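(* Let $\nu$ be a partition of a positive even integer into odd parts, and let $\lambda$ be a balanced partition with $|\lambda|\ge|\nu|$. Let $(\alpha,\beta)$ be the 2-quotient of $\lambda$. Then $$\mathbf g_\nu(\lambda)=\frac{2^{|\nu|/2}}{\mathfrak z(\nu)}\sum_{\mu}\sigma_\mu\,\chi^\mu(\nu)\,\mathbf s_a(\alpha)\,\mathbf s_b(\beta),$$ where the sum runs over all balanced partitions $\mu$ with $|\mu|=|\nu|$ whose Young diagram is contained in the Young diagram of $\lambda$, and $(a,b)$ denotes the 2-quotient of $\mu$.
   Context: Characters. For a partition $\lambda$ of $n$, $\chi^\lambda$ is the character of the irreducible representation of the symmetric group $S(n)$ indexed by $\lambda$ (with $(n)$ giving the trivial representation), $\dim\lambda$ its dimension, and $\chi^\lambda(\eta)$ its value on permutations of cycle type $\eta$. $C_\eta$ is the conjugacy class of cycle type $\eta$; $\mathfrak z(\eta)=\prod_{i\ge1} i^{m_i(\eta)}m_i(\eta)!$, where $m_i(\eta)$ is the number of parts equal to $i$. Put $$\mathbf f_\eta(\lambda)=|C_\eta|\frac{\chi^\lambda(\eta)}{\dim\lambda},\qquad \mathbf g_\nu(\lambda)=\frac{\mathbf f_{(\nu,2,2,\dots,2)}(\lambda)}{\mathbf f_{(2,2,\dots,2)}(\lambda)},$$ where $(\nu,2,\dots,2)$ is $\nu$ completed by parts equal to $2$ to a partition of $|\lambda|$, and $(2,\dots,2)$ is the partition of $|\lambda|$ with all parts equal to 2 ($\chi^\lambda(2,\dots,2)\neq0$ for balanced $\lambda$). Balanced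 partitions and 2-quotients. A partition is balanced if its Young diagram can be obtained from the empty one by successively adding dominoes (pairs of adjacent cells), each intermediate shape being a Young diagram. For a partition $\lambda=(\lambda_1\ge\lambda_2\ge\dots)$ (extended by zeros) let $M(\lambda)=\{\lambda_i-i+\tfrac12: i\ge1\}\subset\mathbb Z+\tfrac12$. For $\lambda$ balanced, its 2-quotient is the pair of partitions $(\alpha,\beta)$ determined by $M(\alpha)=\{(x+\tfrac12)/2: x\in M(\lambda)\cap(2\mathbb Z+\tfrac12)\}$ and $M(\beta)=\{(x-\tfrac12)/2: x\in M(\lambda)\cap(2\mathbb Z-\tfrac12)\}$; one has $|\alpha|+|\beta|=|\lambda|/2$. Sign. For balanced $\mu$, $\sigma_\mu=(-1)^{o/2}$, where $o$ (necessarily even) is the number of odd parts of $\mu$. Shifted Schur functions. With $(x\downharpoonright k)=x(x-1)\cdots(x-k+1)$, $$\mathbf s_\mu(x_1,\dots,x_n)=\frac{\det[(x_i+n-i\downharpoonright\mu_j+n-j)]_{1\le i,j\le n}}{\det[(x_i+n-i\downharpoonright n-j)]_{1\le i,j\le n}}\qquad(n\ge\ell(\mu)),$$ which satisfies $\mathbf s_\mu(x_1,\dots,x_n,0)=\mathbf s_\mu(x_1,\dots,x_n)$; for a partition $\alpha$, $\mathbf s_\mu(\alpha)=\mathbf s_\mu(\alpha_1,\dots,\alpha_n)$ for any $n\ge\max(\ell(\mu),\ell(\alpha))$. *)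

(* Defs.v *)
From mathcomp Require Import all_boot all_order all_algebra all_fingroup.
From mathcomp Require Import all_solvable all_field all_character.
From mathcomp Require Import boolp classical_sets functions cardinality fsbigop.

Set Implicit Arguments.
Unset Strict Implicit.
Unset Printing Implicit Defensive.

Import Order.TTheory GRing.Theory Num.Theory.
Local Open Scope ring_scope.

(* Partitions are weakly decreasing lists of positive integers; the size of
   [la] is [sumn la], its length is [size la], and its parts, indexed from 0
   and extended by zeros, are [nth 0 la i]. *)
Definition is_partition (la : seq nat) : bool :=
  sorted geq la && (0%N \notin la).

(* Cells are pairs (row, column), indexed from 0. *)
Definition diagram (la : seq nat) : set (nat * nat) :=
  [set c | (c.2 < nth 0 la c.1)%N]%classic.

Definition adjacent (c d : nat * nat) : Prop :=
  d = (c.1, c.2.+1) \/ d = (c.1.+1, c.2).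

Definition adds_domino (la mu : seq nat) : Prop :=
  exists c d : nat * nat,
    [/\ adjacent c d, ~ diagram la c, ~ diagram la d &
        diagram mu = (diagram la `|` [set c; d])%classic].

Inductive balanced : seq nat -> Prop :=
| balanced_nil : balanced [::]
| balanced_step la mu :
    balanced la -> is_partition mu -> adds_domino la mu -> balanced mu.

(* With [i] starting at 0, la_i - i + 1/2 becomes nth 0 la i - i - 1/2. *)
Definition maya (la : seq nat) : set rat :=
  [set x | exists i : nat, x = (nth 0%N la i)%:R - i%:R - 2^-1]%classic.

Definition is_two_quotient (la : seq nat) (ab : seq nat * seq nat) : Prop :=
  [/\ is_partition ab.1, is_partition ab.2,
      maya ab.1 = [set (x + 2^-1) / 2 | x in
        maya la `&` [set x | exists k : int, x = 2 * k%:~R + 2^-1]]%classic &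
      maya ab.2 = [set (x - 2^-1) / 2 | x in
        maya la `&` [set x | exists k : int, x = 2 * k%:~R - 2^-1]]%classic].

(* For balanced [la] there is exactly one such pair; the default value is only
   used when there is none. *)
Definition two_quotient (la : seq nat) : seq nat * seq nat :=
  xget ([::], [::]) [set ab | is_two_quotient la ab]%classic.

(* The Specht module of [la], for [n = sumn la]. The cells of [la] are numbered
   0, 1, ..., n-1 row by row: [reshape_index la i] and [reshape_offset la i] are
   the row and the column of the cell number [i]. *)
Definition row_stabilizer (n : nat) (la : seq nat) : {set 'S_n} :=
  [set s : 'S_n | [forall i, reshape_index la (s i) == reshape_index la i]]%SET.

Definition column_stabilizer (n : nat) (la : seq nat) : {set 'S_n} :=
  [set s : 'S_n | [forall i, reshape_offset la (s i) == reshape_offset la i]]%SET.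

Definition symmetric_group (n : nat) : {group 'S_n} := [set: 'S_n]%G.

(* The Young symmetrizer, in the basis of the group algebra in which
   [regular_repr] is written. *)
Definition young_symmetrizer (n : nat) (la : seq nat) :
    'rV[algC]_#|symmetric_group n| :=
  \sum_(p in row_stabilizer n la) \sum_(q in column_stabilizer n la)
    (-1) ^+ odd_perm q *:
      delta_mx 0 (gring_index (symmetric_group n) (p * q)%g).

(* The right ideal generated by the Young symmetrizer. For [la = [:: n]] the
   latter is the sum of all permutations, which spans the trivial module. *)
Definition specht_mx (n : nat) (la : seq nat) :=
  cyclic_mx (regular_repr algC (symmetric_group n)) (young_symmetrizer n la).

Definition specht_repr (n : nat) (la : seq nat) :
    mx_representation algC (symmetric_group n) (\rank (specht_mx n la)) :=
  submod_repr (cyclic_mx_module (regular_repr algC (symmetric_group n))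
                 (young_symmetrizer n la)).

Definition specht_char (n : nat) (la : seq nat) : 'CF(symmetric_group n) :=
  cfRepr (specht_repr n la).

(* Cycle types are compared as multisets: [eta] need not be sorted. The porbits
   of [s] are its cycles, fixed points included. *)
Definition cycle_class (n : nat) (eta : seq nat) : {set 'S_n} :=
  [set s : 'S_n | perm_eq [seq #|X| | X : {set 'I_n} in porbits s] eta]%SET.

(* The value of the irreducible character indexed by [la] on the permutations
   of cycle type [eta], for [sumn eta = sumn la]. *)
Definition chi (la eta : seq nat) : algC :=
  specht_char (sumn la) la (repr (cycle_class (sumn la) eta)).

Definition dimension (la : seq nat) : nat := \rank (specht_mx (sumn la) la).

Definition zfrak (eta : seq nat) : nat :=
  (\prod_(1 <= i < (sumn eta).+1) (i ^ count_mem i eta * (count_mem i eta)`!))%N.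

Definition f_char (eta la : seq nat) : algC :=
  #|cycle_class (sumn la) eta|%:R * (chi la eta / (dimension la)%:R).

(* [eta] completed by parts equal to 2 to a partition of [n], up to order. *)
Definition complete_by_2 (n : nat) (eta : seq nat) : seq nat :=
  eta ++ nseq ((n - sumn eta)./2) 2.

Definition g_char (nu la : seq nat) : algC :=
  f_char (complete_by_2 (sumn la) nu) la
    / f_char (complete_by_2 (sumn la) [::]) la.

Definition sigma (mu : seq nat) : algC := (-1) ^+ (count odd mu)./2.

Definition falling (F : fieldType) (x : F) (k : nat) : F :=
  \prod_(j < k) (x - j%:R).

(* With indices starting at 0, n - i becomes n - i.+1. *)
Definition shifted_schur (F : fieldType) (n : nat) (mu : seq nat)
    (x : 'I_n -> F) : F :=
  \det (\matrix_(i < n, j < n)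
          falling (x i + (n - i.+1)%N%:R) (nth 0%N mu j + (n - j.+1))%N)
  / \det (\matrix_(i < n, j < n)
          falling (x i + (n - i.+1)%N%:R) (n - j.+1)%N).

Definition shifted_schur_at (mu al : seq nat) : algC :=
  shifted_schur mu
    (fun i : 'I_(maxn (size mu) (size al)) => (nth 0%N al i)%:R).

(* Main.v *)
Require Import Defs.
From mathcomp Require Import all_boot all_order all_algebra all_fingroup.
From mathcomp Require Import all_solvable all_field all_character.
From mathcomp Require Import zify ring lra.

(* Write [l = la + delta] for a partition [la]. The class function
   [phi_la = sum_w sgn(w) pi_(l - w delta)], where [pi_k] is the permutation
   character on the colorings with content [k], has norm 1 by Pieri's rule. The
   Specht module embeds both in the permutation module [pi_la] and in the
   sign-twisted one [eps] given by the columns of [la]. Counting 0-1 matrices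
   with given margins shows that [<pi_k, eps>] is 1 for [k = la] and 0 for the
   other [k = l - w delta]; so the Specht character [chi] has norm 1 and
   [<phi_la, chi> = 1], hence [chi = phi_la].

   For fixed [eta], [phi_la] at [eta] is an alternating function [B] of [l], and
   adjoining a cycle of length 2 replaces [B] by [sum_i B (l - 2 e_i)]. Split [l]
   by parity into [2 x] and [2 y + 1]: then [x] and [y] are the shifted parts of
   the 2-quotient, and by induction on [k] adjoining [k] such cycles gives
   [k! sum_(a, b) G(x, a) G(y, b) B(2 a, 2 b + 1)] where
   [G(x, a) = det (1 / (x_i - a_j)!)]. The ratio [G(x, a) / G(x, delta)] is the
   shifted Schur function, and the sign of the permutation sorting
   [(2 a, 2 b + 1)] is [sigma] up to a constant. *)

Set Implicit Arguments.
Unset Strict Implicit.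
Unset Printing Implicit Defensive.

Import Order.TTheory GRing.Theory Num.Theory.
Local Open Scope ring_scope.

(** * Symmetric functions as operators on coefficient functions *)

(** The abacus carries [2 K] beads, [K] on each runner, with [K] bounding the lengths of [la],
    [alpha] and [beta]. An even number of beads makes bead parity agree with the half-integer
    convention of the 2-quotient, and one [K] for all partitions turns their characters at [nu] into
    values of one function [B]. The factor in front of the sum comes from class sizes alone; what is
    left is a quotient of two character values of [la]. Both carry the sign of the permutation
    sorting [la] by parity, which cancels. The same sign for the empty partition survives: it is the
    constant by which [sigma] differs from a sorting sign. When all parts are 2, [B] is the
    Vandermonde alternant and only the pair of staircases contributes, which produces the
    denominators of the shifted Schur functions. Containment in [la] appears because [G(x, a)]
    vanishes unless [a] lies below [x]. On the Specht side nothing is assumed irreducible: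
    embeddings enter only as inequalities between inner products, and nonvanishing supplies the
    lower bound 1. *)

Lemma big_ffun_unlift (R : Type) (idx : R) (op : Monoid.com_law idx)
    (T : finType) (m : nat) (p : 'I_m.+1) (F : {ffun 'I_m.+1 -> T} -> R) :
  \big[op/idx]_f F f =
  \big[op/idx]_(t : T) \big[op/idx]_(g : {ffun 'I_m -> T})
     F [ffun i => oapp g t (unlift p i)].
Proof.
rewrite pair_bigA /=.
rewrite (reindex (fun q : T * {ffun 'I_m -> T} =>
   [ffun i => oapp q.2 q.1 (unlift p i)])) //=.
exists (fun f : {ffun 'I_m.+1 -> T} => (f p, [ffun i => f (lift p i)])).
  move=> [t g] _ /=; rewrite ffunE unlift_none /=; congr (_, _).
  by apply/ffunP=> i; rewrite !ffunE liftK.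
move=> f _; apply/ffunP=> i; rewrite !ffunE /=.
by case: unliftP => [j ->|->] //=; rewrite ffunE.
Qed.

Lemma ffun0_eq (T : Type) (f g : {ffun 'I_0 -> T}) : f = g.
Proof. by apply/ffunP=> -[]. Qed.

Lemma big_ffun0 (R : Type) (idx : R) (op : Monoid.com_law idx) (T : finType)
    (F : {ffun 'I_0 -> T} -> R) (f0 : {ffun 'I_0 -> T}) :
  \big[op/idx]_f F f = F f0.
Proof.
by rewrite (big_pred1 f0) // => f; apply/esym/eqP/ffun0_eq.
Qed.

Definition unitv (N : nat) (i : 'I_N) : {ffun 'I_N -> int} :=
  [ffun j => (j == i)%:Z].

Definition permv (N : nat) (w : 'S_N) (v : {ffun 'I_N -> int}) :
    {ffun 'I_N -> int} := [ffun i => v (w i)].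

Definition staircase (N : nat) : {ffun 'I_N -> int} :=
  [ffun i : 'I_N => (N - i.+1)%N%:Z].

(* A function [A] on exponent vectors stands for the Laurent polynomial with
   coefficients [A]: [alternant] is the Vandermonde polynomial, [psum k] is
   the multiplication by the power sum of degree [k]. *)
Definition alternating (N : nat) (A : {ffun 'I_N -> int} -> algC) : Prop :=
  forall (w : 'S_N) v, A (permv w v) = (-1) ^+ odd_perm w * A v.

Definition nneg_support (N : nat) (A : {ffun 'I_N -> int} -> algC) : Prop :=
  forall (v : {ffun 'I_N -> int}) i, v i < 0 -> A v = 0.

Definition alternant (N : nat) (v : {ffun 'I_N -> int}) : algC :=
  \sum_(w : 'S_N) (-1) ^+ odd_perm w * (v == permv w (staircase N))%:R.

Definition psum (N k : nat) (A : {ffun 'I_N -> int} -> algC)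
    (v : {ffun 'I_N -> int}) : algC := \sum_(i < N) A (v - unitv i *+ k).

Definition psums (N : nat) (eta : seq nat) (A : {ffun 'I_N -> int} -> algC) :
    {ffun 'I_N -> int} -> algC := foldr (@psum N) A eta.

Lemma ffunMnE (aT : finType) (f : {ffun aT -> int}) n x : (f *+ n) x = f x *+ n.
Proof. by elim: n => [|n IHn]; rewrite ?mulr0n ?ffunE // !mulrS ffunE IHn. Qed.

Lemma alternating_alternant N : alternating (@alternant N).
Proof.
move=> u v; rewrite /alternant mulr_sumr (reindex_inj (mulgI u)) /=.
apply: eq_bigr => w _; rewrite odd_permM signr_addb mulrA; congr (_ * _%:R).
congr nat_of_bool; apply/eqP/eqP => [/ffunP h | ->].
  by apply/ffunP=> i; have := h (u^-1 i)%g; rewrite !ffunE permM permKV.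
by apply/ffunP=> i; rewrite !ffunE permM.
Qed.

Lemma nneg_support_alternant N : nneg_support (@alternant N).
Proof.
move=> v i vi; rewrite /alternant big1 // => w _.
by case: eqP => [e|]; rewrite ?mulr0 //; move: vi; rewrite e !ffunE.
Qed.

Lemma alternating_psum N k (A : {ffun 'I_N -> int} -> algC) :
  alternating A -> alternating (psum k A).
Proof.
move=> altA u v; rewrite /psum mulr_sumr [RHS](reindex_inj (@perm_inj _ u)) /=.
apply: eq_bigr => i _; rewrite -altA; congr A; apply/ffunP=> j.
by rewrite !(ffunE, ffunMnE) (inj_eq perm_inj).
Qed.

Lemma nneg_support_psum N k (A : {ffun 'I_N -> int} -> algC) :
  nneg_support A -> nneg_support (psum k A).
Proof.
move=> nnA v i vi; rewrite /psum big1 // => j _; apply: (nnA _ i).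
rewrite !(ffunE, ffunMnE); apply: le_lt_trans vi; rewrite gerBl.
by rewrite mulrn_wge0.
Qed.

Lemma alternating_psums N eta (A : {ffun 'I_N -> int} -> algC) :
  alternating A -> alternating (psums eta A).
Proof. by move=> altA; elim: eta => //= k eta; apply: alternating_psum. Qed.

Lemma nneg_support_psums N eta (A : {ffun 'I_N -> int} -> algC) :
  nneg_support A -> nneg_support (psums eta A).
Proof. by move=> nnA; elim: eta => //= k eta; apply: nneg_support_psum. Qed.

Lemma eq_psum N k (A B : {ffun 'I_N -> int} -> algC) :
  A =1 B -> psum k A =1 psum k B.
Proof. by move=> eqAB v; apply: eq_bigr => i _. Qed.

Lemma psumC N j k (A : {ffun 'I_N -> int} -> algC) :
  psum j (psum k A) =1 psum k (psum j A).
Proof.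
move=> v; rewrite /psum exchange_big; apply: eq_bigr => i _.
by apply: eq_bigr => i' _; congr A; rewrite addrAC.
Qed.

Lemma psums_rem N k eta (A : {ffun 'I_N -> int} -> algC) :
  k \in eta -> psums eta A =1 psum k (psums (rem k eta) A).
Proof.
elim: eta => //= j eta IH; rewrite inE; case: (eqVneq k j) => [->|] //=.
move=> _ /IH {}IH v; rewrite psumC /=.
exact: eq_psum.
Qed.

Lemma perm_psums N eta eta' (A : {ffun 'I_N -> int} -> algC) :
  perm_eq eta eta' -> psums eta A =1 psums eta' A.
Proof.
elim: eta eta' => [|k eta IH] eta' eqe v.
  by move: eqe; rewrite perm_sym => /perm_nilP ->.
have k_in : k \in eta' by rewrite -(perm_mem eqe) mem_head.
rewrite (psums_rem A k_in) /=; apply: eq_psum => u; apply: IH.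
by rewrite -(perm_cons k) (perm_trans eqe) // perm_to_rem.
Qed.

(** Each part of [eta] picks the variable it is charged to. Such choices are the colorings constant
    on the cycles of a permutation, the form used in [det_char_psums]. *)
Lemma psumsE N eta (A : {ffun 'I_N -> int} -> algC) v :
  psums eta A v =
  \sum_(d : {ffun 'I_(size eta) -> 'I_N})
     A (v - \sum_i unitv (d i) *+ nth 0%N eta i).
Proof.
elim: eta v => [|k eta IH] v /=.
  rewrite (big_ffun0 _ _ (ffun0 (card_ord 0))).
  by rewrite big_ord0 subr0.
rewrite (big_ffun_unlift _ ord0) /psum; apply: eq_bigr => i _.
rewrite IH; apply: eq_bigr => d _; congr A.
rewrite big_ord_recl ffunE unlift_none /= -addrA -opprD; congr (_ - (_ + _)).
by apply: eq_bigr => j _; rewrite ffunE liftK.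
Qed.

(** * Pieri's rule and the evaluation of products of complete polynomials *)

(** Exponent vectors are confined to a box, so that summing over all vectors below a given one is a
    sum over a finite type. *)
Definition boxperm (N M : nat) (w : 'S_N) (b : {ffun 'I_N -> 'I_M}) :
    {ffun 'I_N -> 'I_M} := [ffun i => b (w i)].

Definition box_alternating (N M : nat) (A : {ffun 'I_N -> 'I_M} -> algC) :=
  forall (w : 'S_N) b, A (boxperm w b) = (-1) ^+ odd_perm w * A b.

(* Multiplication by the complete homogeneous polynomial of degree [k]. *)
Definition hsum (N M k : nat) (A : {ffun 'I_N -> 'I_M} -> algC)
    (l : {ffun 'I_N -> 'I_M}) : algC :=
  \sum_(b : {ffun 'I_N -> 'I_M} |
        [forall i, (b i <= l i)%N] && (\sum_i l i == \sum_i b i + k)%N) A b.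

Lemma boxpermM N M (u w : 'S_N) (b : {ffun 'I_N -> 'I_M}) :
  boxperm u (boxperm w b) = boxperm (u * w)%g b.
Proof. by apply/ffunP=> i; rewrite !ffunE permM. Qed.

Lemma boxperm1 N M (b : {ffun 'I_N -> 'I_M}) : boxperm 1%g b = b.
Proof. by apply/ffunP=> i; rewrite !ffunE perm1. Qed.

Lemma boxpermK N M (w : 'S_N) : cancel (@boxperm N M w) (boxperm w^-1%g).
Proof. by move=> b; rewrite boxpermM mulVg boxperm1. Qed.

Lemma sum_boxperm N M (w : 'S_N) (b : {ffun 'I_N -> 'I_M}) :
  (\sum_i boxperm w b i = \sum_i b i)%N.
Proof.
by rewrite [RHS](reindex_inj (@perm_inj _ w)); apply: eq_bigr => i _; rewrite ffunE.
Qed.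

Lemma box_alternating_hsum N M k (A : {ffun 'I_N -> 'I_M} -> algC) :
  box_alternating A -> box_alternating (hsum k A).
Proof.
move=> altA w l; rewrite /hsum mulr_sumr (reindex_inj (can_inj (@boxpermK N M w))).
apply: eq_big => [b|b _]; last exact: altA.
rewrite !sum_boxperm; congr andb; apply/forallP/forallP => h i.
  by have := h (w^-1 i)%g; rewrite !ffunE permKV.
by rewrite !ffunE.
Qed.

(** The involution may have fixed points: there [F x = - F x] forces [F x = 0]. Showing that twice
    the sum is 0 treats both cases at once. *)
Lemma sum_antisym (T : finType) (P : pred T) (u : T -> T) (F : T -> algC) :
    involutive u -> (forall x, P x -> P (u x)) -> (forall x, F (u x) = - F x) ->
  \sum_(x | P x) F x = 0.
Proof.
move=> uK Pu Fu; apply/eqP; rewrite -[_ == 0](mulrn_eq0 _ 2) /= mulr2n.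
rewrite {1}(reindex_inj (inv_inj uK)) -[X in _ + X]opprK subr_eq0 -sumrN.
by apply/eqP/eq_big => [x|x _]; [apply/idP/idP => /Pu; rewrite ?uK | rewrite Fu].
Qed.

(* The summands with [b i <= l i.+1] cancel in pairs, by exchanging [b i] and
   [b i.+1]; this is done for one [i] at a time. *)
Lemma hsum_interlacing N M k (A : {ffun 'I_N -> 'I_M} -> algC)
    (l : {ffun 'I_N -> 'I_M}) :
    box_alternating A -> (forall i j : 'I_N, (i < j)%N -> (l j < l i)%N) ->
  hsum k A l =
  \sum_(b : {ffun 'I_N -> 'I_M} |
      [&& [forall i, (b i <= l i)%N],
          [forall i : 'I_N, forall j : 'I_N, (j == i.+1 :> nat) ==> (l j < b i)%N]
        & (\sum_i l i == \sum_i b i + k)%N]) A b.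
Proof.
move=> altA decl.
pose Q t (b : {ffun 'I_N -> 'I_M}) := [forall i : 'I_N, forall j : 'I_N,
  (i < t)%N && (j == i.+1 :> nat) ==> (l j < b i)%N].
have step t : hsum k A l = \sum_(b : {ffun 'I_N -> 'I_M} |
    [&& [forall i, (b i <= l i)%N], Q t b & (\sum_i l i == \sum_i b i + k)%N]) A b.
  elim: t => [|t ->].
    apply: eq_bigl => b; congr andb; rewrite /Q.
    suff -> : [forall i : 'I_N, forall j : 'I_N,
      (i < 0)%N && (j == i.+1 :> nat) ==> (l j < b i)%N] by [].
    by apply/forallP=> i; apply/forallP=> j; rewrite ltn0.
  case: (ltnP t.+1 N) => [tN|Nt]; last first.
    apply: eq_bigl => b; congr [&& _, _ & _]; rewrite /Q.
    apply/forallP/forallP => h i; apply/forallP=> j; apply/implyP.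
      case/andP=> _ /eqP ji; have /forallP/(_ j)/implyP := h i; apply.
      rewrite ji eqxx andbT; have := ltn_ord j; rewrite ji => {}ji.
      by move: (leq_trans ji Nt); rewrite ltnS.
    case/andP=> it ji; have /forallP/(_ j)/implyP := h i; apply.
    by rewrite ltnS (ltnW it).
  (* The exchange acts where [b i0 <= l j0]. The bound by [l] survives since [l j0 < l i0], and
     [Q t] only constrains entries of index less than [t], which stay put. *)
  pose i0 := Ordinal (ltnW tN); pose j0 := Ordinal tN.
  have ij0 : i0 != j0 by rewrite -val_eqE /= neq_ltn ltnSn.
  rewrite (bigID (fun b : {ffun 'I_N -> 'I_M} => (l j0 < b i0)%N)) /=.
  rewrite [X in _ + X](@sum_antisym _ _ (boxperm (tperm i0 j0))) ?addr0.
  - apply: eq_bigl => b; rewrite -!andbA; congr andb; rewrite andbC -andbA andbC.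
    congr andb; rewrite /Q; apply/andP/forallP => [[lb /forallP h] i|h].
      apply/forallP=> j; apply/implyP=> /andP[]; rewrite ltnS leq_eqVlt.
      case/orP=> [/eqP it /eqP ji|it ji]; last first.
        by have /forallP/(_ j)/implyP := h i; apply; rewrite it.
      have -> : i = i0 by apply/val_inj.
      by have -> : j = j0 by apply/val_inj; rewrite /= ji it.
    split; first by have /forallP/(_ j0)/implyP := h i0; apply; rewrite /= ltnSn eqxx.
    apply/forallP=> i; apply/forallP=> j; apply/implyP=> /andP[it ji].
    by have /forallP/(_ j)/implyP := h i; apply; rewrite ltnS (ltnW it).
  - by move=> b; rewrite boxpermM tperm2 boxperm1.
  - move=> b /andP[/and3P[/forallP ble /forallP Qb sb]]; rewrite -leqNgt => lb.
    rewrite -leqNgt sum_boxperm sb andbT ffunE tpermL (ble j0) andbT.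
    apply/andP; split; apply/forallP=> i.
      rewrite ffunE; case: tpermP => [->|->|_ _] //.
      by apply: leq_trans (ble j0) _; apply/ltnW/decl; rewrite /= ltnSn.
    apply/forallP=> j; apply/implyP=> /andP[it ji].
    have /forallP/(_ j)/implyP := Qb i; rewrite it ji => /(_ isT).
    rewrite ffunE tpermD // -val_eqE /= neq_ltn ?it ?orbT //.
    by rewrite ltnS (ltnW it) orbT.
  by move=> b; rewrite altA odd_tperm ij0 expr1 mulN1r.
rewrite (step N); apply: eq_bigl => b; congr [&& _, _ & _]; rewrite /Q.
by apply/eq_forallb=> i; apply/eq_forallb=> j; rewrite ltn_ord.
Qed.


Fixpoint hsums (N M : nat) (mu : nat -> nat) (r : nat)
    (A : {ffun 'I_N -> 'I_M} -> algC) : {ffun 'I_N -> 'I_M} -> algC :=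
  if r is r'.+1 then hsum (mu r') (hsums mu r' A) else A.

Definition box_alternant (N M : nat) (b : {ffun 'I_N -> 'I_M}) : algC :=
  alternant [ffun i => (b i : nat)%:Z].

Lemma box_alternating_hsums N M mu r (A : {ffun 'I_N -> 'I_M} -> algC) :
  box_alternating A -> box_alternating (hsums mu r A).
Proof. by move=> altA; elim: r => //= r; apply: box_alternating_hsum. Qed.

Lemma box_alternating_alternant N M : box_alternating (@box_alternant N M).
Proof.
move=> w b; rewrite /box_alternant -alternating_alternant; congr alternant.
by apply/ffunP=> i; rewrite !ffunE.
Qed.

Lemma perm_mono_leq N (w : 'S_N) :
  (forall i j : 'I_N, (i < j)%N -> (w i < w j)%N) -> forall i : 'I_N, (i <= w i)%N.
Proof.
move=> mono; suff h k (i : 'I_N) : (i <= k)%N -> (i <= w i)%N by move=> i; apply: (h i).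
elim: k i => [|k IHk] i; first by rewrite leqn0 => /eqP ->.
rewrite leq_eqVlt => /orP[/eqP ik|]; last by rewrite ltnS; apply: IHk.
have kN : (k < N)%N by rewrite -ltnS -ik ltnW // ltnS ltn_ord.
rewrite ik; apply: leq_ltn_trans (mono (Ordinal kN) i _); last by rewrite /= ik.
by apply: (IHk (Ordinal kN)).
Qed.

Lemma perm_mono N (w : 'S_N) :
  (forall i j : 'I_N, (i < j)%N -> (w i < w j)%N) -> w = 1%g.
Proof.
move=> mono; apply/permP=> i; rewrite perm1; apply/val_inj/eqP => /=.
rewrite eqn_leq perm_mono_leq // andbT -{2}(permK w i); apply: perm_mono_leq.
move=> j j' jj'; rewrite ltnNge leq_eqVlt; apply/norP; split.
  by apply/eqP=> /val_inj/perm_inj e; move: jj'; rewrite e ltnn.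
by apply/negP=> /mono; rewrite !permKV ltnNge ltnW.
Qed.

Lemma strict_dec_staircase N (l : 'I_N -> nat) :
    (forall i j : 'I_N, (i < j)%N -> (l j < l i)%N) ->
  forall i : 'I_N, (N - i.+1 <= l i)%N.
Proof.
move=> decl; suff h k (i : 'I_N) : (N - i.+1 = k)%N -> (k <= l i)%N.
  by move=> i; apply: h.
elim: k i => // k IHk i ik.
have iN : (i.+1 < N)%N by rewrite -subn_gt0 ik.
apply: leq_ltn_trans (IHk (Ordinal iN) _) (decl i (Ordinal iN) _) => //=.
by rewrite subnS ik.
Qed.

Lemma alternant_strict_dec N (v : {ffun 'I_N -> int}) :
    (forall i j : 'I_N, (i < j)%N -> v j < v i) ->
  alternant v = (v == staircase N)%:R.
Proof.
move=> decv; rewrite /alternant (bigD1 1%g) //= odd_perm1 expr0 mul1r.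
rewrite big1 ?addr0 => [|w w1].
  by congr (_ == _)%:R; apply/ffunP=> i; rewrite !ffunE perm1.
case: eqP => [vw|]; last by rewrite mulr0.
case/eqP: w1; apply: perm_mono => i j /decv; rewrite vw !ffunE ltz_nat.
have := ltn_ord (w i); have := ltn_ord (w j); lia.
Qed.

(** Kostka triangularity. The coefficient counts semistandard tableaux of shape [l] minus the
    staircase whose content is given by the first [r] values of [mu], and a tableau exists only if
    its shape dominates its content. The last hypothesis is the opposite dominance, so only the
    tableau with row [i] filled by [i] is left. [mu] is an arbitrary sequence, as the weights
    [la + delta - w delta] require. *)
Lemma hsums_alternant N M (mu : nat -> nat) r (l : {ffun 'I_N -> 'I_M}) :
    (forall i j : 'I_N, (i < j)%N -> (l j < l i)%N) -> (r <= N)%N ->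
    (forall j, (j <= r)%N -> (\sum_(i < N | (i < j)%N) l i <=
       \sum_(i < N | (i < j)%N) (mu i + (N - i.+1)))%N) ->
  hsums mu r (@box_alternant N M) l =
  [forall i : 'I_N, l i == ((if i < r then mu i else 0) + (N - i.+1))%N :> nat]%:R.
Proof.
elim: r l => [|r IHr] l decl rN ps.
  rewrite /= /box_alternant alternant_strict_dec; last first.
    by move=> i j ij; rewrite !ffunE ltz_nat decl.
  congr (nat_of_bool _)%:R; apply/eqP/forallP => [/ffunP h i|h].
    by have := h i; rewrite !ffunE => -[->]; rewrite add0n.
  by apply/ffunP=> i; rewrite !ffunE; have /eqP -> := h i.
rewrite /= hsum_interlacing //; last first.
  exact: box_alternating_hsums (@box_alternating_alternant N M).
pose r0 := Ordinal rN.
have dec_interl (b : {ffun 'I_N -> 'I_M}) : [forall i, (b i <= l i)%N] ->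
    [forall i : 'I_N, forall j : 'I_N, (j == i.+1 :> nat) ==> (l j < b i)%N] ->
    forall i j : 'I_N, (i < j)%N -> (b j < b i)%N.
  move=> /forallP ble /forallP blt i j ij.
  have i1N : (i.+1 < N)%N by apply: leq_ltn_trans ij (ltn_ord j).
  have /forallP/(_ (Ordinal i1N))/implyP/(_ (eqxx _)) := blt i.
  apply: leq_ltn_trans; apply: leq_trans (ble j) _.
  move: ij; rewrite leq_eqVlt => /orP[/eqP e|ij]; last first.
    by apply/ltnW/(decl (Ordinal i1N)).
  by rewrite (_ : Ordinal i1N = j) //; apply: val_inj.
have IH (b : {ffun 'I_N -> 'I_M}) : [forall i, (b i <= l i)%N] ->
    [forall i : 'I_N, forall j : 'I_N, (j == i.+1 :> nat) ==> (l j < b i)%N] ->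
    hsums mu r (@box_alternant N M) b =
  [forall i : 'I_N, b i == ((if i < r then mu i else 0) + (N - i.+1))%N :> nat]%:R.
  move=> ble blt; apply: IHr; [exact: dec_interl | exact: ltnW |].
  move=> j jr; apply: leq_trans (ps j (ltnW _)) => //.
  by apply: leq_sum => i _; apply: (forallP ble).
(* If some [b] contributed, its rows before [r] would be given by [mu]. The prefix bound then forces
   [l = b] there, interlacing pushes the rows after [r] down to the staircase, and the degree fixes
   row [r]: [l] would have the excluded form. *)
case: forallP => [lE|nlE]; last first.
  rewrite big1 // => b /and3P[ble blt /eqP sb]; rewrite IH //.
  case: forallP => // bE; case: nlE.
  have lr (i : 'I_N) : (i < r)%N -> l i = b i.
    move=> ir; apply/val_inj/eqP; rewrite /= eq_sym.
    have := (leqif_sum (fun (i : 'I_N) (_ : (i < r)%N) => leqif_eq (forallP ble i))).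
    case=> _; rewrite eqn_leq leq_sum => [|k _]; last exact: (forallP ble).
    have -> : (\sum_(i < N | (i < r)%N) l i <= \sum_(i < N | (i < r)%N) b i)%N.
      apply: leq_trans (ps r _) _ => //; apply: leq_sum => k kr.
      by have /eqP -> := bE k; rewrite kr.
    by move/esym/forallP/(_ i)/implyP/(_ ir).
  have lgt (i : 'I_N) : (r < i)%N -> l i = (N - i.+1)%N :> nat.
    move=> ri; apply/eqP; rewrite eqn_leq (strict_dec_staircase decl) andbT.
    have i1N : (i.-1 < N)%N by apply: leq_ltn_trans (leq_pred _) (ltn_ord i).
    have /forallP/(_ i)/implyP := forallP blt (Ordinal i1N).
    have /eqP -> := bE (Ordinal i1N); rewrite /= prednK; last lia.
    by have -> : (i <= r)%N = false by [lia]; rewrite eqxx => /(_ isT); lia.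
  have lr0 : l r0 = (b r0 + mu r)%N :> nat.
    move: sb; rewrite (bigD1 r0) //= [X in (_ = X + _)%N](bigD1 r0) //=.
    rewrite (eq_bigr (fun i => b i : nat)) => [|i]; first by rewrite addnAC => /addIn.
    rewrite -val_eqE /= => ir; case: (ltngtP i r) ir => // [/lr -> //|ri _].
    by rewrite lgt //; have /eqP -> := bE i; rewrite ltnNge ltnW.
  move=> i; case: (ltngtP i r) => [ir|ri|ir].
  - by rewrite lr //; have /eqP -> := bE i; rewrite ir ltnS ltnW.
  - by rewrite lgt // ltnS leqNgt ri.
  - have -> : i = r0 by apply: val_inj.
    by rewrite lr0 /= ltnSn; have /eqP -> := bE r0; rewrite /= ltnn; lia.
have lt0M : (N - r.+1 < M)%N.
  by apply: leq_ltn_trans (ltn_ord (l r0)); apply: (strict_dec_staircase decl r0).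
(* The one contributing vector: [l] with row [r] lowered to its staircase value. *)
pose b0 : {ffun 'I_N -> 'I_M} := [ffun i => if i == r0 then Ordinal lt0M else l i].
have b0E (i : 'I_N) : b0 i = ((if (i < r)%N then mu i else 0) + (N - i.+1))%N :> nat.
  rewrite ffunE -val_eqE /=; case: (ltngtP i r) => [ir|ri|->] //=.
    by have /eqP -> := lE i; rewrite ltnS (ltnW ir).
  by have /eqP -> := lE i; rewrite ltnS leqNgt ri.
have b0le : [forall i, (b0 i <= l i)%N].
  apply/forallP=> i; rewrite b0E; have /eqP -> := lE i.
  by rewrite leq_add2r; case: (ltnP i r) => [ir|//]; rewrite ltnS (ltnW ir).
have b0lt : [forall i : 'I_N, forall j : 'I_N,
    (j == i.+1 :> nat) ==> (l j < b0 i)%N].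
  apply/forallP=> i; apply/forallP=> j; apply/implyP=> /eqP ji.
  rewrite ffunE -val_eqE /=; case: eqP => [ir|_]; last by rewrite decl ?ji.
  have /eqP -> := lE j; rewrite ji ir ltnn /= add0n.
  by have := ltn_ord j; rewrite ji ir; lia.
rewrite (bigD1 b0) /=; last first.
  rewrite b0le b0lt /=; apply/eqP; rewrite (bigD1 r0) //= [in RHS](bigD1 r0) //=.
  rewrite b0E /= ltnn add0n; have /eqP -> := lE r0; rewrite /= ltnSn.
  rewrite (eq_bigr (fun i => b0 i : nat)) => [|i ir]; first by rewrite -addnA addnC.
  by rewrite ffunE (negPf ir).
rewrite IH // big1 ?addr0 => [|b /andP[/and3P[ble blt _] bb0]].
  by case: forallP => // -[] i; rewrite b0E.
rewrite IH //; case: forallP => // bE; case/eqP: bb0; apply/ffunP=> i.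
by apply: val_inj; rewrite /= b0E; have /eqP -> := bE i.
Qed.

(** * Counting colorings *)

Definition fixes_coloring (n : nat) (X : finType) (s : 'S_n) (e : {ffun 'I_n -> X}) :=
  [forall x, e (s x) == e x].

Definition recolor (n : nat) (X : finType) (s : 'S_n) (e : {ffun 'I_n -> X}) :
  {ffun 'I_n -> X} := [ffun x => e (s x)].

(** Values bounded by [n] make the contents a finite type, by which sums over colorings can be
    partitioned. *)
Definition content (n : nat) (X : finType) (e : {ffun 'I_n -> X}) :
    {ffun X -> 'I_n.+1} :=
  [ffun y => inord #|[set x | e x == y]|].

Lemma contentE n (X : finType) (e : {ffun 'I_n -> X}) y :
  content e y = #|[set x | e x == y]| :> nat.
Proof.
by rewrite ffunE inordK // ltnS (leq_trans (max_card _)) // card_ord.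
Qed.

Lemma sum_content n (X : finType) (e : {ffun 'I_n -> X}) :
  (\sum_y content e y)%N = n.
Proof.
transitivity (\sum_y \sum_(x < n | e x == y) 1)%N.
  by apply: eq_bigr => y _; rewrite contentE sum1dep_card.
rewrite (exchange_big_dep xpredT) //= -[RHS](card_ord n) -sum1_card.
by apply: eq_bigr => x _; rewrite (big_pred1 (e x)) // => y; rewrite eq_sym.
Qed.

Lemma count_mem_codom n (X : finType) (e : {ffun 'I_n -> X}) y :
  count_mem y [tuple e i | i < n] = content e y.
Proof.
rewrite contentE /= cardE [in RHS]/enum_mem size_filter count_map enumT.
by apply: eq_count => x; rewrite !inE.
Qed.

Lemma content_recolor n (X : finType) (s : 'S_n) (e : {ffun 'I_n -> X}) :
  content (recolor s e) = content e.
Proof.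
apply/ffunP=> y; apply: val_inj; rewrite /= !contentE.
rewrite -(card_preimset [set x | e x == y] (@perm_inj _ s)).
by apply: eq_card => x; rewrite !inE ffunE.
Qed.

Lemma content_transitive n (X : finType) (e e' : {ffun 'I_n -> X}) :
  content e = content e' -> exists t : 'S_n, e' = recolor t e.
Proof.
move=> eqc.
have /tuple_permP[t et] :
    perm_eq [tuple e' i | i < n] [tuple e i | i < n].
  by apply/allP=> y _ /=; rewrite !count_mem_codom eqc.
exists t; apply/ffunP=> x; rewrite ffunE.
have := congr1 (fun s => nth (e' x) s x) et.
rewrite /= (nth_map x) ?size_enum_ord // nth_ord_enum => ->.
rewrite (nth_map x) ?size_enum_ord // nth_ord_enum tnth_mktuple //.
Qed.

Lemma content_surj n (X : finType) (a : {ffun X -> 'I_n.+1}) :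
  (\sum_y a y)%N = n -> exists e : {ffun 'I_n -> X}, content e = a.
Proof.
move=> suma; pose s := flatten [seq nseq (a y) y | y <- enum X].
have ss : size s == n.
  rewrite size_flatten /shape -map_comp sumnE big_map -[X in _ == X]suma big_enum.
  by apply/eqP/eq_bigr => y _; rewrite /= size_nseq.
exists [ffun i => tnth (Tuple ss) i]; apply/ffunP=> y; apply: val_inj.
rewrite /= -count_mem_codom.
have -> : [tuple [ffun i => tnth (Tuple ss) i] i | i < n] = Tuple ss.
  by apply: eq_from_tnth => i; rewrite tnth_mktuple ffunE.
rewrite /= count_flatten -map_comp sumnE big_map big_enum (bigD1 y) //=.
rewrite count_nseq /= eqxx mul1n big1 ?addn0 // => z zy.
by rewrite count_nseq /= (negPf zy).
Qed.

(** Orbit and stabilizer: the colorings of a given content form one orbit, and the permutations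
    carrying [e0] to [e] form a coset of the stabilizer of [e], so the stabilizers have total size
    [n!]. *)
Lemma sum_stab_content n (X : finType) (a : {ffun X -> 'I_n.+1}) :
  (\sum_(e : {ffun 'I_n -> X} | content e == a) #|[set s | fixes_coloring s e]|)%N =
  ((\sum_y a y == n)%N * n`!)%N.
Proof.
case: eqP => [/content_surj[e0 e0a]|na]; last first.
  rewrite big1 // => e /eqP ea; case: na; rewrite -ea sum_content //.
rewrite mul1n -card_Sn -sum1_card (partition_big (fun s => recolor s e0)
  (fun e => content e == a)) /= => [|s _]; last by rewrite content_recolor e0a.
apply: eq_bigr => e /eqP ea.
have [t et] : exists t : 'S_n, e = recolor t e0.
  by apply: content_transitive; rewrite ea.
rewrite sum1dep_card -[RHS](card_preimset _ (mulIg t)) /=.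
apply: eq_card => s; rewrite !inE; apply/forallP/eqP => [h|/ffunP h x].
  by apply/ffunP=> x; have /eqP := h x; rewrite et !ffunE permM.
by have := h x; rewrite et !ffunE permM => ->.
Qed.

(** Burnside's lemma, with the orbits on colorings named by their contents. *)
Lemma sum_fixes n (X : finType) (f : {ffun X -> 'I_n.+1} -> algC) :
  \sum_(s : 'S_n) \sum_(e : {ffun 'I_n -> X} | fixes_coloring s e) f (content e) =
  n`!%:R * \sum_(a : {ffun X -> 'I_n.+1} | (\sum_y a y)%N == n) f a.
Proof.
rewrite (exchange_big_dep xpredT) //= (partition_big (@content n X) xpredT) //=.
rewrite mulr_sumr [RHS]big_mkcond; apply: eq_bigr => a _.
transitivity ((\sum_(e : {ffun 'I_n -> X} | content e == a)
   #|[set s | fixes_coloring s e]|)%:R * f a).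
  rewrite natr_sum mulr_suml; apply: eq_bigr => e /eqP <-.
  by rewrite sumr_const cardsE mulr_natl.
by rewrite sum_stab_content; case: eqP; rewrite ?mul1n ?mul0r.
Qed.

(** A pair of colorings is one coloring by pairs. Its content is a matrix of natural numbers, whose
    margins are the contents of the two colorings. *)
Definition ffst (I A B : finType) (e : {ffun I -> A * B}) : {ffun I -> A} :=
  [ffun x => (e x).1].

Definition fsnd (I A B : finType) (e : {ffun I -> A * B}) : {ffun I -> B} :=
  [ffun x => (e x).2].

Lemma sum_ffun_pair (I A B : finType) (F : {ffun I -> A} -> {ffun I -> B} -> algC) :
  \sum_c \sum_d F c d = \sum_(e : {ffun I -> A * B}) F (ffst e) (fsnd e).
Proof.
rewrite pair_bigA /= [RHS](reindex (fun p : {ffun I -> A} * {ffun I -> B} =>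
   [ffun x => (p.1 x, p.2 x)])) /=.
  by apply: eq_bigr => -[c d] _ /=; congr F; apply/ffunP=> x; rewrite !ffunE.
exists (fun e => (ffst e, fsnd e)) => [[c d] _|e _] /=.
  by congr (_, _); apply/ffunP=> x; rewrite !ffunE.
by apply/ffunP=> x; rewrite !ffunE; case: (e x).
Qed.

Lemma fixes_pair n (A B : finType) (s : 'S_n) (e : {ffun 'I_n -> A * B}) :
  fixes_coloring s e = fixes_coloring s (ffst e) && fixes_coloring s (fsnd e).
Proof.
apply/forallP/andP => [h|[/forallP h1 /forallP h2] x].
  by split; apply/forallP=> x; rewrite !ffunE; have /eqP -> := h x.
by have := h1 x; have := h2 x; rewrite !ffunE -pair_eqE /pair_eq /= => -> ->.
Qed.

Lemma content_ffst n (A B : finType) (e : {ffun 'I_n -> A * B}) i :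
  content (ffst e) i = (\sum_j content e (i, j))%N :> nat.
Proof.
rewrite contentE -sum1dep_card (partition_big (fun x => (e x).2) xpredT) //=.
apply: eq_bigr => j _; rewrite contentE -sum1dep_card.
by apply: eq_bigl => x; rewrite ffunE -pair_eqE.
Qed.

Lemma content_fsnd n (A B : finType) (e : {ffun 'I_n -> A * B}) j :
  content (fsnd e) j = (\sum_i content e (i, j))%N :> nat.
Proof.
rewrite contentE -sum1dep_card (partition_big (fun x => (e x).1) xpredT) //=.
apply: eq_bigr => i _; rewrite contentE -sum1dep_card.
by apply: eq_bigl => x; rewrite ffunE -pair_eqE andbC.
Qed.

(** * Coloring characters and their inner products *)

Definition weight (n N : nat) (c : {ffun 'I_n -> 'I_N}) : {ffun 'I_N -> int} :=
  \sum_x unitv (c x).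

Lemma weightE n N (c : {ffun 'I_n -> 'I_N}) i : weight c i = (content c i)%:Z.
Proof.
rewrite contentE -sum1dep_card /weight sum_ffunE.
rewrite (eq_bigr (fun x => (c x == i)%:Z)); last first.
  by move=> x _; rewrite ffunE eq_sym.
by rewrite -[RHS]/(Posz _) [in RHS]big_mkcond /= (big_morph _ PoszD (erefl 0));
   apply: eq_bigr => x _; case: eqP.
Qed.

(* The permutation character of the action on the colorings of weight [k], and
   the virtual character given by the determinantal formula, for [v = la +
   delta]. *)
Definition coloring_char (n N : nat) (k : {ffun 'I_N -> int}) (s : 'S_n) : algC :=
  \sum_(c : {ffun 'I_n -> 'I_N} | fixes_coloring s c) (weight c == k)%:R.

Definition det_char (n N : nat) (v : {ffun 'I_N -> int}) (s : 'S_n) : algC :=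
  \sum_(c : {ffun 'I_n -> 'I_N} | fixes_coloring s c) alternant (v - weight c).

Lemma det_charE n N (v : {ffun 'I_N -> int}) (s : 'S_n) :
  det_char v s = \sum_(w : 'S_N) (-1) ^+ odd_perm w *
                   coloring_char (v - permv w (staircase N)) s.
Proof.
rewrite /det_char /alternant exchange_big; apply: eq_bigr => w _.
rewrite -mulr_sumr; congr (_ * _); apply: eq_bigr => c _.
by congr (nat_of_bool _)%:R; apply/eqP/eqP => [<-|->]; rewrite subKr.
Qed.

Lemma sum_det_coloring n N (v k : {ffun 'I_N -> int}) :
  \sum_(s : 'S_n) det_char v s * coloring_char k s =
  n`!%:R * \sum_(a : {ffun 'I_N * 'I_N -> 'I_n.+1} | (\sum_y a y)%N == n)
    ([ffun j => (\sum_i a (i, j))%N%:Z] == k)%:R *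
    alternant (v - [ffun i => (\sum_j a (i, j))%N%:Z]).
Proof.
rewrite -(sum_fixes (fun a : {ffun 'I_N * 'I_N -> 'I_n.+1} =>
    ([ffun j => (\sum_i a (i, j))%N%:Z] == k)%:R *
    alternant (v - [ffun i => (\sum_j a (i, j))%N%:Z]))).
apply: eq_bigr => s _; rewrite /det_char /coloring_char mulr_suml.
under eq_bigr => c _ do rewrite mulr_sumr.
rewrite big_mkcond; under eq_bigr => c _ do rewrite big_mkcond -(fun_if (fun x => x)).
rewrite (eq_bigr (fun c : {ffun 'I_n -> 'I_N} => \sum_d
  if fixes_coloring s c && fixes_coloring s d
  then alternant (v - weight c) * (weight d == k)%:R else 0)); last first.
  by move=> c _; case: ifP => _ //=; rewrite big1.
rewrite sum_ffun_pair [RHS]big_mkcond; apply: eq_bigr => e _.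
rewrite fixes_pair; case: ifP => // _; rewrite mulrC.
have -> : weight (fsnd e) = [ffun j => (\sum_i content e (i, j))%N%:Z].
  by apply/ffunP=> j; rewrite weightE content_fsnd !ffunE.
have -> // : weight (ffst e) = [ffun i => (\sum_j content e (i, j))%N%:Z].
by apply/ffunP=> j; rewrite weightE content_ffst !ffunE.
Qed.

(** The matrices coming from Burnside's lemma are regrouped by columns, since a column of sum [mu j]
    is a monomial of the complete polynomial of degree [mu j]. *)
Lemma sum_columns n N (mu : nat -> nat) (F : {ffun 'I_N -> int} -> algC) :
    (\sum_(j < N) mu j)%N = n ->
  \sum_(a : {ffun 'I_N * 'I_N -> 'I_n.+1} | (\sum_y a y)%N == n)
    ([ffun j => (\sum_i a (i, j))%N%:Z] == [ffun j : 'I_N => (mu j)%:Z])%:R *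
    F [ffun i => (\sum_j a (i, j))%N%:Z] =
  \sum_(a : {ffun 'I_N -> {ffun 'I_N -> 'I_n.+1}} |
     [forall j, (\sum_i a j i)%N == mu j])
     F [ffun i => (\sum_j a j i)%N%:Z].
Proof.
move=> sum_mu.
rewrite (reindex (fun a : {ffun 'I_N -> {ffun 'I_N -> 'I_n.+1}} =>
   [ffun p => a p.2 p.1])) /=; last first.
  exists (fun a => [ffun j => [ffun i => a (i, j)]]) => a _.
    by apply/ffunP=> i; apply/ffunP=> j; rewrite !ffunE.
  by apply/ffunP=> -[i j]; rewrite !ffunE.
rewrite big_mkcond [RHS]big_mkcond; apply: eq_bigr => a _.
have -> : [ffun i => (\sum_j [ffun p => a p.2 p.1] (i, j))%N%:Z] =
    [ffun i => (\sum_j a j i)%N%:Z] :> {ffun 'I_N -> int}.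
  by apply/ffunP=> i; rewrite !ffunE; congr Posz; apply: eq_bigr => j _; rewrite ffunE.
have -> : [ffun j => (\sum_i [ffun p => a p.2 p.1] (i, j))%N%:Z] =
    [ffun j => (\sum_i a j i)%N%:Z] :> {ffun 'I_N -> int}.
  by apply/ffunP=> i; rewrite !ffunE; congr Posz; apply: eq_bigr => j _; rewrite ffunE.
have -> : (\sum_y [ffun p => a p.2 p.1] y = \sum_j \sum_i a j i)%N.
  by rewrite exchange_big pair_bigA; apply: eq_bigr => y _; rewrite ffunE.
case: (forallP (P := fun j => (\sum_i a j i)%N == mu j)) => [h|nh].
  rewrite (eq_bigr (fun j : 'I_N => mu j)) => [|j _]; last exact/eqP.
  rewrite sum_mu eqxx; case: eqP => [|[]]; first by rewrite mul1r.
  by apply/ffunP=> j; rewrite !ffunE (eqP (h j)).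
case: eqP => // _; case: eqP => [/ffunP e|]; rewrite ?mul0r //.
by case: nh => j; have := e j; rewrite !ffunE => -[->].
Qed.

Lemma unlift_widen r (j : 'I_r) :
  unlift ord_max (widen_ord (leqnSn r) j) = Some j.
Proof.
have -> : widen_ord (leqnSn r) j = lift ord_max j.
  by apply: val_inj; rewrite /= /bump leqNgt ltn_ord.
by rewrite liftK.
Qed.

(** Subtracting a column [t] from [l] is the passage from [l] to [b] in [hsum]. A column exceeding
    [l] somewhere leaves a negative exponent, hence contributes 0, so the remaining vectors stay in
    the box. *)
Lemma sum_columns_hsums n N M (mu : nat -> nat) r (l : {ffun 'I_N -> 'I_M}) :
    (forall j, (j < r)%N -> (mu j <= n)%N) ->
  \sum_(a : {ffun 'I_r -> {ffun 'I_N -> 'I_n.+1}} |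
     [forall j, (\sum_i a j i)%N == mu j])
     alternant ([ffun i => (l i : nat)%:Z] - [ffun i => (\sum_j a j i)%N%:Z]) =
  hsums mu r (@box_alternant N M) l.
Proof.
elim: r l => [|r IHr] l mun.
  rewrite big_mkcond (big_ffun0 _ _ (ffun0 (card_ord 0))) /=.
  case: forallP => [_|[]]; last by case.
  by congr alternant; apply/ffunP=> i; rewrite !ffunE big_ord0 subr0.
rewrite big_mkcond (big_ffun_unlift _ ord_max) /= /hsum.
pose G (t : {ffun 'I_N -> 'I_n.+1}) : {ffun 'I_N -> int} :=
  [ffun i => (l i : nat)%:Z - (t i : nat)%:Z].
transitivity (\sum_(t : {ffun 'I_N -> 'I_n.+1} | (\sum_i t i)%N == mu r)
  \sum_(g : {ffun 'I_r -> {ffun 'I_N -> 'I_n.+1}} |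
     [forall j, (\sum_i g j i)%N == mu j])
   alternant (G t - [ffun i => (\sum_j g j i)%N%:Z])).
  rewrite [RHS]big_mkcond; apply: eq_bigr => t _; rewrite [X in if _ then X else _]big_mkcond.
  rewrite (fun_if (fun x => x)); have [tr|tr] := boolP ((\sum_i t i)%N == mu r); last first.
    rewrite big1 // => g _; case: forallP => // /(_ ord_max).
    by rewrite ffunE unlift_none (negPf tr).
  apply: eq_bigr => g _; set P := [forall _, _]; set Q := [forall _, _].
  have -> : Q = P.
    apply/forallP/forallP => h j.
      by have := h (widen_ord (leqnSn r) j); rewrite ffunE unlift_widen.
    rewrite ffunE; case: unliftP => [k ->|->] //=.
    by rewrite /bump leqNgt ltn_ord add0n; apply: h.
  case: P => //; congr alternant; apply/ffunP=> i; rewrite !ffunE.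
  rewrite big_ord_recr /= ffunE unlift_none /= PoszD opprD addrA addrAC.
  congr (_ - Posz _); apply: eq_bigr => j _.
  by rewrite ffunE unlift_widen.
rewrite (bigID (fun t : {ffun 'I_N -> 'I_n.+1} => [forall i, (t i <= l i)%N])) /=.
rewrite [X in _ + X]big1 ?addr0 => [|t /andP[_]]; last first.
  rewrite negb_forall => /existsP[i]; rewrite -ltnNge => lti.
  apply: big1 => g _; apply: (nneg_support_alternant (i := i)).
  by rewrite !ffunE; lia.
have lM i (t : {ffun 'I_N -> 'I_n.+1}) : (l i - t i < M)%N.
  by apply: leq_ltn_trans (leq_subr _ _) (ltn_ord _).
rewrite (reindex_onto
   (fun b : {ffun 'I_N -> 'I_M} => [ffun i => inord (l i - b i)] : {ffun 'I_N -> 'I_n.+1})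
   (fun t => [ffun i => Ordinal (lM i t)])) /=; last first.
  move=> t /andP[_ /forallP tl]; apply/ffunP=> i; rewrite !ffunE /=.
  by apply: val_inj; rewrite /= subKn // inord_val.
(* [inord] loses nothing here: each entry of [l - b] is at most the total [mu r], which is at most
   [n]. *)
have sub_small (b : {ffun 'I_N -> 'I_M}) : [forall i, (b i <= l i)%N] ->
    (\sum_i l i == \sum_i b i + mu r)%N -> forall i, (l i - b i < n.+1)%N.
  move=> /forallP ble sb i; rewrite ltnS (leq_trans _ (mun r _)) //.
  move: sb; rewrite (bigD1 i) //= [X in _ == (X + _)%N](bigD1 i) //= => /eqP.
  have : (\sum_(i0 < N | i0 != i) b i0 <= \sum_(i0 < N | i0 != i) l i0)%N.
    by apply: leq_sum => j _; apply: ble.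
  move=> Sle e; rewrite leq_subLR -(leq_add2r (\sum_(j < N | j != i) l j)) e.
  by rewrite addnAC leq_add2l.
apply: eq_big => b; last first.
  move=> /andP[/andP[sb /forallP tl] /eqP/ffunP bE].
  rewrite -IHr; last by move=> j jr; apply: mun; rewrite ltnW.
  apply: eq_bigr => g _; congr (alternant (_ - _)).
  apply/ffunP=> i; have /(congr1 val) := bE i; have := tl i; rewrite !ffunE /=.
  by move=> til; rewrite /G !ffunE => biE; rewrite -[in RHS]biE -subzn.
apply/andP/andP => [[/andP[sb /forallP tl] /eqP/ffunP bE]|[ble sb]].
  have bl i : (b i + (inord (l i - b i) : 'I_n.+1))%N = l i.
    have /(congr1 val) := bE i; have := tl i; rewrite !ffunE /= => til.
    rewrite ffunE; move: til; move: (nat_of_ord (inord _)) => x; lia.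
  split; first by apply/forallP=> i; rewrite -(bl i) leq_addr.
  rewrite -(eqP sb) -big_split /=; apply/eqP/eq_bigr => i _.
  by rewrite ffunE bl.
have subE i : (inord (l i - b i) : 'I_n.+1) = (l i - b i)%N :> nat.
  by rewrite inordK // sub_small.
split; last first.
  apply/eqP/ffunP=> i; apply: val_inj; rewrite !ffunE /= ffunE subE subKn //.
  exact: (forallP ble).
apply/andP; split; last by apply/forallP=> i; rewrite ffunE subE leq_subr.
rewrite (eq_bigr (fun i => l i - b i)%N) => [|i _]; last by rewrite ffunE subE.
by rewrite sumnB ?(eqP sb) ?addKn // => i _; apply: (forallP ble).
Qed.

Definition beta_vec (N : nat) (f : 'I_N -> nat) : {ffun 'I_N -> int} :=
  [ffun i => (f i + (N - i.+1))%N%:Z].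

Lemma sum_initial_segment N (j : nat) (S : {set 'I_N}) :
    #|S| = #|[set i : 'I_N | (i < j)%N]| ->
  (\sum_(i < N | (i < j)%N) i <= \sum_(i in S) i)%N.
Proof.
move=> cardS; pose I := [set i : 'I_N | (i < j)%N].
have -> : (\sum_(i < N | (i < j)%N) i = \sum_(i in I) i)%N.
  by apply: eq_bigl => i; rewrite inE.
rewrite (big_setID S) /= [X in (_ <= X)%N](big_setID I) /= setIC leq_add2l.
have cardD : #|I :\: S| = #|S :\: I|.
  by apply/eqP; rewrite -(eqn_add2l #|I :&: S|) cardsID setIC cardsID cardS.
apply: (@leq_trans (#|I :\: S| * j)).
  rewrite -sum_nat_const; apply: leq_sum => i; rewrite !inE => /andP[_ ij].
  exact: ltnW.
rewrite cardD -sum_nat_const; apply: leq_sum => i; rewrite !inE -leqNgt.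
by case/andP.
Qed.

(** The first [j] staircase entries are its largest, so the staircase dominates its rearrangements.
    Hence [la + delta - w delta] dominates [la]. *)
Lemma sum_perm_staircase N (w : 'S_N) (j : nat) :
  (\sum_(i < N | (i < j)%N) (N - (w i).+1) <=
   \sum_(i < N | (i < j)%N) (N - i.+1))%N.
Proof.
have E (u : 'S_N) : (\sum_(i < N | (i < j)%N) (N - (u i).+1) +
   \sum_(i < N | (i < j)%N) u i = \sum_(i < N | (i < j)%N) N.-1)%N.
  rewrite -big_split; apply: eq_bigr => i _ /=; have := ltn_ord (u i); lia.
have := E w; have := E 1%g.
under eq_bigr => i _ do rewrite perm1.
rewrite [X in (_ + X)%N](eq_bigr (fun i : 'I_N => i : nat)) => [|i _]; last by rewrite perm1.
move=> <- e.
have := @sum_initial_segment N j (w @: [set i : 'I_N | (i < j)%N]).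
rewrite card_imset; last exact: perm_inj.
move=> /(_ erefl); rewrite big_imset /=; last by move=> ? ? _ _; apply: perm_inj.
under [X in (_ <= X)%N]eq_bigl => i do rewrite inE.
move: e; do 2!move: (\sum_(i < N | _) (N - _))%N => ?.
do 2!move: (\sum_(i < N | _) _)%N => ?; lia.
Qed.

(** The weight [la + delta - w delta] dominates [la] and equals it only for [w = 1], so
    [hsums_alternant] leaves that single case. *)
Lemma sum_det_coloring_beta n N (f : 'I_N -> nat) (w : 'S_N) :
    (forall i j : 'I_N, (i < j)%N -> (f j <= f i)%N) -> (\sum_i f i)%N = n ->
  \sum_(s : 'S_n) det_char (beta_vec f) s *
     coloring_char (beta_vec f - permv w (staircase N)) s = n`!%:R * (w == 1%g)%:R.
Proof.
move=> decf sumf; set k := beta_vec f - _.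
(* A negative entry excludes every coloring of this weight, and it cannot occur for [w = 1]. *)
have [/existsP[i ki]|kpos] := boolP [exists i, k i < 0].
  rewrite big1 => [|s _].
    case: eqP => [w1|]; rewrite ?mulr0 //.
    by move: ki; rewrite /k w1 !ffunE perm1 PoszD addrK.
  rewrite [X in _ * X]big1 ?mulr0 // => c _; case: eqP => // e.
  by move: ki; rewrite -e weightE.
rewrite negb_exists in kpos.
pose mu j := if insub j is Some i then `|k i|%N else 0%N.
have muE (i : 'I_N) : (mu i)%:Z = k i.
  by rewrite /mu valK gez0_abs // leNgt (forallP kpos).
have mu_eq (i : 'I_N) : (mu i + (N - (w i).+1) = f i + (N - i.+1))%N.
  by apply/eqP; rewrite -eqz_nat !PoszD muE /k !ffunE PoszD subrK.
have sum_mu : (\sum_(j < N) mu j)%N = n.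
  apply/eqP; rewrite -(eqn_add2r (\sum_(i < N) (N - (w i).+1))) -big_split /=.
  rewrite (eq_bigr _ (fun i _ => mu_eq i)) big_split sumf /= eqn_add2l.
  by rewrite [X in X == _](reindex_inj (@perm_inj _ w)).
have -> : k = [ffun j : 'I_N => (mu j)%:Z] by apply/ffunP=> j; rewrite [RHS]ffunE muE.
rewrite sum_det_coloring (sum_columns (fun u => alternant (beta_vec f - u))) //.
have ltM (i : 'I_N) : (f i + (N - i.+1) < (n + N).+1)%N.
  by rewrite ltnS leq_add ?leq_subr // -sumf (bigD1 i) //= leq_addr.
pose l : {ffun 'I_N -> 'I_(n + N).+1} := [ffun i => Ordinal (ltM i)].
have -> : beta_vec f = [ffun i => (l i : nat)%:Z].
  by apply/ffunP=> i; rewrite !ffunE.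
rewrite sum_columns_hsums; last first.
  by move=> j jN; rewrite -sum_mu (bigD1 (Ordinal jN)) //= leq_addr.
rewrite hsums_alternant //; first last.
- move=> j _; rewrite (eq_bigr (fun i : 'I_N => mu i + (N - (w i).+1))%N).
    by rewrite !big_split leq_add2l /=; apply: sum_perm_staircase.
  by move=> i _; rewrite ffunE mu_eq.
- by move=> i j ij; rewrite !ffunE /=; have := decf i j ij; have := ltn_ord j; lia.
congr (_ * (nat_of_bool _)%:R); apply/forallP/eqP => [h|w1 i]; last first.
  by rewrite ltn_ord ffunE /= -mu_eq w1 perm1.
apply/permP=> i; rewrite perm1; apply: val_inj => /=.
have := h i; rewrite ltn_ord ffunE /= -mu_eq eqn_add2l.
have := ltn_ord i; have := ltn_ord (w i); lia.
Qed.

Lemma det_char_conj n N (v : {ffun 'I_N -> int}) (s : 'S_n) :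
  (det_char v s)^* = det_char v s.
Proof.
rewrite /det_char rmorph_sum; apply: eq_bigr => c _.
rewrite /alternant rmorph_sum; apply: eq_bigr => w _.
by rewrite rmorphM rmorphXn rmorphN1 rmorph_nat.
Qed.

(** Only the second factor is expanded into coloring characters; pairing them with the unexpanded
    first factor leaves the term [w = 1]. *)
Lemma det_char_norm n N (f : 'I_N -> nat) :
    (forall i j : 'I_N, (i < j)%N -> (f j <= f i)%N) -> (\sum_i f i)%N = n ->
  \sum_(s : 'S_n) det_char (beta_vec f) s * (det_char (beta_vec f) s)^* = n`!%:R.
Proof.
move=> decf sumf; transitivity (\sum_(w : 'S_N) (-1) ^+ odd_perm w *
   (n`!%:R * (w == 1%g)%:R) : algC).
  rewrite (eq_bigr (fun w : 'S_N => \sum_(s : 'S_n) (-1) ^+ odd_perm w *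
     (det_char (beta_vec f) s *
      coloring_char (beta_vec f - permv w (staircase N)) s))) => [|w _].
    rewrite exchange_big; apply: eq_bigr => s _.
    rewrite det_char_conj {2}det_charE mulr_sumr; apply: eq_bigr => w _.
    by rewrite mulrCA.
  by rewrite -mulr_sumr sum_det_coloring_beta.
rewrite (bigD1 1%g) //= odd_perm1 eqxx mulr1 mul1r big1 ?addr0 // => w w1.
by rewrite (negPf w1) !mulr0.
Qed.

(** * Pairing with sign-twisted coloring characters *)

(** Two points of equal color give a transposition in the stabilizer, and multiplying by it cancels
    the signs in pairs. An injective coloring has trivial stabilizer. *)
Lemma sum_sign_fixes n (X : finType) (e : {ffun 'I_n -> X}) :
  \sum_(s : 'S_n | fixes_coloring s e) (-1) ^+ odd_perm s = (injectiveb e)%:R :> algC.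
Proof.
case: (injectiveP e) => [inje|ninj].
  rewrite (big_pred1 1%g) ?odd_perm1 // => s; apply/forallP/eqP => [h|-> x].
    by apply/permP=> x; rewrite perm1; apply/inje/eqP.
  by rewrite perm1.
have /injectivePn[x [y xy exy]] : ~~ injectiveb e by apply/injectiveP.
apply: (@sum_antisym _ _ (fun s => tperm x y * s)%g).
- by move=> s; rewrite mulgA tperm2 mul1g.
- move=> s /forallP h; apply/forallP=> z; rewrite permM.
  by rewrite (eqP (h _)); case: tpermP => // ->; rewrite exy.
- by move=> s; rewrite odd_permM odd_tperm xy signr_addb expr1 mulN1r.
Qed.

(** An injective coloring by pairs is a 0-1 matrix with the prescribed margins together with a
    numbering of its [n] ones; the sign kills all other colorings. *)
Lemma sum_sign_coloring n N P (k : {ffun 'I_N -> int}) (k' : {ffun 'I_P -> int}) :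
  \sum_(s : 'S_n) (-1) ^+ odd_perm s * coloring_char k' s * coloring_char k s =
  #|[set e : {ffun 'I_n -> 'I_N * 'I_P} | [&& injectiveb e,
       weight (ffst e) == k & weight (fsnd e) == k']]|%:R.
Proof.
rewrite -sum1dep_card natr_sum big_mkcondr /=.
transitivity (\sum_(e : {ffun 'I_n -> 'I_N * 'I_P}) \sum_(s : 'S_n | fixes_coloring s e)
  (-1) ^+ odd_perm s * ((weight (ffst e) == k) && (weight (fsnd e) == k'))%:R : algC).
  rewrite (exchange_big_dep xpredT) //=; apply: eq_bigr => s _.
  rewrite -mulrA -mulr_sumr mulrC; rewrite [RHS]mulrC; congr (_ * _).
  rewrite mulrC /coloring_char mulr_suml.
  under eq_bigr => c _ do rewrite mulr_sumr.
  rewrite big_mkcond; rewrite (eq_bigr (fun c : {ffun 'I_n -> 'I_N} => \sum_d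
    if fixes_coloring s c && fixes_coloring s d
    then (weight c == k)%:R * (weight d == k')%:R else 0)); last first.
    by move=> c _; case: ifP => _ //=; rewrite ?big_mkcond // big1.
  rewrite sum_ffun_pair [RHS]big_mkcond; apply: eq_bigr => e _.
  by rewrite fixes_pair; case: ifP => // _; rewrite -natrM mulnb.
rewrite [RHS]big_mkcond; apply: eq_bigr => e _.
rewrite -mulr_suml sum_sign_fixes; case: injectiveb; rewrite ?mul0r ?mul1r //.
by case: andP.
Qed.

(** The uniqueness case of the Gale-Ryser theorem. Within one column, the first [t] rows of [D] hold
    no more cells than those of the diagram: either the diagram column has ended, and the column
    sums agree, or it fills all [t] rows. The hypothesis on rows gives the opposite inequality in
    total, so equality holds in each column. *)
Lemma set_eq_diagram N P (D : {set 'I_N * 'I_P}) (f : 'I_N -> nat) :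
    (forall i j : 'I_N, (i < j)%N -> (f j <= f i)%N) ->
    (forall j : 'I_P, \sum_i ((i, j) \in D) = \sum_i (j < f i))%N ->
    (forall t, \sum_(i < N | (i < t)%N) \sum_(j < P) (j < f i) <=
               \sum_(i < N | (i < t)%N) \sum_(j < P) ((i, j) \in D))%N ->
  forall i j, ((i, j) \in D) = (j < f i)%N.
Proof.
move=> decf cols rows.
pose a t j := (\sum_(i < N | (i < t)%N) ((i, j) \in D))%N.
pose g t (j : 'I_P) := (\sum_(i < N | (i < t)%N) (j < f i))%N.
have ag t j : (a t j <= g t j)%N.
  have [/existsP[i /andP[it fij]]|nfij] :=
      boolP [exists i : 'I_N, (i < t)%N && (f i <= j)%N].
    have -> : g t j = (\sum_i (j < f i))%N.
      rewrite [RHS](bigID (fun i : 'I_N => (i < t)%N)) /= [X in (_ + X)%N]big1 ?addn0 //.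
      move=> i' ti'; apply/eqP; rewrite eqb0 -leqNgt; apply: leq_trans fij.
      by apply: decf; apply: leq_trans it _; rewrite leqNgt.
    by rewrite -cols [X in (_ <= X)%N](bigID (fun i : 'I_N => (i < t)%N)) leq_addr.
  apply: leq_sum => i it; rewrite negb_exists in nfij.
  have := forallP nfij i; rewrite it /= -ltnNge => ->; exact: leq_b1.
have eq_ag t j : a t j = g t j.
  have [_] := leqif_sum (fun j (_ : true) => leqif_eq (ag t j)).
  have -> : (\sum_j a t j == \sum_j g t j)%N.
    rewrite eqn_leq leq_sum => [|j' _]; last exact: ag.
    by rewrite /a /g exchange_big [X in (_ <= X)%N]exchange_big; apply: rows.
  by move/esym/forallP/(_ j)/eqP.
move=> i j; have := eq_ag i.+1 j; have := eq_ag i j; rewrite /a /g.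
have split (F : 'I_N -> bool) : (\sum_(k < N | (k < i.+1)%N) F k =
    F i + \sum_(k < N | (k < i)%N) F k)%N.
  rewrite (bigD1 i) //=; congr addn; apply: eq_bigl => k.
  by rewrite ltnS ltn_neqAle andbC.
rewrite !split => -> /addIn; by case: (_ \in _); case: (_ < _)%N.
Qed.

Lemma content_injective n (X : finType) (e : {ffun 'I_n -> X}) :
  injective e -> forall p, content e p = (p \in codom e) :> nat.
Proof.
move=> inje p; rewrite contentE; case: (boolP (p \in codom e)) => [/codomP[x ->]|pe].
  rewrite (_ : [set _ | _] = [set x]) ?cards1 //.
  by apply/setP=> y; rewrite !inE (inj_eq inje).
apply/eqP; rewrite cards_eq0; apply/eqP/setP=> y; rewrite !inE.
by apply/eqP=> ep; case/negP: pe; rewrite -ep codom_f.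
Qed.

Lemma recolor_inj n (X : finType) (e : {ffun 'I_n -> X}) :
  injective e -> injective (fun s : 'S_n => recolor s e).
Proof.
move=> inje s t /ffunP st; apply/permP=> x; apply: inje.
by have := st x; rewrite !ffunE.
Qed.

(** [e0] numbers the cells of the diagram of [f]. By [set_eq_diagram] every contributing [e] fills
    the same diagram; its row lengths force [w = 1], and the [n!] numberings of the diagram are then
    the recolorings of [e0]. *)
Lemma sum_sign_coloring_beta n N P (f : 'I_N -> nat) (w : 'S_N)
    (e0 : {ffun 'I_n -> 'I_N * 'I_P}) :
    (forall i j : 'I_N, (i < j)%N -> (f j <= f i)%N) ->
    (forall i, f i <= P)%N -> injective e0 ->
    (forall i j, ((i, j) \in codom e0) = (j < f i)%N) ->
  \sum_(s : 'S_n) (-1) ^+ odd_perm s * coloring_char (weight (fsnd e0)) s *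
     coloring_char (beta_vec f - permv w (staircase N)) s = n`!%:R * (w == 1%g)%:R.
Proof.
move=> decf fP inje0 codome0; rewrite sum_sign_coloring -natrM; congr _%:R.
have count_f i : (\sum_(j < P) (j < f i) = f i)%N.
  rewrite -[RHS](card_ord (f i)) -sum1_card (big_ord_widen _ (fun=> 1%N) (fP i)).
  by rewrite [RHS]big_mkcond; apply: eq_bigr => j _; case: ifP.
have weight_fst (e : {ffun 'I_n -> 'I_N * 'I_P}) i : injective e ->
    weight (ffst e) i = (\sum_j ((i, j) \in codom e))%N%:Z.
  move=> inje; rewrite weightE content_ffst; congr Posz.
  by apply: eq_bigr => j _; rewrite content_injective.
have weight_snd (e : {ffun 'I_n -> 'I_N * 'I_P}) j : injective e ->
    weight (fsnd e) j = (\sum_i ((i, j) \in codom e))%N%:Z.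
  move=> inje; rewrite weightE content_fsnd; congr Posz.
  by apply: eq_bigr => i _; rewrite content_injective.
have weight_e0 : weight (ffst e0) = beta_vec f - permv 1 (staircase N).
  apply/ffunP=> i; rewrite weight_fst // !ffunE perm1 PoszD addrK.
  by congr Posz; rewrite -[RHS]count_f; apply: eq_bigr => j _; rewrite codome0.
have codom_e (e : {ffun 'I_n -> 'I_N * 'I_P}) : injective e ->
    weight (ffst e) = beta_vec f - permv w (staircase N) ->
    weight (fsnd e) = weight (fsnd e0) ->
    forall i j, ((i, j) \in codom e) = (j < f i)%N.
  move=> inje /ffunP wfst /ffunP wsnd i j.
  have rowE i' : (\sum_j ((i', j) \in codom e) + (N - (w i').+1) =
      f i' + (N - i'.+1))%N.
    apply/eqP; rewrite -eqz_nat PoszD -weight_fst // wfst !ffunE.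
    by rewrite subrK.
  rewrite -(@set_eq_diagram N P [set p | p \in codom e] f) ?inE //.
    move=> j'; have := wsnd j'; rewrite !weight_snd // => -[wj].
    rewrite (eq_bigr (fun i0 => nat_of_bool ((i0, j') \in codom e))).
      by rewrite wj; apply: eq_bigr => i' _; rewrite codome0.
    by move=> i' _; rewrite inE.
  move=> t; rewrite -(leq_add2r (\sum_(i < N | (i < t)%N) (N - (w i).+1))).
  rewrite -!big_split /=.
  rewrite [X in (_ <= X)%N](eq_bigr (fun i : 'I_N => f i + (N - i.+1))%N); last first.
    move=> i' _; rewrite -rowE; congr addn.
    by apply: eq_bigr => j' _; rewrite inE.
  rewrite (eq_bigr (fun i : 'I_N => f i + (N - (w i).+1))%N); last first.
    by move=> i' _; rewrite count_f.
  by rewrite !big_split leq_add2l; apply: sum_perm_staircase.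
have [w1|w1] := eqVneq w 1%g; last first.
  rewrite muln0; apply/eqP; rewrite cards_eq0; apply/eqP/setP=> e.
  rewrite !inE; apply/negP=> /and3P[/injectiveP inje /eqP wfst /eqP wsnd].
  case/eqP: w1; apply/permP=> i; rewrite perm1; apply: val_inj => /=.
  have /ffunP/(_ i) := wfst; rewrite weight_fst // !ffunE.
  rewrite (eq_bigr (fun j : 'I_P => nat_of_bool (j < f i)%N)); last first.
    by move=> j _; rewrite codom_e.
  rewrite count_f; have := ltn_ord i; have := ltn_ord (w i); lia.
rewrite muln1 -card_Sn -(card_imset _ (recolor_inj inje0)); apply: eq_card => e.
rewrite inE; apply/and3P/imsetP => [[/injectiveP inje /eqP wfst /eqP wsnd]|[s _ ->]].
  have [] := @content_transitive n _ e0 e; last by move=> s ->; exists s.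
  apply/ffunP=> -[i j]; apply: val_inj; rewrite /= !content_injective //.
  by rewrite codome0 codom_e.
have injs : injective (recolor s e0).
  by move=> x y; rewrite !ffunE => /inje0/perm_inj.
have codoms p : (p \in codom (recolor s e0)) = (p \in codom e0).
  have := content_injective injs p; rewrite content_recolor content_injective //.
  by case: (_ \in _); case: (_ \in _).
split; first exact/injectiveP.
  rewrite w1 -weight_e0; apply/eqP/ffunP=> i; rewrite !weight_fst //.
  by congr Posz; apply: eq_bigr => j _; rewrite codoms.
apply/eqP/ffunP=> j; rewrite !weight_snd //.
by congr Posz; apply: eq_bigr => i _; rewrite codoms.
Qed.

(** * Coloring representations and Specht modules *)

Lemma row_free_kernel (F : fieldType) m n (A : 'M[F]_(m, n)) :
  (forall v : 'rV_m, v *m A = 0 -> v = 0) -> row_free A.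
Proof.
move=> h; rewrite -kermx_eq0; apply/eqP/row_matrixP=> i; rewrite row0; apply: h.
by apply/sub_kermxP/row_sub.
Qed.

(** [theta] is the character of the quotient module. That it is a character is what makes inner
    products with other characters increase along the embedding. *)
Lemma cfRepr_embed (gT : finGroupType) (G : {group gT}) n1 n2
    (rU : mx_representation algC G n1) (rV : mx_representation algC G n2)
    (B : 'M_(n1, n2)) :
    row_free B -> {in G, forall x, rU x *m B = B *m rV x} ->
  exists2 theta, theta \is a character & cfRepr rV = cfRepr rU + theta.
Proof.
move=> freeB homB.
have sBU : (B <= <<B>>)%MS by rewrite genmxE.
have modB : mxmodule rV <<B>>%MS.
  apply/mxmoduleP=> x Gx; rewrite genmxE (eqmxMr _ (genmxE _)) -homB //.
  exact: submxMl.
exists (cfRepr (factmod_repr modB)); first exact: cfRepr_char.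
have -> : cfRepr rU = cfRepr (submod_repr modB).
  apply: cfRepr_sim; exists (in_submod _ B).
  - by rewrite genmxE; apply/esym/eqP.
  - apply: row_free_kernel => v vB; apply: (row_free_inj freeB).
    by rewrite mul0mx -[B in LHS](in_submodK sBU) val_submodE mulmxA vB mul0mx.
  - by move=> x Gx; rewrite -in_submodJ // -homB // [RHS]in_submodE -mulmxA -in_submodE.
by apply/cfun_inP=> x Gx; rewrite !cfunE Gx mxtrace_sub_fact_mod.
Qed.

(* The action of the symmetric group on the colorings of weight [k], twisted by
   the sign when [b] is true. *)
Definition coloring (n N : nat) (k : {ffun 'I_N -> int}) :=
  {c : {ffun 'I_n -> 'I_N} | weight c == k}.

Lemma weight_recolor n N (s : 'S_n) (c : {ffun 'I_n -> 'I_N}) :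
  weight (recolor s c) = weight c.
Proof. by apply/ffunP=> i; rewrite !weightE content_recolor. Qed.

Lemma coloring_act_proof n N (k : {ffun 'I_N -> int}) (c : coloring n k) (s : 'S_n) :
  weight (recolor s^-1 (val c)) == k.
Proof. by rewrite weight_recolor (valP c). Qed.

(** The inverse turns [recolor], which is a left action, into a right one, as required by matrices
    acting on row vectors. *)
Definition coloring_act n N (k : {ffun 'I_N -> int}) (c : coloring n k) (s : 'S_n) :
  coloring n k := Sub (recolor s^-1 (val c)) (coloring_act_proof c s).

Lemma coloring_act1 n N (k : {ffun 'I_N -> int}) (c : coloring n k) :
  coloring_act c 1%g = c.
Proof. by apply/val_inj/ffunP=> x; rewrite ffunE invg1 perm1. Qed.

Lemma coloring_actM n N (k : {ffun 'I_N -> int}) (c : coloring n k) (s t : 'S_n) :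
  coloring_act c (s * t)%g = coloring_act (coloring_act c s) t.
Proof. by apply/val_inj/ffunP=> x; rewrite !ffunE invMg permM. Qed.

Definition coloring_mx (b : bool) n N (k : {ffun 'I_N -> int}) (s : 'S_n) :
    'M[algC]_#|{: coloring n k}| :=
  \matrix_(i, j) ((-1) ^+ (b && odd_perm s) *
                  (coloring_act (enum_val i) s == enum_val j)%:R).

Lemma coloring_mx_repr b n N (k : {ffun 'I_N -> int}) :
  mx_repr (symmetric_group n) (@coloring_mx b n N k).
Proof.
split=> [|s t _ _]; apply/matrixP=> i j; rewrite !mxE.
  by rewrite odd_perm1 andbF mul1r coloring_act1 (inj_eq enum_val_inj).
rewrite (bigD1 (enum_rank (coloring_act (enum_val i) s))) //= !mxE.
rewrite big1 ?addr0 => [|l]; last first.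
  move=> ne; rewrite !mxE; case: eqP => [e|]; last by rewrite mulr0 mul0r.
  by rewrite e enum_valK eqxx in ne.
rewrite enum_rankK eqxx mulr1 mulrA coloring_actM -signr_addb odd_permM.
by case: b.
Qed.

Canonical coloring_repr b n N (k : {ffun 'I_N -> int}) :=
  MxRepresentation (@coloring_mx_repr b n N k).

Lemma fixes_coloringV n (X : finType) (s : 'S_n) (e : {ffun 'I_n -> X}) :
  (recolor s^-1 e == e) = fixes_coloring s e.
Proof.
apply/eqP/forallP => [/ffunP h x|h]; first by rewrite -(h (s x)) ffunE permK.
by apply/ffunP=> x; rewrite ffunE -[in RHS](permKV s x) (eqP (h _)).
Qed.

Lemma cfRepr_coloring b n N (k : {ffun 'I_N -> int}) s :
  cfRepr (@coloring_repr b n N k) s =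
  (-1) ^+ (b && odd_perm s) * coloring_char k s.
Proof.
rewrite cfunE inE /= /coloring_char /mxtrace.
under eq_bigr => i _ do rewrite mxE.
rewrite -mulr_sumr; congr (_ * _).
rewrite -(big_enum_val (fun c : coloring n k => (coloring_act c s == c)%:R)) /=.
rewrite [RHS](bigID (fun c : {ffun 'I_n -> 'I_N} => weight c == k)) /=.
rewrite [X in _ = _ + X]big1 ?addr0 => [|c /andP[_ /negPf-> //]].
rewrite (eq_bigl (fun c : {ffun 'I_n -> 'I_N} =>
  (c \in [pred c | weight c == k]) && fixes_coloring s c)); last first.
  by move=> c; rewrite inE andbC.
rewrite (big_sub_cond [pred c | weight c == k]) /= big_mkcond /=.
rewrite [RHS]big_mkcond; apply: eq_bigr => c _.
rewrite -fixes_coloringV -val_eqE /=; case: ifP => _ //.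
by have /= -> := valP c.
Qed.

(** * The Specht module inside coloring modules *)

Definition gcoef n (y : 'rV[algC]_#|symmetric_group n|) (g : 'S_n) : algC :=
  y 0 (gring_index (symmetric_group n) g).

Lemma gring_index_inj n : injective (gring_index (symmetric_group n)).
Proof. by move=> g h; apply: (can_in_inj (@gring_indexK _ _)); rewrite inE. Qed.

Lemma gcoef_delta n (h g : 'S_n) :
  gcoef (delta_mx 0 (gring_index (symmetric_group n) h)) g = (h == g)%:R.
Proof. by rewrite /gcoef mxE eqxx eq_sym (inj_eq (@gring_index_inj n)). Qed.

Lemma gcoef_inj n (y : 'rV[algC]_#|symmetric_group n|) :
  (forall g, gcoef y g = 0) -> y = 0.
Proof.
move=> y0; apply/rowP=> i; rewrite mxE.
by have := y0 (enum_val i); rewrite /gcoef gring_valK.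
Qed.

Lemma specht_mxP n la (y : 'rV_#|symmetric_group n|) :
    (y <= specht_mx n la)%MS ->
  exists a : 'S_n -> algC, forall g, gcoef y g =
    \sum_h a h * (\sum_(p in row_stabilizer n la) \sum_(q in column_stabilizer n la)
                    (-1) ^+ odd_perm q * (p * q * h == g)%g%:R).
Proof.
case/cyclic_mxP=> A /envelop_mxP[a ->] ->; exists a => g.
rewrite mulmx_sumr /gcoef summxE; apply: eq_big => [h|h _]; first by rewrite inE.
rewrite -scalemxAr mxE /young_symmetrizer mulmx_suml summxE; congr (_ * _).
apply: eq_bigr => p _; rewrite mulmx_suml summxE; apply: eq_bigr => q _.
rewrite -scalemxAl mxE; congr (_ * _).
by rewrite -rowE rowK gring_indexK ?inE // -[LHS]/(gcoef _ _) gcoef_delta.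
Qed.

(** A group element [g] is sent to [c] moved by [g], up to sign, and this commutes with right
    multiplication. The hypothesis is injectivity on the Specht module: a coordinate of the image is
    a signed sum of coefficients over one coset of the stabilizer of [c]. *)
Lemma specht_embed (b : bool) n la N (k : {ffun 'I_N -> int}) (c : coloring n k) :
    (forall y, (y <= specht_mx n la)%MS ->
       (forall g0, \sum_(g | coloring_act c g == coloring_act c g0)
          (-1) ^+ (b && odd_perm g) * gcoef y g = 0) -> y = 0) ->
  exists2 theta, theta \is a character &
    cfRepr (@coloring_repr b n N k) = specht_char n la + theta.
Proof.
move=> ker0; pose f : 'M[algC]_(#|symmetric_group n|, #|{: coloring n k}|) :=
  \matrix_(i, j) ((-1) ^+ (b && odd_perm (enum_val i)) *
                  (coloring_act c (enum_val i) == enum_val j)%:R).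
have fJ g : g \in symmetric_group n ->
    regular_repr algC (symmetric_group n) g *m f = f *m coloring_mx b k g.
  move=> Gg; apply/matrixP=> i j.
  rewrite !mxE (bigD1 (gring_index (symmetric_group n) (enum_val i * g)%g)) //=.
  rewrite big1 ?addr0 => [|l /negPf nl]; last by rewrite !mxE eqxx nl mul0r.
  rewrite !mxE !eqxx /= mul1r gring_indexK ?inE //.
  rewrite (bigD1 (enum_rank (coloring_act c (enum_val i)))) //= !mxE.
  rewrite big1 ?addr0 => [|l nl]; last first.
    rewrite !mxE; case: eqP => [e|]; last by rewrite mulr0 mul0r.
    by rewrite e enum_valK eqxx in nl.
  rewrite enum_rankK eqxx mulr1 mulrA coloring_actM -signr_addb odd_permM.
  by rewrite andb_addr.
apply: (@cfRepr_embed _ _ _ _ _ _ (val_submod 1%:M *m f)).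
  apply: row_free_kernel => v; rewrite mulmxA -val_submodE => vf.
  apply/eqP; rewrite -(@val_submod_eq0 _ _ (specht_mx n la)); apply/eqP.
  apply: ker0 => [|g0]; first exact: val_submodP.
  have /matrixP/(_ 0 (enum_rank (coloring_act c g0))) := vf.
  rewrite !mxE => e; rewrite -[RHS]e big_mkcond.
  rewrite (reindex (fun i : 'I_#|symmetric_group n| => enum_val i)) /=; last first.
    exists (gring_index (symmetric_group n)) => g _; first exact: gring_valK.
    by rewrite gring_indexK ?inE.
  apply: eq_bigr => i _; rewrite [f _ _]mxE enum_rankK /gcoef gring_valK.
  by case: ifP; rewrite ?mulr0 // mulr1 mulrC.
move=> g Gg; rewrite mulmxA -val_submodE -[X in val_submod X]mul1mx.
by rewrite val_submodJ // -!mulmxA fJ.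
Qed.

Lemma fixes_coloringM n (X : finType) (e : {ffun 'I_n -> X}) (s t : 'S_n) :
  fixes_coloring s e -> fixes_coloring (s * t)%g e = fixes_coloring t e.
Proof.
move=> /forallP fs; apply/forallP/forallP => ft x.
  have := ft (s^-1 x)%g; rewrite permM permKV => /eqP ->.
  by rewrite -(eqP (fs _)) permKV.
by rewrite permM (eqP (ft _)) (eqP (fs _)).
Qed.

Lemma gcoef_row_invariant n la N (r : {ffun 'I_n -> 'I_N})
    (y : 'rV_#|symmetric_group n|) (p g : 'S_n) :
    (forall s, (s \in row_stabilizer n la) = fixes_coloring s r) ->
    (y <= specht_mx n la)%MS -> p \in row_stabilizer n la ->
  gcoef y (p * g)%g = gcoef y g.
Proof.
move=> hR /specht_mxP[a ya] pR; rewrite !ya; apply: eq_bigr => h _; congr (_ * _).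
rewrite (reindex_inj (mulgI p)) /=; apply: eq_big => [s|s _].
  by rewrite !hR fixes_coloringM // -hR.
by apply: eq_bigr => q _; rewrite -!mulgA (inj_eq (mulgI p)).
Qed.

(** Coefficients of elements of the Specht module are constant on the cosets of the row stabilizer,
    so a coset sum is a positive multiple of one coefficient. *)
Lemma specht_row_embed n la N (r : {ffun 'I_n -> 'I_N}) :
    (forall s, (s \in row_stabilizer n la) = fixes_coloring s r) ->
  exists2 theta, theta \is a character &
    cfRepr (@coloring_repr false n N (weight r)) = specht_char n la + theta.
Proof.
move=> hR; pose r' : coloring n (weight r) :=
  exist _ r (eqxx (weight r)).
apply: (@specht_embed false n la N (weight r) r') => y yU y0; apply: gcoef_inj => g0.
have {}y0 := y0 g0.
have : \sum_(g in [set g | coloring_act r' g == coloring_act r' g0]) gcoef y g0 = 0.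
  rewrite -[RHS]y0; apply: eq_big => [g|g]; first by rewrite inE.
  rewrite inE => /eqP/(congr1 val)/= /ffunP gg0.
  rewrite mul1r -[in RHS](mulgKV g0 g) (gcoef_row_invariant _ hR) // hR.
  by apply/forallP=> x; have := gg0 (g x); rewrite !ffunE permK permM => <-.
rewrite sumr_const => /eqP; rewrite mulrn_eq0 cards_eq0 => /orP[/eqP/setP/(_ g0)|/eqP //].
by rewrite !inE eqxx.
Qed.

Lemma coloring_act_inj n N (k : {ffun 'I_N -> int}) (g : 'S_n) :
  injective (fun c : coloring n k => coloring_act c g).
Proof.
by apply: (can_inj (g := fun c => coloring_act c g^-1%g)) => c;
   rewrite -coloring_actM mulgV coloring_act1.
Qed.

(* The kernel is trivial since [y = a b x] and [b y = 0] imply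
   [<y, y> = <x, b a y> = #|R| <x, b y> = 0], where [a] and [b] are the two
   factors of the Young symmetrizer and [R] is the row stabilizer. *)
Lemma specht_column_embed n la N P (r : {ffun 'I_n -> 'I_N}) (d : {ffun 'I_n -> 'I_P}) :
    (forall s, (s \in row_stabilizer n la) = fixes_coloring s r) ->
    (forall s, (s \in column_stabilizer n la) = fixes_coloring s d) ->
  exists2 theta, theta \is a character &
    cfRepr (@coloring_repr true n P (weight d)) = specht_char n la + theta.
Proof.
move=> hR hC; pose d' : coloring n (weight d) := exist _ d (eqxx (weight d)).
apply: (@specht_embed true n la P (weight d) d') => y yU y0.
have {}y0 h : \sum_(q in column_stabilizer n la) (-1) ^+ odd_perm q * gcoef y (q * h)%g = 0.
  have := y0 h; rewrite (reindex_inj (mulIg h)) /= => e.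
  have sn0 : (-1) ^+ odd_perm h != 0 :> algC by rewrite signr_eq0.
  apply: (mulfI sn0); rewrite mulr0 mulr_sumr -[RHS]e.
  apply: eq_big => [q|q _]; last by rewrite odd_permM signr_addb mulrCA mulrA.
  rewrite coloring_actM (inj_eq (@coloring_act_inj _ _ _ _)) hC -val_eqE /=.
  by rewrite fixes_coloringV.
have yy0 : \sum_g gcoef y g * (gcoef y g)^* = 0.
  have [a ya] := specht_mxP yU.
  under eq_bigr => g _ do rewrite {1}ya mulr_suml.
  rewrite exchange_big big1 // => h _.
  under eq_bigr => g _ do rewrite -mulrA mulr_suml.
  rewrite -mulr_sumr exchange_big big1 ?mulr0 // => p pR.
  under eq_bigr => g _ do rewrite mulr_suml.
  rewrite exchange_big /=; transitivity ((\sum_(q in column_stabilizer n la)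
      (-1) ^+ odd_perm q * gcoef y (q * h)%g)^*); last by rewrite y0 rmorph0.
  rewrite rmorph_sum; apply: eq_bigr => q qC; rewrite (bigD1 (p * q * h)%g) //= eqxx mulr1.
  rewrite big1 ?addr0 => [|g ng]; last by rewrite eq_sym (negPf ng) mulr0 mul0r.
  rewrite rmorphM rmorphXn rmorphN1 -mulgA.
  by rewrite (gcoef_row_invariant _ hR).
apply: gcoef_inj => g; apply/eqP; rewrite -mul_conjC_eq0.
have /psumr_eq0P := yy0; move=> /(_ (fun g _ => mul_conjC_ge0 (gcoef y g))).
by move=> /(_ g isT) ->.
Qed.

Lemma cfdot_symmetric_group n (phi psi : 'CF(symmetric_group n)) :
  '[phi, psi] = n`!%:R^-1 * \sum_(s : 'S_n) phi s * (psi s)^*.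
Proof.
rewrite cfdotE cardsT card_Sn; congr (_ * _).
by apply: eq_bigl => s; rewrite inE.
Qed.

(** The identity has coefficient 1 in the Young symmetrizer: if [p] preserves rows, [q] preserves
    columns and [p * q = 1], then [p] fixes every cell. *)
Lemma specht_neq0 n la N P (r : {ffun 'I_n -> 'I_N}) (d : {ffun 'I_n -> 'I_P}) :
    (forall s, (s \in row_stabilizer n la) = fixes_coloring s r) ->
    (forall s, (s \in column_stabilizer n la) = fixes_coloring s d) ->
    injective (fun x => (r x, d x)) ->
  (0 < \rank (specht_mx n la))%N.
Proof.
move=> hR hC inj_rd; rewrite lt0n mxrank_eq0; apply/negP=> /eqP U0.
have : (young_symmetrizer n la <= specht_mx n la)%MS by apply: cyclic_mx_id.
rewrite U0 submx0 => /eqP y0.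
have RC p q : p \in row_stabilizer n la -> q \in column_stabilizer n la ->
    (p * q)%g = 1%g -> p = 1%g.
  rewrite hR hC => /forallP pr /forallP qd pq; apply/permP=> x; rewrite perm1.
  apply: inj_rd; rewrite (eqP (pr x)); congr (_, _).
  by rewrite -(eqP (qd _)) -permM pq perm1.
have one_stab (X : finType) (e : {ffun 'I_n -> X}) : fixes_coloring 1%g e.
  by apply/forallP=> x; rewrite perm1.
have : gcoef (young_symmetrizer n la) 1%g = 1.
  transitivity (\sum_(p in row_stabilizer n la) \sum_(q in column_stabilizer n la)
      (-1) ^+ odd_perm q * (p * q == 1)%g%:R : algC).
    rewrite /gcoef /young_symmetrizer summxE; apply: eq_bigr => p _.
    rewrite summxE; apply: eq_bigr => q _.
    by rewrite mxE -[X in _ * X]/(gcoef _ 1%g) gcoef_delta.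
  rewrite (bigD1 (1%g : 'S_n)) ?hR //=.
  rewrite (bigD1 (1%g : 'S_n)) ?hC //= odd_perm1 mulg1 eqxx mulr1.
  rewrite big1 ?addr0 => [|q /andP[_ /negPf q1]]; last by rewrite mul1g q1 mulr0.
  rewrite big1 ?addr0 // => p /andP[pR p1]; rewrite big1 // => q qC.
  by case: eqP => [/(RC _ _ pR qC)/eqP|]; rewrite ?(negPf p1) ?mulr0.
by rewrite /gcoef y0 mxE => /eqP; rewrite eq_sym oner_eq0.
Qed.

Lemma specht_char_det (n : nat) (la : seq nat) (N P : nat) (f : 'I_N -> nat)
    (r : {ffun 'I_n -> 'I_N}) (d : {ffun 'I_n -> 'I_P}) :
    (forall i j : 'I_N, (i < j)%N -> (f j <= f i)%N) ->
    (forall i, (f i <= P)%N) -> (\sum_i f i)%N = n ->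
    (forall s, (s \in row_stabilizer n la) = fixes_coloring s r) ->
    (forall s, (s \in column_stabilizer n la) = fixes_coloring s d) ->
    injective (fun x => (r x, d x)) ->
    (forall i j, ((i, j) \in codom (fun x => (r x, d x))) = (j < f i)%N) ->
  specht_char n la =1 det_char (beta_vec f).
Proof.
move=> f_dec f_P f_n row_r col_d inj_rd codom_rd.
pose e0 : {ffun 'I_n -> 'I_N * 'I_P} := [ffun x => (r x, d x)].
have inj_e0 : injective e0 by move=> x y; rewrite !ffunE => /inj_rd.
have codom_e0 i j : ((i, j) \in codom e0) = (j < f i)%N.
  by rewrite -codom_rd; congr (_ \in _); apply: eq_codom => x; rewrite ffunE.
have de0 : fsnd e0 = d by apply/ffunP=> x; rewrite !ffunE.
have re0 : ffst e0 = r by apply/ffunP=> x; rewrite !ffunE.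
have fact_neq0 : (n`!%:R : algC) != 0 by rewrite pnatr_eq0 -lt0n fact_gt0.
pose kap (w : 'S_N) := beta_vec f - permv w (staircase N).
have weight_r : weight r = kap 1%g.
  apply/ffunP=> i; rewrite -re0 weightE content_ffst !ffunE perm1 PoszD addrK.
  congr Posz; transitivity (\sum_(j < P) (j < f i))%N.
    by apply: eq_bigr => j _; rewrite content_injective // codom_e0.
  rewrite -[RHS](card_ord (f i)) -sum1_card (big_ord_widen _ (fun=> 1%N) (f_P i)).
  by rewrite [RHS]big_mkcond; apply: eq_bigr => j _; case: ifP.
pose Pi w := cfRepr (coloring_repr false n (kap w)).
pose E := cfRepr (coloring_repr true n (weight d)).
pose chi0 := specht_char n la.
pose phi := \sum_w (-1) ^+ odd_perm w *: Pi w.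
have phiE s : phi s = det_char (beta_vec f) s.
  rewrite det_charE sum_cfunE; apply: eq_bigr => w _.
  by rewrite cfunE cfRepr_coloring mul1r.
have PiE w : '[Pi w, E] = (w == 1%g)%:R.
  rewrite cfdot_symmetric_group.
  rewrite (eq_bigr (fun s : 'S_n => (-1) ^+ odd_perm s *
     coloring_char (weight (fsnd e0)) s * coloring_char (kap w) s)) => [|s _].
    rewrite sum_sign_coloring_beta //; first by rewrite mulKf.
  rewrite !cfRepr_coloring mul1r rmorphM rmorphXn rmorphN1 mulrC de0.
  by congr (_ * _ * _); rewrite rmorph_sum; apply: eq_bigr => c _; rewrite rmorph_nat.
have char_chi : chi0 \is a character by apply: cfRepr_char.
have char_Pi w : Pi w \is a character by apply: cfRepr_char.
have [th1 char_th1 Pi1] : exists2 theta, theta \is a character & Pi 1%g = chi0 + theta.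
  by rewrite /Pi -weight_r; apply: specht_row_embed.
have [th2 char_th2 E2] : exists2 theta, theta \is a character & E = chi0 + theta.
  exact: specht_column_embed row_r col_d.
have ge0 (a b : 'CF(symmetric_group n)) : a \is a character -> b \is a character ->
    0 <= '[a, b].
  by move=> ca cb; rewrite natr_ge0 // Cnat_cfdot_char.
(* The chain from 1 through ['[chi0]] and ['[Pi 1%g, chi0]] to ['[Pi 1%g, E] = 1] collapses. For
   other [w], ['[Pi w, chi0]] lies between 0 and ['[Pi w, E] = 0]. *)
have norm_ge1 : 1 <= '[chi0].
  have /natrP[k chik] : '[chi0] \in Num.nat by apply: Cnat_cfdot_char.
  rewrite chik ler1n lt0n -(pnatr_eq0 algC) -chik cfnorm_eq0.
  apply/eqP=> /cfunP/(_ 1%g); rewrite cfRepr1 cfunE => /eqP.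
  by rewrite pnatr_eq0 -leqn0 leqNgt (specht_neq0 row_r col_d).
have le1 w : '[Pi w, chi0] <= (w == 1%g)%:R.
  by rewrite -PiE E2 cfdotDr lerDl ge0.
have norm_le : '[chi0] <= '[Pi 1%g, chi0] by rewrite Pi1 cfdotDl lerDl ge0.
have Pichi w : '[Pi w, chi0] = (w == 1%g)%:R.
  apply/eqP; rewrite eq_le le1 /=; case: eqP => [->|_]; last exact: ge0.
  exact: le_trans norm_ge1 norm_le.
have chi_norm : '[chi0] = 1.
  by apply/eqP; rewrite eq_le norm_ge1 andbT; apply: le_trans norm_le _; rewrite Pichi eqxx.
have phichi : '[phi, chi0] = 1.
  rewrite cfdot_suml (bigD1 1%g) //= cfdotZl Pichi odd_perm1 eqxx mulr1.
  by rewrite big1 ?addr0 // => w /negPf w1; rewrite cfdotZl Pichi w1 mulr0.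
have phi_norm : '[phi] = 1.
  rewrite cfdot_symmetric_group; under eq_bigr => s _ do rewrite phiE.
  by rewrite (det_char_norm f_dec f_n) mulVf.
have : '[phi - chi0] = 0.
  by rewrite cfnormB phi_norm chi_norm phichi rmorph1 subrr.
move/eqP; rewrite cfnorm_eq0 subr_eq0 => /eqP phi_chi s.
by rewrite -phiE phi_chi.
Qed.

(** * Frobenius' character formula *)

Lemma fixes_coloring_porbit n (X : finType) (s : 'S_n) (e : {ffun 'I_n -> X}) x y :
  fixes_coloring s e -> y \in porbit s x -> e y = e x.
Proof.
move=> /forallP fe /porbitP[i ->]; elim: i => [|i IHi]; first by rewrite expg0 perm1.
by rewrite expgSr permM (eqP (fe _)).
Qed.

(** A coloring fixed by [s] chooses one color per cycle, and a cycle of length [c] adds [c] to the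
    weight of its color: each cycle acts as a power sum. *)
Lemma det_char_psums n N (v : {ffun 'I_N -> int}) (s : 'S_n) :
  det_char v s = psums [seq #|X| | X : {set 'I_n} in porbits s] (@alternant N) v.
Proof.
rewrite psumsE /image_mem size_map; set Q := enum _; set m := size Q.
have hP x : (index (porbit s x) Q < m)%N.
  by rewrite index_mem mem_enum imset_f.
pose h x := Ordinal (hP x).
have exh i : exists x, h x == i.
  have : nth set0 Q i \in Q by rewrite mem_nth.
  rewrite mem_enum => /imsetP[x _ xi]; exists x; rewrite -val_eqE /= -xi.
  by rewrite index_uniq // enum_uniq.
pose rep i := xchoose (exh i).
have repK i : h (rep i) = i by apply/eqP/(xchooseP (exh i)).
have h_orbit x y : h x = h y -> x \in porbit s y.
  move=> /(congr1 val)/= /(congr1 (nth set0 Q)).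
  rewrite !nth_index ?mem_enum ?imset_f // => <-; exact: porbit_id.
have orbit_h x y : x \in porbit s y -> h x = h y.
  by rewrite porbit_sym -eq_porbit_mem => /eqP e; apply: val_inj; rewrite /= e.
rewrite /det_char (reindex (fun d : {ffun 'I_m -> 'I_N} => [ffun x => d (h x)])) /=; last first.
  exists (fun c : {ffun 'I_n -> 'I_N} => [ffun i => c (rep i)]) => [d _|c].
    by apply/ffunP=> i; rewrite !ffunE repK.
  rewrite inE => fc; apply/ffunP=> x; rewrite !ffunE.
  by apply: (fixes_coloring_porbit fc); apply: h_orbit; rewrite repK.
apply: eq_big => [d|d _].
  apply/forallP=> x; rewrite !ffunE; apply/eqP; congr (d _); apply: orbit_h.
  by have := mem_porbit s 1 x; rewrite expg1.
congr (alternant (_ - _)); rewrite /weight.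
rewrite (partition_big h xpredT) //=; apply: eq_bigr => i _.
rewrite (eq_bigr (fun=> unitv (d i))) => [|x /eqP <-]; last by rewrite ffunE.
rewrite sumr_const; congr (_ *+ _); rewrite (nth_map set0) //.
have : nth set0 Q i \in Q by rewrite mem_nth.
rewrite mem_enum => /imsetP[x _ xi]; rewrite xi; apply: eq_card => y.
rewrite unfold_in; apply/eqP/idP => [hy|].
  have {}hy : h y = i by apply: val_inj.
  apply: h_orbit; rewrite hy; apply: val_inj; rewrite /= -xi index_uniq //.
  exact: enum_uniq.
by move/orbit_h => ->; rewrite /= -xi index_uniq // enum_uniq.
Qed.

Lemma partition_nth_dec la i j : is_partition la -> (i <= j)%N ->
  (nth 0 la j <= nth 0 la i)%N.
Proof.
case/andP=> srt _ ij; case: (ltnP j (size la)) => [jl|jl]; last by rewrite nth_default.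
have geq_tr : transitive geq by move=> a b c ba cb; apply: leq_trans cb ba.
have geq_refl : reflexive geq by move=> a; apply: leqnn.
have := sorted_leq_nth geq_tr geq_refl 0%N srt.
by move=> /(_ i j); rewrite !inE; apply => //; apply: leq_ltn_trans jl.
Qed.

Lemma sum_nth_partition la N : (size la <= N)%N ->
  (\sum_(i < N) nth 0 la i = sumn la)%N.
Proof.
move=> sl; rewrite sumnE (big_nth 0%N) big_mkord.
rewrite (big_ord_widen N (fun i => nth 0 la i)%N sl) big_mkcond /=.
rewrite [RHS]big_mkcond; apply: eq_bigr => i _; case: ltnP => // li.
by rewrite nth_default.
Qed.

Lemma nth_le_sumn la i : (nth 0 la i <= sumn la)%N.
Proof.
case: (ltnP i (size la)) => [il|il]; last by rewrite nth_default.
by rewrite -(sum_nth_partition (leqnn _)) (bigD1 (Ordinal il)) //= leq_addr.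
Qed.

Lemma tableau_coordinates la N : (size la <= N)%N ->
  exists (r : {ffun 'I_(sumn la) -> 'I_N}) (d : {ffun 'I_(sumn la) -> 'I_(sumn la)}),
    [/\ forall s, (s \in row_stabilizer (sumn la) la) = fixes_coloring s r,
        forall s, (s \in column_stabilizer (sumn la) la) = fixes_coloring s d,
        injective (fun x => (r x, d x)) &
        forall i j, ((i, j) \in codom (fun x => (r x, d x))) = (j < nth 0 la i)%N].
Proof.
move=> sN.
have rowP (x : 'I_(sumn la)) : (reshape_index la x < N)%N.
  by apply: leq_trans sN; apply: reshape_indexP.
have offP (x : 'I_(sumn la)) : (reshape_offset la x < nth 0 la (reshape_index la x))%N.
  exact: reshape_offsetP.
have colP (x : 'I_(sumn la)) : (reshape_offset la x < sumn la)%N.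
  exact: leq_trans (offP x) (nth_le_sumn _ _).
exists [ffun x => Ordinal (rowP x)], [ffun x => Ordinal (colP x)]; split.
- by move=> t; rewrite inE; apply: eq_forallb => x; rewrite !ffunE -val_eqE.
- by move=> t; rewrite inE; apply: eq_forallb => x; rewrite !ffunE -val_eqE.
- move=> x y []; rewrite !ffunE => -[xy1] [xy2]; apply: val_inj => /=.
  by rewrite -(reshape_indexK la x) -(reshape_indexK la y) xy1 xy2.
move=> i j; apply/codomP/idP => [[x]|].
  by rewrite !ffunE => -[-> ->] /=; apply: offP.
move=> ji; have il : (i < size la)%N.
  by rewrite ltnNge; apply: contraL ji => il; rewrite nth_default.
have xP : (flatten_index la i j < sumn la)%N by apply: flatten_indexP.
exists (Ordinal xP); rewrite !ffunE; congr (_, _); apply: val_inj => /=.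
  by rewrite flatten_indexKl.
by rewrite flatten_indexKr.
Qed.

(** [N] is any bound on the length, so that all partitions can later share one even number of
    beads. *)
Lemma specht_char_psums la N (eta : seq nat) (s : 'S_(sumn la)) :
    is_partition la -> (size la <= N)%N -> s \in cycle_class (sumn la) eta ->
  specht_char (sumn la) la s =
  psums eta (@alternant N) (beta_vec (fun i : 'I_N => nth 0%N la i)).
Proof.
move=> pla sN; rewrite inE => seta; rewrite -(perm_psums _ seta) -det_char_psums.
have [r [d [row_r col_d inj_rd codom_rd]]] := tableau_coordinates sN.
apply: (@specht_char_det _ la N (sumn la) _ r d) => // [i j ij|i|].
- by apply: partition_nth_dec => //; apply: ltnW.
- exact: nth_le_sumn.
- exact: sum_nth_partition.
Qed.

(** * Sizes of conjugacy classes *)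

(** Cycles are taken on a subset [A] so that an induction can remove the cycle through a point and
    continue on its complement. *)
Definition cycles_on (T : finType) (A : {set T}) (s : {perm T}) : seq nat :=
  [seq #|X| | X : {set T} in [set porbit s x | x in A]].

Definition perms_of_type (T : finType) (A : {set T}) (eta : seq nat) :
    {set {perm T}} :=
  [set s | perm_on A s && perm_eq (cycles_on A s) eta].

Definition full_cycles (T : finType) (X : {set T}) (x : T) : {set {perm T}} :=
  [set s | perm_on X s && (porbit s x == X)].

Lemma sum_subsets (T : finType) (B : {set T}) (F : nat -> nat) :
  (\sum_(X : {set T} | X \subset B) F #|X| = \sum_(k < #|B|.+1) 'C(#|B|, k) * F k)%N.
Proof.
rewrite (partition_big (fun X : {set T} => inord #|X| : 'I_#|B|.+1) xpredT) //=.
apply: eq_bigr => k _; rewrite -cards_draws -sum1dep_card big_distrl /=.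
apply: eq_big => [X|X /andP[XB /eqP <-]].
  case: (boolP (X \subset B)) => //= XB; rewrite -val_eqE /= inordK // ltnS.
  exact: subset_leq_card.
by rewrite mul1n inordK // ltnS subset_leq_card.
Qed.

Lemma sum_subsets_containing (T : finType) (A : {set T}) x (F : nat -> nat) :
    x \in A ->
  (\sum_(X : {set T} | (x \in X) && (X \subset A)) F #|X| =
   \sum_(k < #|A|) 'C(#|A|.-1, k) * F k.+1)%N.
Proof.
move=> xA; have cA : #|A| = #|A :\ x|.+1 by rewrite (cardsD1 x) xA.
rewrite [in RHS]cA /= -(sum_subsets _ (fun k => F k.+1)).
rewrite (reindex_onto (fun Y => x |: Y) (fun X => X :\ x)) /=; last first.
  by move=> X /andP[xX _]; rewrite setD1K.
apply: eq_big => [Y|Y]; last first.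
  by case/andP=> _ /eqP YE; rewrite cardsU1 -YE !inE eqxx.
rewrite setU11 /= subUset sub1set xA /= subsetD1.
apply/andP/andP => [[YA /eqP YE]|[YA xY]].
  by split=> //; rewrite -YE !inE eqxx.
by split=> //; rewrite setU1K.
Qed.

Lemma perm_on_restr (T : finType) (X : {set T}) (s : {perm T}) :
    (forall y, y \in X -> s y \in X) ->
  exists2 t : {perm T}, perm_on X t & {in X, t =1 s}.
Proof.
move=> sX.
have sX' y : (s y \in X) = (y \in X).
  apply/idP/idP => [syX|/sX //].
  have : s @: X == X.
    rewrite eqEcard card_imset ?leqnn ?andbT; last exact: perm_inj.
    by apply/subsetP=> _ /imsetP[z zX ->]; apply: sX.
  move/eqP=> e; move: syX; rewrite -{1}e => /imsetP[z zX /perm_inj ->].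
  by [].
have injf : injective (fun y => if y \in X then s y else y).
  move=> y z; case: ifP => yX; case: ifP => zX.
  - exact: perm_inj.
  - by move=> e; move: zX; rewrite -e sX' yX.
  - by move=> e; move: yX; rewrite e sX' zX.
  - by [].
exists (perm injf); last by move=> y yX; rewrite permE yX.
by apply/subsetP=> y; rewrite inE permE; case: ifP => //; rewrite eqxx.
Qed.

Lemma porbit_eq_in (T : finType) (X : {set T}) (s t : {perm T}) y :
    {in X, t =1 s} -> (forall y, y \in X -> s y \in X) -> y \in X ->
  porbit s y = porbit t y.
Proof.
move=> ts sX yX.
have it i : (s ^+ i)%g y = (t ^+ i)%g y /\ (s ^+ i)%g y \in X.
  elim: i => [|i [IH1 IH2]]; first by rewrite !expg0 perm1.
  by rewrite !expgSr !permM -IH1 ts //; split=> //; apply: sX.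
apply/setP=> z; apply/porbitP/porbitP => -[i ->]; exists i.
  by case: (it i).
by case: (it i).
Qed.

Lemma perm_cycles_setU1 (T : finType) (X : {set T}) (Q : {set {set T}}) :
  X \notin Q ->
  perm_eq [seq #|Y| | Y : {set T} in X |: Q] (#|X| :: [seq #|Y| | Y : {set T} in Q]).
Proof.
move=> XQ; rewrite -[RHS in perm_eq _ RHS]/(map _ (X :: enum Q)).
rewrite /image_mem; apply: perm_map; apply: uniq_perm.
- exact: enum_uniq.
- by rewrite /= mem_enum XQ enum_uniq.
- by move=> Y; rewrite mem_enum !inE mem_enum.
Qed.

Lemma cycles_on_mul (T : finType) (A X : {set T}) (x : T) (s1 s2 : {perm T}) :
    X \subset A -> x \in X ->
    s1 \in full_cycles X x -> perm_on (A :\: X) s2 ->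
  [/\ perm_on A (s1 * s2)%g, porbit (s1 * s2)%g x = X,
      {in X, s1 =1 (s1 * s2)%g}, {in A :\: X, s2 =1 (s1 * s2)%g} &
      perm_eq (cycles_on A (s1 * s2)%g) (#|X| :: cycles_on (A :\: X) s2)].
Proof.
move=> XA xX; rewrite inE => /andP[on1 /eqP orb1] on2; set s := (s1 * s2)%g.
have sX : {in X, s1 =1 s}.
  move=> y yX; rewrite permM (out_perm on2) //.
  by rewrite inE perm_closed // yX.
have sD : {in A :\: X, s2 =1 s}.
  by move=> y; rewrite inE => /andP[yX _]; rewrite permM (out_perm on1).
have X_stable y : y \in X -> s y \in X by move=> yX; rewrite -sX // perm_closed.
have D_stable y : y \in A :\: X -> s y \in A :\: X.
  by move=> yD; rewrite -sD // perm_closed.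
have on_s : perm_on A s.
  apply/subsetP=> y; rewrite inE permM; apply: contraR => yA.
  have yX : y \notin X by apply: contra yA; apply: (subsetP XA).
  by rewrite (out_perm on1) // (out_perm on2) // inE (negPf yA) andbF.
have orb : porbit s x = X by rewrite (porbit_eq_in sX X_stable xX).
split=> //; have -> : cycles_on A s =
    [seq #|Y| | Y : {set T} in X |: [set porbit s2 y | y in A :\: X]].
  rewrite /cycles_on; set U := [set _ | _ in A]; set V := _ |: _.
  suff -> : U = V by [].
  apply/setP=> Y; rewrite !inE; apply/imsetP/idP => [[y yA ->]|].
    have [yX|yX] := boolP (y \in X); last first.
      have yD : y \in A :\: X by rewrite inE yX.
      by apply/orP; right; rewrite (porbit_eq_in sD D_stable yD) imset_f.
    by apply/orP; left; move: yX; rewrite -{1}orb -eq_porbit_mem => /eqP ->; rewrite orb.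
  case/orP=> [/eqP ->|/imsetP[y yD ->]]; first by exists x; rewrite ?(subsetP XA).
  by exists y; rewrite ?(porbit_eq_in sD D_stable yD) //; move: yD; rewrite inE => /andP[].
apply: perm_cycles_setU1; apply/imsetP=> -[y yD XE].
have : y \in X by rewrite XE porbit_id.
by move: yD; rewrite inE => /andP[/negPf->].
Qed.

(** Such an [s] is uniquely the product of a full cycle on [X] and a permutation of the complement
    of [X] in [A]. *)
Lemma card_perms_with_cycle (T : finType) (A X : {set T}) (x : T)
    (Q : pred (seq nat)) :
    X \subset A -> x \in X ->
    (forall t t', perm_eq t t' -> Q t = Q t') ->
  #|[set s | [&& perm_on A s, porbit s x == X & Q (cycles_on A s)]]| =
  (#|full_cycles X x| *
   #|[set s | perm_on (A :\: X) s && Q (#|X| :: cycles_on (A :\: X) s)]|)%N.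
Proof.
move=> XA xX permQ; rewrite -cardsX -[RHS](card_in_imset (f := fun p => (p.1 * p.2)%g)).
  apply: eq_card => s; rewrite !inE; apply/and3P/imsetP.
    case=> on_s /eqP orb Qs.
    have X_stable y : y \in X -> s y \in X.
      by rewrite -orb -!eq_porbit_mem; have := porbit_perm s 1 y; rewrite expg1 => ->.
    have D_stable y : y \in A :\: X -> s y \in A :\: X.
      rewrite !inE (perm_closed _ on_s) => /andP[yX ->]; rewrite andbT; apply: contra yX.
      by rewrite -orb -!eq_porbit_mem; have := porbit_perm s 1 y; rewrite expg1 => ->.
    have [s1 on1 s1E] := perm_on_restr X_stable.
    have [s2 on2 s2E] := perm_on_restr D_stable.
    have sE : s = (s1 * s2)%g.
      apply/permP=> y; rewrite permM; have [yX|yX] := boolP (y \in X).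
        by rewrite s1E // (out_perm on2) // inE X_stable.
      rewrite (out_perm on1) //; have [yA|yA] := boolP (y \in A).
        by rewrite s2E // inE yX.
      by rewrite (out_perm on2) ?inE ?(negPf yA) ?andbF // (out_perm on_s).
    have fc1 : s1 \in full_cycles X x.
      by rewrite inE on1 -(porbit_eq_in s1E X_stable xX) orb eqxx.
    have [_ _ _ _ cyc] := cycles_on_mul XA xX fc1 on2.
    exists (s1, s2) => //; rewrite !inE /= on2 -(permQ _ _ cyc) -sE Qs.
    by move: fc1; rewrite /full_cycles in_set => ->.
  case=> -[s1 s2]; rewrite !inE /= => /andP[fc1 /andP[on2 Q2]] ->.
  have {}fc1 : s1 \in full_cycles X x by rewrite in_set.
  by have [on_s orb _ _ cyc] := cycles_on_mul XA xX fc1 on2; rewrite (permQ _ _ cyc) orb eqxx.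
move=> [s1 s2] [t1 t2]; rewrite !inE /= => /andP[fc1 /andP[on2 _]].
move=> /andP[fc1' /andP[on2' _]] e.
have fcs : s1 \in full_cycles X x by rewrite in_set.
have fct : t1 \in full_cycles X x by rewrite in_set.
have [_ _ X1 _ _] := cycles_on_mul XA xX fcs on2.
have [_ _ X2 _ _] := cycles_on_mul XA xX fct on2'.
have st1 : s1 = t1.
  apply/permP=> y; have [yX|yX] := boolP (y \in X); first by rewrite X1 // X2 // e.
  by case/andP: fc1 => on1 _; case/andP: fc1' => on1' _; rewrite !(@out_perm _ X).
by congr (_, _) => //; apply: (mulgI s1); rewrite {2}st1.
Qed.

Lemma porbit_sub (T : finType) (A : {set T}) (s : {perm T}) x :
  perm_on A s -> x \in A -> porbit s x \subset A.
Proof.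
move=> on_s xA; apply/subsetP=> y /porbitP[i ->].
by elim: i => [|i IHi]; rewrite ?expg0 ?perm1 // expgSr permM (perm_closed _ on_s).
Qed.

(** [Q] is abstract because the splitting serves twice: for all permutations, which yields the
    number of full cycles, and for a given cycle type. *)
Lemma card_perms_sum (T : finType) (A : {set T}) x (Q : pred (seq nat)) :
    x \in A -> (forall t t', perm_eq t t' -> Q t = Q t') ->
  #|[set s | perm_on A s && Q (cycles_on A s)]| =
  (\sum_(X : {set T} | (x \in X) && (X \subset A)) #|full_cycles X x| *
   #|[set s | perm_on (A :\: X) s && Q (#|X| :: cycles_on (A :\: X) s)]|)%N.
Proof.
move=> xA permQ; rewrite -sum1dep_card.
rewrite (partition_big (fun s : {perm T} => porbit s x)
  (fun X => (x \in X) && (X \subset A))) /= => [|s /andP[on_s _]]; last first.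
  by rewrite porbit_id porbit_sub.
apply: eq_bigr => X /andP[xX XA]; rewrite -card_perms_with_cycle // sum1dep_card.
by apply: eq_card => s; rewrite !inE -andbA [X in _ && X]andbC.
Qed.

Lemma card_perm_on (T : finType) (A : {set T}) :
  #|[set s | perm_on A s && predT (cycles_on A s)]| = #|A|`!.
Proof. by rewrite -card_perm; apply: eq_card => s; rewrite inE andbT. Qed.

(** The product (k-1)! (|A|-k)! times the number of [k]-subsets of [A] through [x] is (|A|-1)! for
    every [k]. *)
Lemma sum_factorials (T : finType) (A : {set T}) x (G : nat -> nat) : x \in A ->
  (\sum_(X : {set T} | (x \in X) && (X \subset A))
     #|X|.-1`! * (#|A| - #|X|)`! * G #|X| = #|A|.-1`! * \sum_(k < #|A|) G k.+1)%N.
Proof.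
move=> xA.
rewrite (sum_subsets_containing (fun k => k.-1`! * (#|A| - k)`! * G k)%N xA).
rewrite big_distrr; apply: eq_bigr => k _ /=; rewrite !mulnA; congr (_ * _)%N.
rewrite -(@bin_fact #|A|.-1 k); last by have := ltn_ord k; lia.
by rewrite -mulnA; congr (_ * (_ * _`!))%N; have := ltn_ord k; lia.
Qed.

(** The |X|! permutations are split by the cycle [Y] through [x]. By [sum_factorials] the claimed
    values also add up to |X|!; the terms with [Y] proper agree by induction, hence so does the term
    [Y = X]. *)
Lemma card_full_cycles (T : finType) (X : {set T}) x :
  x \in X -> #|full_cycles X x| = #|X|.-1`!.
Proof.
move: {2}#|X| (leqnn #|X|) => m; elim: m X => [|m IHm] X cX xX.
  by move: cX; rewrite (cardsD1 x) xX.
have := @sum_factorials _ X x (fun=> 1%N) xX; rewrite sum1_card card_ord.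
have -> : (#|X|.-1`! * #|X| = #|X|`!)%N.
  by rewrite (cardsD1 x) xX /= mulnC.
rewrite -card_perm_on (@card_perms_sum _ _ x) //.
rewrite (bigD1 X) ?xX //= [in RHS](bigD1 X) ?xX //= subnn !muln1.
have -> : #|[set s | perm_on (X :\: X) s && true]| = 1%N.
  by have := card_perm_on (X :\: X); rewrite setDv cards0.
rewrite muln1; set S1 := (\sum_(Y | _) _)%N; set S2 := (\sum_(Y | _) _)%N.
suff -> : S1 = S2 by move/addIn.
apply: eq_bigr => Y /andP[/andP[xY YX] neYX].
have ltYX : (#|Y| < #|X|)%N by rewrite proper_card // properEneq neYX.
rewrite IHm //; last by rewrite -ltnS (leq_trans ltYX).
by rewrite muln1 (card_perm_on (X :\: Y)) cardsD (setIidPr YX).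
Qed.

Lemma zfrak_widen eta B : (sumn eta <= B)%N ->
  zfrak eta = (\prod_(1 <= i < B.+1) (i ^ count_mem i eta * (count_mem i eta)`!))%N.
Proof.
move=> sB; rewrite /zfrak [RHS](big_cat_nat (n := (sumn eta).+1)) //=.
rewrite -[LHS]muln1; congr (_ * _)%N; rewrite big_nat big1 // => i /andP[si _].
rewrite (_ : count_mem i eta = 0%N) ?muln1 //; apply/count_memPn.
apply: contraL si => /perm_to_rem/perm_sumn /= ->.
by rewrite -leqNgt leq_addr.
Qed.

Lemma zfrak_cons k eta : (0 < k)%N ->
  zfrak (k :: eta) = (zfrak eta * (k * (count_mem k eta).+1))%N.
Proof.
move=> k0; rewrite (@zfrak_widen eta (sumn (k :: eta))) ?leq_addl // /zfrak.
have kin : k \in index_iota 1 (sumn (k :: eta)).+1.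
  by rewrite mem_index_iota k0 /= ltnS leq_addr.
rewrite !(bigD1_seq k) ?iota_uniq //= eqxx.
rewrite (eq_bigr (fun i => i ^ count_mem i eta * (count_mem i eta)`!)%N); last first.
  by move=> i /negPf ik; rewrite eq_sym ik.
by rewrite add1n expnS factS mulnACA -mulnA mulnC.
Qed.

Lemma perm_zfrak eta eta' : perm_eq eta eta' -> zfrak eta = zfrak eta'.
Proof.
move=> e; rewrite /zfrak (perm_sumn e); apply: eq_bigr => i _.
by rewrite (seq.permP e).
Qed.

Lemma sum_mul_count eta B : (sumn eta <= B)%N ->
  (\sum_(k < B) k.+1 * count_mem k.+1 eta = sumn eta)%N.
Proof.
elim: eta => [|j eta IH] /= sB; first by rewrite big1 // => k _; rewrite muln0.
rewrite (eq_bigr (fun k : 'I_B => k.+1 * (j == k.+1) + k.+1 * count_mem k.+1 eta)%N).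
  rewrite big_split /= IH; last by apply: leq_trans sB; apply: leq_addl.
  congr addn; case: j sB => [|j] sB; first by rewrite big1 // => k _; rewrite muln0.
  have jB : (j < B)%N by apply: leq_trans sB; rewrite addSn ltnS leq_addr.
  rewrite (bigD1 (Ordinal jB)) //= eqxx muln1 big1 ?addn0 // => k.
  by rewrite -val_eqE eqSS eq_sym => /negPf->; rewrite muln0.
by move=> k _; rewrite mulnDr.
Qed.

(** Deleting a part [k] of multiplicity [m] divides [zfrak] by [k * m]. After the factorials are
    collected, the cycle through [x] leaves the sum of [k * m] over all sizes [k], which is |A|. *)
Lemma card_perms_of_type (T : finType) (A : {set T}) eta :
    0%N \notin eta -> sumn eta = #|A| ->
  (#|perms_of_type A eta| * zfrak eta = #|A|`!)%N.
Proof.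
move: {2}#|A| (leqnn #|A|) => m; elim: m A eta => [|m IHm] A eta cA eta0 sA.
  have A0 : A = set0 by apply/eqP; rewrite -cards_eq0 -leqn0.
  have -> : eta = [::].
    case: eta eta0 sA => // k eta; rewrite inE negb_or A0 cards0 /=; lia.
  rewrite A0 cards0 /zfrak big_nil muln1; apply/eqP/cards1P; exists 1%g.
  apply/setP=> s; rewrite !inE; apply/andP/eqP => [[on_s _]|->].
    by apply/permP=> x; rewrite (out_perm on_s) ?perm1 // inE.
  split; first exact: perm_on1.
  by rewrite /cycles_on imset0 /image_mem enum_set0.
have [A0|[x xA]] := set_0Vmem A.
  by apply: IHm => //; rewrite A0 cards0.
pose Q t := perm_eq t eta.
have permQ t t' : perm_eq t t' -> Q t = Q t' by move=> /permPl e; rewrite /Q e.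
rewrite /perms_of_type -/(Q _) (@card_perms_sum _ _ x Q) // big_distrl /=.
transitivity (\sum_(X : {set T} | (x \in X) && (X \subset A))
   #|X|.-1`! * (#|A| - #|X|)`! * (#|X| * count_mem #|X| eta))%N.
  apply: eq_bigr => X /andP[xX XA]; rewrite card_full_cycles // -!mulnA.
  congr (_ * _)%N.
  have cD : #|A :\: X| = (#|A| - #|X|)%N by rewrite cardsD (setIidPr XA).
  have X0 : (0 < #|X|)%N by rewrite (cardsD1 x) xX.
  have XA' : (#|X| <= #|A|)%N by apply: subset_leq_card.
  have [Xe|Xe] := boolP (#|X| \in eta); last first.
    rewrite (count_memPn Xe) !muln0; apply/eqP; rewrite muln_eq0 cards_eq0.
    apply/orP; left; apply/eqP/setP=> s; rewrite !inE /Q; apply/negP=> /andP[_ e].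
    by case/negP: Xe; rewrite -(perm_mem e) mem_head.
  have e := perm_to_rem Xe.
  rewrite (perm_zfrak e) zfrak_cons // mulnA (seq.permP e) /= eqxx add1n -cD.
  rewrite -(IHm _ (rem #|X| eta)); first last.
  - by have := perm_sumn e; rewrite sA cD /= => ->; rewrite addKn.
  - by apply: contra eta0; apply: mem_rem.
  - by rewrite cD; lia.
  congr (_ * _ * _)%N; apply: eq_card => s; rewrite !inE; congr andb.
  by rewrite /Q (seq.permPr e) perm_cons.
rewrite (@sum_factorials _ A x (fun k => k * count_mem k eta)%N) //.
by rewrite sum_mul_count ?sA // (cardsD1 x) xA /= mulnC.
Qed.

Lemma card_cycle_class n eta : 0%N \notin eta -> sumn eta = n ->
  (#|cycle_class n eta| * zfrak eta = n`!)%N.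
Proof.
move=> eta0 sn; rewrite -[in RHS](card_ord n) -cardsT -(@card_perms_of_type _ _ eta) //.
  congr (_ * _)%N; apply: eq_card => s; rewrite !inE.
  have -> : perm_on [set: 'I_n] s by apply/subsetP=> x; rewrite inE.
  rewrite /cycles_on /porbits (_ : [set porbit s x | x in [set: 'I_n]] = [set porbit s x | x : 'I_n]) //.
  by apply/setP=> Y; apply/imsetP/imsetP => -[x _ ->]; exists x; rewrite ?inE.
by rewrite cardsT card_ord.
Qed.

Lemma zfrak_gt0 eta : (0 < zfrak eta)%N.
Proof.
rewrite /zfrak big_nat; elim/big_ind: _ => [//|a b a0 b0|i /andP[i0 _]].
  by rewrite muln_gt0 a0.
by rewrite muln_gt0 fact_gt0 expn_gt0 i0.
Qed.

Lemma cycle_class_gt0 n eta : 0%N \notin eta -> sumn eta = n ->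
  (0 < #|cycle_class n eta|)%N.
Proof.
move=> e0 sn; have := fact_gt0 n.
by rewrite -(card_cycle_class e0 sn) muln_gt0 => /andP[].
Qed.

Lemma chi_psums la N eta :
    is_partition la -> (size la <= N)%N -> 0%N \notin eta -> sumn eta = sumn la ->
  chi la eta = psums eta (@alternant N) (beta_vec (fun i : 'I_N => nth 0%N la i)).
Proof.
move=> pla sN eta0 se; rewrite /chi (specht_char_psums (eta := eta) pla sN) //.
(* [repr] returns an element of the class only because the class is nonempty; on the empty set it
   defaults to the identity. *)
have /card_gt0P[s sC] := cycle_class_gt0 eta0 se.
exact: mem_repr sC.
Qed.

Lemma dimension_gt0 la : (0 < dimension la)%N.
Proof.
have [r [d [row_r col_d inj_rd _]]] := tableau_coordinates (leqnn (size la)).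
exact: specht_neq0 row_r col_d inj_rd.
Qed.

Lemma eq_cycle_class n eta eta' : perm_eq eta eta' -> cycle_class n eta = cycle_class n eta'.
Proof. by move=> e; apply/setP=> s; rewrite !inE (seq.permPr e). Qed.

Lemma zfrak_cat_2 nu k : 2 \notin nu ->
  zfrak (nu ++ nseq k 2) = (zfrak nu * (2 ^ k * k`!))%N.
Proof.
move=> nu2; rewrite (perm_zfrak (permEl (perm_catC _ _))).
elim: k => [|k IHk] /=; first by rewrite muln1.
rewrite zfrak_cons // IHk count_cat (count_memPn nu2) addn0 count_nseq /= mul1n.
by rewrite expnS factS; ring.
Qed.

(** The dimension and the factorial of |la| cancel, leaving the ratio of the two [zfrak] values. As
    [nu] has no part 2, this ratio is 2^m m! / (zfrak nu 2^k k!) with m - k = |nu|/2, whence the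
    power of 2. *)
Lemma g_charE nu la :
    is_partition la -> is_partition nu -> all odd nu ->
    ~~ odd (sumn nu) -> ~~ odd (sumn la) -> (sumn nu <= sumn la)%N ->
  let k := (sumn la - sumn nu)./2 in
  g_char nu la = 2 ^+ (sumn nu)./2 / (zfrak nu)%:R *
    (((sumn la)./2)`!%:R / k`!%:R *
      (chi la (nseq k 2 ++ nu) / chi la (nseq (sumn la)./2 2))).
Proof.
move=> pla pnu nu_odd nu_even la_even nu_la k.
set m := (sumn la)./2.
have nu0 : 0%N \notin nu by case/andP: pnu.
have nu2 : 2 \notin nu by apply/negP=> /(allP nu_odd).
have mE : m.*2 = sumn la by rewrite /m -[RHS]odd_double_half (negPf la_even).
have pE : (sumn nu)./2.*2 = sumn nu by rewrite -[RHS]odd_double_half (negPf nu_even).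
have kE : k = (m - (sumn nu)./2)%N.
  by rewrite /k -mE -{1}pE -doubleB doubleK.
have pm : ((sumn nu)./2 <= m)%N by rewrite -leq_double mE pE.
have s1 : sumn (complete_by_2 (sumn la) nu) = sumn la.
  rewrite /complete_by_2 sumn_cat sumn_nseq -/k kE; lia.
have c2 : complete_by_2 (sumn la) [::] = nseq m 2 by rewrite /complete_by_2 subn0.
have s2 : sumn (nseq m 2) = sumn la by rewrite sumn_nseq; lia.
have z1 : 0%N \notin complete_by_2 (sumn la) nu.
  by rewrite mem_cat negb_or nu0 mem_nseq andbF.
have z2 : 0%N \notin nseq m 2 by rewrite mem_nseq andbF.
have C1 := card_cycle_class z1 s1; have C2 := card_cycle_class z2 s2.
have chi1 : chi la (complete_by_2 (sumn la) nu) = chi la (nseq k 2 ++ nu).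
  by rewrite /chi (eq_cycle_class _ (permEl (perm_catC _ _))).
rewrite /g_char /f_char c2 chi1.
have d0 : (dimension la)%:R != 0 :> algC by rewrite pnatr_eq0 -lt0n dimension_gt0.
have fact0 j : (j`!)%:R != 0 :> algC by rewrite pnatr_eq0 -lt0n fact_gt0.
have zn0 : (zfrak nu)%:R != 0 :> algC by rewrite pnatr_eq0 -lt0n zfrak_gt0.
have two0 : 2 != 0 :> algC by rewrite pnatr_eq0.
have cc eta : 0%N \notin eta -> sumn eta = sumn la ->
    #|cycle_class (sumn la) eta|%:R = (sumn la)`!%:R / (zfrak eta)%:R :> algC.
  move=> e0 se; rewrite -(card_cycle_class e0 se) natrM mulfK //.
  by rewrite pnatr_eq0 -lt0n zfrak_gt0.
rewrite !cc // (zfrak_cat_2 _ nu2) -/k.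
have -> : zfrak (nseq m 2) = (2 ^ m * m`!)%N.
  by have := @zfrak_cat_2 [::] m isT; rewrite /= => ->; rewrite /zfrak big_nil mul1n.
rewrite !natrM !natrX.
have -> : (2 : algC) ^+ m = 2 ^+ (sumn nu)./2 * 2 ^+ k.
  by rewrite -exprD kE subnKC.
(* If the denominator vanishes, both sides are 0 by the convention for inverses. *)
have [->|chi0] := eqVneq (chi la (nseq m 2)) 0.
  by rewrite mul0r mulr0 invr0 !mulr0.
field.
rewrite d0 zn0 !fact0 chi0 !expf_neq0 //.
Qed.

(** * Removing cycles of length two on a 2-abacus *)

Definition strict_dec (K : nat) (x : {ffun 'I_K -> int}) : bool :=
  [forall i : 'I_K, forall j : 'I_K, (i < j)%N ==> (x j < x i)].

Lemma strict_decP K (x : {ffun 'I_K -> int}) :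
  reflect (forall i j : 'I_K, (i < j)%N -> x j < x i) (strict_dec x).
Proof.
apply: (iffP forallP) => [h i j ij|h i].
  by have /forallP/(_ j)/implyP/(_ ij) := h i.
by apply/forallP=> j; apply/implyP; apply: h.
Qed.

Lemma strict_dec_inj K (x : {ffun 'I_K -> int}) : strict_dec x -> injective x.
Proof.
move=> /strict_decP dx i j xij; apply: val_inj.
by case: (ltngtP i j) => // /dx; rewrite xij ltxx.
Qed.

Lemma permvM K (u w : 'S_K) (x : {ffun 'I_K -> int}) :
  permv u (permv w x) = permv (u * w)%g x.
Proof. by apply/ffunP=> i; rewrite !ffunE permM. Qed.

Lemma permv1 K (x : {ffun 'I_K -> int}) : permv 1%g x = x.
Proof. by apply/ffunP=> i; rewrite !ffunE perm1. Qed.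

Lemma sorting_perm K (x : {ffun 'I_K -> int}) :
  injective x -> exists w : 'S_K, strict_dec (permv w x).
Proof.
move=> injx; pose t := [tuple x i | i < K].
pose s := sort (fun a b : int => b <= a) t.
have total_ge : total (fun a b : int => b <= a) by move=> a b; apply: le_total.
have trans_ge : transitive (fun a b : int => b <= a).
  by move=> a b c ba cb; apply: le_trans cb ba.
have /tuple_permP[w sE] : perm_eq s t by rewrite perm_sort.
exists w; apply/strict_decP => i j ij; rewrite !ffunE.
have nth_s (k : 'I_K) : nth 0 s k = x (w k).
  by rewrite sE -tnth_nth !tnth_mktuple.
rewrite lt_neqAle; apply/andP; split.
  by apply/eqP=> /injx/perm_inj e; move: ij; rewrite e ltnn.
have srt : sorted (fun a b : int => b <= a) s by apply: sort_sorted.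
have size_s : size s = K by rewrite size_sort size_tuple.
have := sorted_leq_nth trans_ge (fun a => lexx a) 0 srt.
move=> /(_ i j); rewrite !inE size_s !ltn_ord !nth_s; apply => //.
exact: ltnW.
Qed.

Lemma strict_dec_perm_uniq K (w : 'S_K) (x : {ffun 'I_K -> int}) :
  strict_dec x -> strict_dec (permv w x) -> w = 1%g.
Proof.
move=> /strict_decP dx /strict_decP dwx; apply: perm_mono => i j ij.
have := dwx i j ij; rewrite !ffunE; case: (ltngtP (w i) (w j)) => // [/dx|/val_inj->].
  by move=> h1 h2; have := lt_trans h1 h2; rewrite ltxx.
by rewrite ltxx.
Qed.

Lemma alternating_ninj K (F : {ffun 'I_K -> int} -> algC) (x : {ffun 'I_K -> int}) :
  alternating F -> ~ injective x -> F x = 0.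
Proof.
move=> altF ninj; have /injectivePn[i [j ij xij]] : ~~ injectiveb x by apply/injectiveP.
have := altF (tperm i j) x; rewrite odd_tperm ij expr1 mulN1r.
have -> : permv (tperm i j) x = x.
  by apply/ffunP=> k; rewrite ffunE; case: tpermP => // ->.
move/eqP; rewrite -addr_eq0 -mulr2n -[F x]mulr1 -mulrnAr mulf_eq0 pnatr_eq0 orbF.
by move/eqP ->; rewrite mulr1.
Qed.

(** * Alternating functions and determinants of reciprocal factorials *)

Definition natv (K M : nat) (a : {ffun 'I_K -> 'I_M}) : {ffun 'I_K -> int} :=
  [ffun i => (a i : nat)%:Z].

(** For strictly decreasing [a] this is the sign of the permutation rearranging [a] into [x], or 0
    if there is none. The determinant form matches [skew_count]. *)
Definition kron_det (K : nat) (x a : {ffun 'I_K -> int}) : algC :=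
  \det (\matrix_(i < K, j < K) (x i == a j)%:R).

Lemma kron_detE K (x a : {ffun 'I_K -> int}) :
  kron_det x a = \sum_(w : 'S_K) (-1) ^+ odd_perm w * (x == permv w a)%:R.
Proof.
rewrite /kron_det /determinant; apply: eq_bigr => w _; congr (_ * _).
rewrite (eq_bigr (fun i => (x i == a (w i))%:R)) => [|i _]; last by rewrite mxE.
case: eqP => [/ffunP e|ne].
  by rewrite big1 // => i _; rewrite e ffunE eqxx.
have /existsP[i xi] : [exists i, x i != a (w i)].
  apply: contraT; rewrite negb_exists => /forallP h; case: ne; apply/ffunP=> i.
  by rewrite ffunE; apply/eqP; rewrite -[_ == _]negbK.
by rewrite (bigD1 i) //= (negPf xi) mul0r.
Qed.

(** An alternating function is determined by its values at strictly decreasing vectors; the support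
    condition and the bound [M] confine these to a finite box. *)
Lemma alternating_expansion K M (F : {ffun 'I_K -> int} -> algC)
    (x : {ffun 'I_K -> int}) :
    alternating F -> nneg_support F -> (forall i, x i < M%:Z) ->
  F x = \sum_(a : {ffun 'I_K -> 'I_M} | strict_dec (natv a))
          kron_det x (natv a) * F (natv a).
Proof.
move=> altF nnF xM.
have termE a : kron_det x (natv a) * F (natv a) =
    \sum_(w : 'S_K) (x == permv w (@natv K M a))%:R * F x.
  rewrite kron_detE mulr_suml; apply: eq_bigr => w _.
  case: eqP => [->|_]; last by rewrite mulr0 !mul0r.
  by rewrite altF mulr1 mul1r.
rewrite (eq_bigr _ (fun a _ => termE a)).
have [/existsP[i xi]|xpos] := boolP [exists i, x i < 0].
  rewrite (nnF x i) // big1 // => a _; rewrite big1 // => w _; exact: mulr0.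
have [injx|ninj] := boolP (injectiveb x); last first.
  have Fx0 : F x = 0 by apply: alternating_ninj => // /injectiveP; apply/negP.
  by rewrite Fx0 big1 // => a _; rewrite big1 // => w _; rewrite mulr0.
have [w0 dw0] := sorting_perm (injectiveP _ injx).
rewrite negb_exists in xpos.
have x_nat i : `|permv w0 x i|%N%:Z = permv w0 x i.
  by rewrite gez0_abs // ffunE leNgt (forallP xpos).
have ltM i : (`|permv w0 x i| < M)%N by rewrite -ltz_nat x_nat ffunE.
pose a0 : {ffun 'I_K -> 'I_M} := [ffun i => Ordinal (ltM i)].
have a0E : natv a0 = permv w0 x by apply/ffunP=> i; rewrite ffunE ffunE x_nat.
rewrite (bigD1 a0) /=; last by rewrite a0E.
have only a w : strict_dec (natv a) -> x = permv w (@natv K M a) -> w = w0^-1%g /\ a = a0.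
  move=> da xE; have w1 : (w0 * w)%g = 1%g.
    by apply: (strict_dec_perm_uniq da); rewrite -permvM -xE.
  split; first by apply/eqP; rewrite eq_sym eq_invg_mul w1.
  have : natv a = natv a0 by rewrite a0E xE permvM w1 permv1.
  by move=> /ffunP e; apply/ffunP=> i; apply: val_inj; have := e i; rewrite !ffunE => -[].
rewrite (bigD1 w0^-1%g) //= a0E permvM mulVg permv1 eqxx mul1r.
rewrite big1 ?addr0 => [|w ww0]; last first.
  case: eqP => [e|]; last by rewrite mul0r.
  have [] := only a0 w; rewrite ?a0E // => e'; by rewrite e' eqxx in ww0.
rewrite big1 ?addr0 // => a /andP[da aa0]; rewrite big1 // => w _.
case: eqP => [e|]; last by rewrite mul0r.
by have [_ e'] := only a w da e; rewrite e' eqxx in aa0.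
Qed.

(* The reciprocal of the factorial, extended by zero to the negative integers
   so that [inv_fact (z - 1) = z * inv_fact z] holds everywhere. *)
Definition inv_fact (z : int) : algC := if z is Posz n then (n`!)%:R^-1 else 0.

Lemma inv_fact_pred z : inv_fact (z - 1) = z%:~R * inv_fact z.
Proof.
case: z => [[|n]|n]; first by rewrite mul0r.
  have -> : n.+1%:Z - 1 = n%:Z by lia.
  by rewrite /= factS natrM -pmulrn invfM mulVKf // pnatr_eq0.
by rewrite mulr0 NegzE -opprD -PoszD.
Qed.

Lemma inv_fact_neg z : z < 0 -> inv_fact z = 0.
Proof. by case: z. Qed.

(* The number of standard Young tableaux of the skew shape given by the strictly
   decreasing sequences [x] and [a], divided by the factorial of its size. *)
Definition skew_count (K : nat) (x a : {ffun 'I_K -> int}) : algC :=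
  \det (\matrix_(i < K, j < K) inv_fact (x i - a j)).

(** In the term of [w], lowering [x i] multiplies the product by [x i - a (w i)], and the sum of
    these factors over [i] is the same for every [w]. For tableaux, this removes the cell with the
    largest entry. *)
Lemma skew_count_pred K (x a : {ffun 'I_K -> int}) :
  \sum_i skew_count (x - unitv i) a =
  (\sum_i x i - \sum_i a i)%:~R * skew_count x a.
Proof.
rewrite /skew_count /determinant exchange_big mulr_sumr; apply: eq_bigr => w _.
rewrite -mulr_sumr mulrCA; congr (_ * _).
transitivity (\sum_i (x i - a (w i))%:~R * \prod_j inv_fact (x j - a (w j)) : algC).
  apply: eq_bigr => i _; rewrite (bigD1 i) //= [in RHS](bigD1 i) //= mulrA.
  rewrite mxE !ffunE eqxx addrAC inv_fact_pred; congr (_ * _).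
  apply: eq_bigr => j /negPf ji; rewrite mxE !ffunE ji subr0 //.
rewrite -mulr_suml -rmorph_sum /= sumrB; congr (_ * _).
  congr (_ - _)%:~R; by rewrite [RHS](reindex_inj (@perm_inj _ w)).
by apply: eq_bigr => j _; rewrite mxE.
Qed.

Lemma prod_inv_fact K (z : 'I_K -> int) : \sum_i z i <= 0 ->
  \prod_i inv_fact (z i) = \prod_i (z i == 0)%:R.
Proof.
move=> sz; have [/existsP[i zi]|zpos] := boolP [exists i, z i < 0].
  rewrite (bigD1 i) // [RHS](bigD1 i) //= inv_fact_neg // mul0r.
  by rewrite (lt_eqF zi) mul0r.
rewrite negb_exists in zpos.
have z0 i : 0 <= z i by rewrite leNgt (forallP zpos).
have : \sum_i z i = 0 by apply/eqP; rewrite eq_le sz sumr_ge0.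
move/psumr_eq0P => h; apply: eq_bigr => i _; rewrite h // ?eqxx.
by rewrite /inv_fact /= invr1.
Qed.

(** When the total of [x] is at most that of [a], a product of reciprocal factorials survives only
    if every difference is 0. *)
Lemma skew_count_kron K (x a : {ffun 'I_K -> int}) :
  \sum_i x i <= \sum_i a i -> skew_count x a = kron_det x a.
Proof.
move=> xa; apply: eq_bigr => w _; congr (_ * _).
rewrite (eq_bigr (fun i => inv_fact (x i - a (w i)))) => [|i _]; last by rewrite mxE.
rewrite prod_inv_fact.
  by apply: eq_bigr => i _; rewrite mxE subr_eq0.
rewrite sumrB subr_le0 (_ : \sum_i a (w i) = \sum_i a i) //.
by rewrite [RHS](reindex_inj (@perm_inj _ w)).
Qed.

Lemma kron_det_sum K (x a : {ffun 'I_K -> int}) :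
  \sum_i x i != \sum_i a i -> kron_det x a = 0.
Proof.
move=> ne; rewrite kron_detE big1 // => w _; case: eqP => [e|]; rewrite ?mulr0 //.
case/eqP: ne; rewrite e [RHS](reindex_inj (@perm_inj _ w)).
by apply: eq_bigr => i _; rewrite ffunE.
Qed.

(* The two runners of a 2-abacus. *)
Definition interleave (K : nat) (x y : {ffun 'I_K -> int}) : {ffun 'I_(K + K) -> int} :=
  [ffun i => match split i with inl j => x j * 2 | inr j => y j * 2 + 1 end].

Lemma interleave_l K (x y : {ffun 'I_K -> int}) j : interleave x y (lshift K j) = x j * 2.
Proof. by rewrite ffunE (unsplitK (inl j)). Qed.

Lemma interleave_r K (x y : {ffun 'I_K -> int}) j :
  interleave x y (rshift K j) = y j * 2 + 1.
Proof. by rewrite ffunE (unsplitK (inr j)). Qed.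

Lemma psum2_interleave K (B : {ffun 'I_(K + K) -> int} -> algC) (x y : {ffun 'I_K -> int}) :
  psum 2 B (interleave x y) = \sum_i B (interleave (x - unitv i) y) +
                              \sum_i B (interleave x (y - unitv i)).
Proof.
rewrite /psum big_split_ord; congr (_ + _); apply: eq_bigr => i _; congr B.
  apply/ffunP=> k; rewrite -[k]splitK; case: (split k) => j /=.
    by rewrite [in LHS]ffunE !interleave_l !(ffunE, ffunMnE) eq_lshift; ring.
  by rewrite [in LHS]ffunE !interleave_r !(ffunE, ffunMnE) eq_rlshift; lia.
apply/ffunP=> k; rewrite -[k]splitK; case: (split k) => j /=.
  by rewrite [in LHS]ffunE !interleave_l !(ffunE, ffunMnE) eq_lrshift; lia.
by rewrite [in LHS]ffunE !interleave_r !(ffunE, ffunMnE) eq_rshift; ring.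
Qed.

Lemma alternating_tperm K (F : {ffun 'I_K -> int} -> algC) :
  (forall i j v, i != j -> F (permv (tperm i j) v) = - F v) -> alternating F.
Proof.
move=> Ft w v; have [ts -> {w}] := prod_tpermP w.
elim: ts v => [|t ts IH] v /=.
  by rewrite big_nil permv1 odd_perm1 mul1r.
case/andP=> dt /IH {}IH; rewrite big_cons -permvM Ft // IH odd_permM odd_tperm.
by rewrite dt signr_addb expr1 !mulN1r mulNr.
Qed.

Lemma alternating_interleave_l K (B : {ffun 'I_(K + K) -> int} -> algC) y :
  alternating B -> alternating (fun x => B (interleave x y)).
Proof.
move=> altB; apply: alternating_tperm => i j x ij.
have -> : interleave (permv (tperm i j) x) y =
    permv (tperm (lshift K i) (lshift K j)) (interleave x y).
  apply/ffunP=> k; rewrite -[k]splitK [in RHS]ffunE; case: (split k) => l /=.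
    rewrite !interleave_l ffunE.
    by case: tpermP => [->|->|li lj]; rewrite ?tpermL ?tpermR ?interleave_l //;
       rewrite tpermD ?interleave_l // eq_lshift eq_sym; apply/eqP.
  by rewrite interleave_r tpermD ?interleave_r // eq_lrshift.
by rewrite altB odd_tperm eq_lshift ij expr1 mulN1r.
Qed.

Lemma alternating_interleave_r K (B : {ffun 'I_(K + K) -> int} -> algC) x :
  alternating B -> alternating (fun y => B (interleave x y)).
Proof.
move=> altB; apply: alternating_tperm => i j y ij.
have -> : interleave x (permv (tperm i j) y) =
    permv (tperm (rshift K i) (rshift K j)) (interleave x y).
  apply/ffunP=> k; rewrite -[k]splitK [in RHS]ffunE; case: (split k) => l /=.
    by rewrite interleave_l tpermD ?interleave_l // eq_rlshift.
  rewrite !interleave_r ffunE.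
  by case: tpermP => [->|->|li lj]; rewrite ?tpermL ?tpermR ?interleave_r //;
     rewrite tpermD ?interleave_r // eq_rshift eq_sym; apply/eqP.
by rewrite altB odd_tperm eq_rshift ij expr1 mulN1r.
Qed.

Lemma nneg_interleave_l K (B : {ffun 'I_(K + K) -> int} -> algC) y :
  nneg_support B -> nneg_support (fun x => B (interleave x y)).
Proof.
move=> nnB x i xi; apply: (nnB _ (lshift K i)); rewrite interleave_l; lia.
Qed.

Lemma nneg_interleave_r K (B : {ffun 'I_(K + K) -> int} -> algC) x :
  nneg_support B -> nneg_support (fun y => B (interleave x y)).
Proof.
move=> nnB y i yi; apply: (nnB _ (rshift K i)); rewrite interleave_r; lia.
Qed.

Definition runner_pair (K M : nat) (k : nat) (s : int)
    (p : {ffun 'I_K -> 'I_M} * {ffun 'I_K -> 'I_M}) : bool :=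
  [&& strict_dec (natv p.1), strict_dec (natv p.2) &
      \sum_i natv p.1 i + \sum_i natv p.2 i + k%:Z == s].

(** Subtracting 2 from a bead lowers it by one on its own runner, so the two runners evolve
    independently except for how the [k] moves are shared between them. *)
Lemma psums2_interleave K M k (B : {ffun 'I_(K + K) -> int} -> algC)
    (x y : {ffun 'I_K -> int}) :
    alternating B -> nneg_support B ->
    (forall i, x i < M%:Z) -> (forall i, y i < M%:Z) ->
  psums (nseq k 2) B (interleave x y) = k`!%:R *
    \sum_(p : {ffun 'I_K -> 'I_M} * {ffun 'I_K -> 'I_M} |
          runner_pair k (\sum_i x i + \sum_i y i) p)
       skew_count x (natv p.1) * skew_count y (natv p.2) *
       B (interleave (natv p.1) (natv p.2)).
Proof.
move=> altB nnB; elim: k x y => [|k IHk] x y xM yM.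
  rewrite mul1r /=.
  rewrite (alternating_expansion (alternating_interleave_l _ altB)
     (nneg_interleave_l _ nnB) xM) /=.
  under eq_bigr => a _ do rewrite (alternating_expansion (alternating_interleave_r _ altB)
     (nneg_interleave_r _ nnB) yM) mulr_sumr.
  rewrite pair_big_dep big_mkcond [RHS]big_mkcond; apply: eq_bigr => -[a b] _ /=.
  rewrite /runner_pair /= addr0 andbA mulrA.
  case: (strict_dec _ && _) => //=; case: eqP => [e|ne]; last first.
    have [ex|/kron_det_sum->] := eqVneq (\sum_i x i) (\sum_i natv a i); last by rewrite !mul0r.
    rewrite (kron_det_sum (x := y)) ?mulr0 ?mul0r //; apply/eqP=> ey; case: ne.
    by rewrite ex ey.
  (* The combined totals agree. If the separate ones differ, one runner has the smaller total on its
     left, and there [skew_count] is a Kronecker determinant with unequal sums, hence 0. *)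
  have [xa|xa] := lerP (\sum_i x i) (\sum_i natv a i).
    rewrite (skew_count_kron xa); have [ex|/kron_det_sum->] := eqVneq (\sum_i x i) (\sum_i natv a i).
      by rewrite skew_count_kron // -(lerD2l (\sum_i x i)) -e ex.
    by rewrite !mul0r.
  have yb : \sum_i y i < \sum_i natv b i.
    by rewrite -(ltrD2l (\sum_i x i)) -e ltrD2r.
  rewrite (skew_count_kron (ltW yb)) (kron_det_sum (x := y)) ?mulr0 ?mul0r //.
  by rewrite lt_eqF.
have sum_pred (z : {ffun 'I_K -> int}) i : \sum_j (z - unitv i) j = \sum_j z j - 1.
  rewrite (eq_bigr (fun j => z j - (j == i)%:Z)) => [|j _]; last by rewrite !ffunE.
  by rewrite sumrB; congr (_ - _); rewrite (bigD1 i) //= eqxx big1 // => j /negPf->.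
have predM (z : {ffun 'I_K -> int}) i j : (forall i, z i < M%:Z) -> (z - unitv i) j < M%:Z.
  by move=> zM; rewrite !ffunE; apply: le_lt_trans (zM j); rewrite gerBl.
pose s := \sum_i x i + \sum_i y i.
have runnerE p : runner_pair k (s - 1) p = @runner_pair K M k.+1 s p.
  by congr [&& _, _ & _]; rewrite eq_sym subr_eq eq_sym -addrA -[k.+1]addn1 PoszD.
rewrite -[LHS]/(psum 2 (psums (nseq k 2) B) _) psum2_interleave.
pose T x' y' (p : {ffun 'I_K -> 'I_M} * {ffun 'I_K -> 'I_M}) :=
  skew_count x' (natv p.1) * skew_count y' (natv p.2) *
  B (interleave (natv p.1) (natv p.2)).
rewrite (eq_bigr (fun i => k`!%:R * \sum_(p | runner_pair k.+1 s p) T (x - unitv i) y p)).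
  rewrite [X in _ + X](eq_bigr (fun i => k`!%:R *
    \sum_(p | runner_pair k.+1 s p) T x (y - unitv i) p)) => [|i _]; last first.
    rewrite IHk // => [|j]; last exact: predM.
    by congr (_ * _); apply: eq_bigl => p; rewrite sum_pred addrA runnerE.
  rewrite -!mulr_sumr -mulrDr factS natrM [_%:R * _%:R]mulrC -mulrA; congr (_ * _).
  rewrite exchange_big [X in _ + X]exchange_big -big_split mulr_sumr.
  apply: eq_bigr => p /and3P[_ _ /eqP sp]; rewrite /T /=.
  rewrite -!mulr_suml -mulrDl -mulr_sumr !skew_count_pred.
  (* The recursions on the two runners multiply a term by its two size differences, whose sum is the
     new factor [k.+1] of the factorial. *)
  have -> : k.+1%:R = (s - \sum_i natv p.1 i - \sum_i natv p.2 i)%:~R :> algC.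
    by rewrite -sp pmulrn; congr (_%:~R); ring.
  by rewrite /s !(rmorphD, rmorphN) /=; ring.
move=> i _; rewrite IHk // => [|j]; last exact: predM.
by congr (_ * _); apply: eq_bigl => p; rewrite sum_pred addrAC runnerE.
Qed.

(** * Abaci of partitions *)

Definition abacus (N : nat) (la : seq nat) : {ffun 'I_N -> int} :=
  beta_vec (fun i : 'I_N => nth 0%N la i).

Lemma abacusE N la (i : 'I_N) : abacus N la i = (nth 0%N la i + (N - i.+1))%N%:Z.
Proof. by rewrite ffunE. Qed.

Lemma abacus_ge0 N la (i : 'I_N) : 0 <= abacus N la i.
Proof. by rewrite abacusE. Qed.

Lemma abacus_nil N : abacus N [::] = staircase N.
Proof. by apply/ffunP=> i; rewrite abacusE ffunE nth_nil. Qed.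

Lemma abacus_strict_dec N la : is_partition la -> strict_dec (abacus N la).
Proof.
move=> pla; apply/strict_decP => i j ij; rewrite !abacusE ltz_nat.
have := partition_nth_dec pla (ltnW ij); have := ltn_ord j; lia.
Qed.

Lemma strict_dec_staircase_int N (v : {ffun 'I_N -> int}) (i : 'I_N) :
  strict_dec v -> (forall i, 0 <= v i) -> (N - i.+1)%N%:Z <= v i.
Proof.
move=> /strict_decP dv v0; rewrite -[v i]gez0_abs // lez_nat.
apply: (@strict_dec_staircase N (fun i => `|v i|%N)) => j k jk.
by rewrite -ltz_nat !gez0_abs // dv.
Qed.

Lemma nth_filter_neq0 s i : sorted geq s ->
  nth 0%N (filter (fun n => n != 0%N) s) i = nth 0%N s i.
Proof.
elim: s i => //= h t IH i ht.
have geq_tr : transitive geq by move=> a b c ba cb; apply: leq_trans cb ba.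
case: eqP => [h0|_] /=; last by case: i => //= i; apply: IH; apply: path_sorted ht.
have t0 : all (pred1 0%N) t.
  have := order_path_min geq_tr ht; apply: sub_all => n /=.
  by rewrite h0 leqn0.
rewrite (eq_in_filter (a2 := pred0)); last by move=> n /(allP t0)/= ->.
rewrite filter_pred0 nth_nil; case: i => [|i] /=; first by rewrite h0.
case: (ltnP i (size t)) => [it|it]; last by rewrite nth_default.
by have /eqP := allP t0 _ (mem_nth 0%N it).
Qed.

Lemma abacus_surj N (v : {ffun 'I_N -> int}) : strict_dec v -> (forall i, 0 <= v i) ->
  exists la, [/\ is_partition la, (size la <= N)%N & abacus N la = v].
Proof.
move=> dv v0; pose f (i : 'I_N) := (`|v i| - (N - i.+1))%N.
have fE i : (f i + (N - i.+1))%N%:Z = v i.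
  rewrite subnK ?gez0_abs //.
  by have := strict_dec_staircase_int i dv v0; rewrite -{1}[v i]gez0_abs.
pose s := [seq f i | i <- enum 'I_N].
have nth_s (i : 'I_N) : nth 0%N s i = f i.
  by rewrite (nth_map i) ?size_enum_ord // nth_ord_enum.
have size_s : size s = N by rewrite size_map size_enum_ord.
have srt : sorted geq s.
  case: s nth_s size_s => // h t nth_s size_s.
  apply/(pathP 0%N) => i it.
  have iN : (i.+1 < N)%N by rewrite -size_s.
  have := nth_s (Ordinal iN); have := nth_s (Ordinal (ltnW iN)) => /= -> ->.
  rewrite -lez_nat; have := fE (Ordinal iN); have := fE (Ordinal (ltnW iN)).
  have /strict_decP/(_ (Ordinal (ltnW iN)) (Ordinal iN) (ltnSn _)) := dv.
  rewrite /=; lia.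
exists (filter (fun n => n != 0%N) s); split.
- rewrite /is_partition mem_filter /= andbT; apply: sorted_filter srt.
  by move=> a b c ba cb; apply: leq_trans cb ba.
- by rewrite size_filter -[X in (_ <= X)%N]size_s count_size.
by apply/ffunP=> i; rewrite abacusE nth_filter_neq0 // nth_s fE.
Qed.

Lemma partition_eq_nth la mu : is_partition la -> is_partition mu ->
  (forall i, nth 0%N la i = nth 0%N mu i) -> la = mu.
Proof.
move=> /andP[_ la0] /andP[_ mu0] e.
have le_size s t : 0%N \notin s -> (forall i, nth 0%N s i = nth 0%N t i) ->
    (size s <= size t)%N.
  move=> s0 st; rewrite leqNgt; apply: contra s0 => ts.
  by have := mem_nth 0%N ts; rewrite st nth_default.
apply: (@eq_from_nth _ 0%N) => [|i _]; last exact: e.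
by apply/eqP; rewrite eqn_leq !le_size.
Qed.

Lemma abacus_inj N la mu : is_partition la -> is_partition mu ->
  (size la <= N)%N -> (size mu <= N)%N -> abacus N la = abacus N mu -> la = mu.
Proof.
move=> pla pmu sla smu /ffunP e; apply: partition_eq_nth => // i.
case: (ltnP i N) => [iN|Ni]; last by rewrite !nth_default ?(leq_trans _ Ni).
by have := e (Ordinal iN); rewrite !abacusE => -[/addIn].
Qed.

Lemma sum_abacus N la : (size la <= N)%N ->
  \sum_i abacus N la i = (sumn la)%:Z + \sum_i staircase N i.
Proof.
move=> sN; rewrite -(sum_nth_partition sN) (big_morph _ PoszD (erefl 0)) -big_split /=.
by apply: eq_bigr => i _; rewrite abacusE ffunE.
Qed.

(** * Dominoes as moves of beads *)

Definition adds_horizontal (la mu : seq nat) (j : nat) : Prop :=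
  forall i, nth 0%N mu i = (nth 0%N la i + (i == j).*2)%N.

Definition adds_vertical (la mu : seq nat) (j : nat) : Prop :=
  nth 0%N la j = nth 0%N la j.+1 /\
  forall i, nth 0%N mu i = (nth 0%N la i + (i == j) + (i == j.+1))%N.

Lemma unitv2E N (j i : 'I_N) : (unitv j *+ 2) i = ((i == j).*2)%:Z.
Proof. by rewrite ffunMnE ffunE; case: (i == j). Qed.

Lemma abacus_horizontal N la mu (j : 'I_N) : adds_horizontal la mu j ->
  abacus N mu = abacus N la + unitv j *+ 2.
Proof.
move=> h; apply/ffunP=> i.
by rewrite [RHS]ffunE unitv2E !abacusE h -PoszD addnAC.
Qed.

(** Equal parts in rows [j] and [j.+1] put their beads at consecutive positions. The lower bead
    moves by two and jumps over the other; the transposition restores the order and is the source of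
    the signs. *)
Lemma abacus_vertical N la mu (j j1 : 'I_N) : val j1 = j.+1 -> adds_vertical la mu j ->
  abacus N mu = permv (tperm j j1) (abacus N la + unitv j1 *+ 2).
Proof.
move=> jj1 [e h]; apply/ffunP=> i; have lt1 := ltn_ord j1.
have jj1' : (j1 == j) = false by rewrite -val_eqE /= jj1; lia.
have jj1n : (j.+1 == j) = false by lia.
rewrite [RHS]ffunE [RHS]ffunE unitv2E !abacusE h; case: tpermP => [->|->|].
- have jn : (j == j.+1 :> nat) = false by lia.
  by rewrite !eqxx jn jj1 -e /=; move: lt1; rewrite jj1; lia.
- by rewrite jj1 !eqxx jj1n (eq_sym j) jj1' -e /=; move: lt1; rewrite jj1; lia.
move=> /eqP ij /eqP ij1; rewrite (negPf ij1).
have -> : (val i == j) = false by apply: negbTE.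
have -> : (val i == j.+1) = false by rewrite -jj1; apply: negbTE.
by rewrite /= !addn0 addr0.
Qed.

Lemma strict_dec_range N (v : {ffun 'I_N -> int}) :
  strict_dec v -> (forall i, 0 <= v i < N%:Z) -> v = staircase N.
Proof.
move=> dv vN; have /strict_decP dv' := dv.
have up m (i : 'I_N) : (i <= m)%N -> v i <= (N - i.+1)%N%:Z.
  elim: m i => [|m IHm] i im.
    have /andP[_ ] := vN i; have := ltn_ord i; lia.
  move: im; rewrite leq_eqVlt => /orP[/eqP im|]; last exact: IHm.
  have mN : (m < N)%N by have := ltn_ord i; lia.
  have := IHm (Ordinal mN) (leqnn _); have := dv' (Ordinal mN) i.
  rewrite /= im => /(_ (ltnSn _)); have := ltn_ord i; lia.
apply/ffunP=> i; rewrite [RHS]ffunE; apply/eqP; rewrite eq_le (up i) //=.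
by apply: strict_dec_staircase_int => // j; case/andP: (vN j).
Qed.

Lemma permv_inj N (u : 'S_N) (v : {ffun 'I_N -> int}) :
  injective v -> injective (permv u v).
Proof. by move=> injv i j; rewrite !ffunE => /injv/perm_inj. Qed.

Lemma permvK N (u : 'S_N) : cancel (@permv N u) (permv u^-1%g).
Proof. by move=> v; rewrite permvM mulVg permv1. Qed.

Lemma permvD N (u : 'S_N) (v w : {ffun 'I_N -> int}) : permv u (v + w) = permv u v + permv u w.
Proof. by apply/ffunP=> i; rewrite !ffunE. Qed.

Lemma permv_unitv2 N (u : 'S_N) (j : 'I_N) :
  permv u (unitv j *+ 2) = unitv (u^-1 j)%g *+ 2.
Proof.
apply/ffunP=> i; rewrite ffunE !unitv2E; congr (Posz (nat_of_bool _).*2).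
by rewrite -[RHS](inj_eq (@perm_inj _ u)) permKV.
Qed.

Lemma interleave_ge0 K (x y : {ffun 'I_K -> int}) k :
  (forall i, 0 <= x i) -> (forall i, 0 <= y i) -> 0 <= interleave x y k.
Proof.
move=> x0 y0; rewrite -[k]splitK; case: (split k) => i /=.
  by rewrite interleave_l; have := x0 i; lia.
by rewrite interleave_r; have := y0 i; lia.
Qed.

Lemma interleave_inj K (x y : {ffun 'I_K -> int}) :
  strict_dec x -> strict_dec y -> injective (interleave x y).
Proof.
move=> /strict_dec_inj injx /strict_dec_inj injy i j.
rewrite -[i]splitK -[j]splitK; case: (split i) => i' /=; case: (split j) => j' /=.
- by rewrite !interleave_l => e; congr lshift; apply: injx; lia.
- by rewrite interleave_l interleave_r; lia.
- by rewrite interleave_l interleave_r; lia.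
- by rewrite !interleave_r => e; congr rshift; apply: injy; lia.
Qed.

Lemma interleave_unitv_l K (x y : {ffun 'I_K -> int}) i :
  interleave (x + unitv i) y = interleave x y + unitv (lshift K i) *+ 2.
Proof.
apply/ffunP=> k; rewrite [RHS]ffunE unitv2E -[k]splitK; case: (split k) => j /=.
  by rewrite !interleave_l !ffunE eq_lshift mulrDl; case: (j == i).
by rewrite !interleave_r eq_rlshift addr0.
Qed.

Lemma interleave_unitv_r K (x y : {ffun 'I_K -> int}) i :
  interleave x (y + unitv i) = interleave x y + unitv (rshift K i) *+ 2.
Proof.
apply/ffunP=> k; rewrite [RHS]ffunE unitv2E -[k]splitK; case: (split k) => j /=.
  by rewrite !interleave_l eq_lrshift addr0.
by rewrite !interleave_r !ffunE eq_rshift mulrDl addrAC; case: (j == i).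
Qed.

Lemma strict_dec_incr K (x : {ffun 'I_K -> int}) i :
  strict_dec x -> injective (x + unitv i) -> strict_dec (x + unitv i).
Proof.
move=> /strict_decP dx injx; apply/strict_decP => j k jk.
have := dx j k jk; have : (x + unitv i) j != (x + unitv i) k.
  by apply/eqP=> /injx e; move: jk; rewrite e ltnn.
by rewrite !ffunE; case: (j == i); case: (k == i) => /=; lia.
Qed.

(** Injectivity says that the target position is free. A move by two stays on its runner, where a
    step of one without collision keeps the order. *)
Lemma interleave_add K (x y : {ffun 'I_K -> int}) (k : 'I_(K + K)) :
    strict_dec x -> strict_dec y -> (forall i, 0 <= x i) -> (forall i, 0 <= y i) ->
    injective (interleave x y + unitv k *+ 2) ->
  exists x' y', [/\ strict_dec x', strict_dec y', forall i, 0 <= x' i,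
    forall i, 0 <= y' i & interleave x y + unitv k *+ 2 = interleave x' y'].
Proof.
move=> dx dy x0 y0; rewrite -[k]splitK; case: (split k) => i /=.
  rewrite -interleave_unitv_l => inj; exists (x + unitv i), y; split => //.
    apply: strict_dec_incr => // j j' e; apply/eqP; rewrite -(eq_lshift K).
    by apply/eqP/inj; rewrite !interleave_l e.
  by move=> j; rewrite !ffunE addr_ge0.
rewrite -interleave_unitv_r => inj; exists x, (y + unitv i); split => //.
  apply: strict_dec_incr => // j j' e; apply/eqP; rewrite -(eq_rshift K).
  by apply/eqP/inj; rewrite !interleave_r e.
by move=> j; rewrite !ffunE addr_ge0.
Qed.

Lemma staircase_strict_dec N : strict_dec (staircase N).
Proof. by rewrite -abacus_nil; apply: abacus_strict_dec. Qed.

Lemma staircase_ge0 N i : 0 <= staircase N i.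
Proof. by rewrite ffunE. Qed.

(** The [2 K] beads of the empty partition fill the positions below [2 K], half of each parity, so
    both runners are empty partitions as well. *)
Lemma interleave_staircase K :
  exists u : 'S_(K + K), permv u (staircase (K + K)) =
                         interleave (staircase K) (staircase K).
Proof.
have inj := interleave_inj (staircase_strict_dec K) (staircase_strict_dec K).
have [w dw] := sorting_perm inj; exists w^-1%g; apply/(canLR (@permvK _ w))/esym.
apply: strict_dec_range => // i; rewrite ffunE; set j := w i.
rewrite interleave_ge0 /=; try by move=> ?; apply: staircase_ge0.
rewrite -[j]splitK; case: (split j) => k /=.
  by rewrite interleave_l ffunE; have := ltn_ord k; lia.
by rewrite interleave_r ffunE; have := ltn_ord k; lia.
Qed.

Lemma count_odd_nth N la : (size la <= N)%N ->
  count odd la = (\sum_(i < N) odd (nth 0%N la i))%N.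
Proof.
move=> sN; have := sum_nth_partition (la := [seq (odd k : nat) | k <- la]) (N := N).
rewrite size_map => /(_ sN) e.
rewrite -sumn_count -e; apply: eq_bigr => i _.
case: (ltnP i (size la)) => [il|li]; first by rewrite (nth_map 0%N).
by rewrite !nth_default ?size_map.
Qed.

From mathcomp Require Import boolp classical_sets functions cardinality fsbigop.

(** * Dominoes *)

Lemma diagramP la r q : diagram la (r, q) <-> (q < nth 0%N la r)%N.
Proof. by []. Qed.

Lemma adds_horizontal_domino la mu j : adds_horizontal la mu j -> adds_domino la mu.
Proof.
move=> h; exists (j, nth 0%N la j), (j, (nth 0%N la j).+1); split.
- by left.
- by rewrite diagramP ltnn.
- by rewrite diagramP ltnNge leqnSn.
apply/seteqP; split => -[r q] /=; rewrite /diagram /= h.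
  have [->|rj] := eqVneq r j; last by rewrite addn0; left.
  rewrite addn2 ltnS leq_eqVlt ltnS leq_eqVlt.
  by case/or3P=> [/eqP->|/eqP->|]; [right; right|right; left|left].
by case=> [|[[-> ->]|[-> ->]]]; rewrite ?eqxx; lia.
Qed.

Lemma adds_vertical_domino la mu j : adds_vertical la mu j -> adds_domino la mu.
Proof.
move=> [e h]; exists (j, nth 0%N la j), (j.+1, nth 0%N la j); split.
- by right.
- by rewrite diagramP ltnn.
- by rewrite diagramP e ltnn.
apply/seteqP; split => -[r q] /=; rewrite /diagram /= h.
  have [->|rj] := eqVneq r j.
    rewrite eqn_leq ltnn andbF addn0 addn1 ltnS leq_eqVlt.
    by case/orP=> [/eqP->|]; [right; left|left].
  rewrite addn0; have [->|rj1] := eqVneq r j.+1; last by rewrite addn0; left.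
  rewrite addn1 ltnS leq_eqVlt -e.
  by case/orP=> [/eqP->|]; [right; right|left].
by case=> [|[[-> ->]|[-> ->]]]; rewrite ?eqxx; lia.
Qed.

(** Rows of a diagram are left-justified, so their lengths change exactly by the cells added to
    them, and the added cells start where the old rows end. *)
Lemma adds_dominoP la mu : adds_domino la mu ->
  exists j, adds_horizontal la mu j \/ adds_vertical la mu j.
Proof.
case=> -[r q] [d [adj nc nd /seteqP[sub sup]]]; exists r.
have cell i k : (k < nth 0%N mu i)%N ->
    (k < nth 0%N la i)%N \/ (i, k) = (r, q) \/ (i, k) = d.
  by move=> h; have [|[->|->]] := sub (i, k) h; [left|right; left|right; right].
have cell_la i k : (k < nth 0%N la i)%N -> (k < nth 0%N mu i)%N.
  by move=> h; apply: (sup (i, k)); left.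
have cell_c : (q < nth 0%N mu r)%N by apply: (sup (r, q)); right; left.
have cell_d : (d.2 < nth 0%N mu d.1)%N by apply: (sup d); right; right.
move: nc; rewrite diagramP => /negP; rewrite -leqNgt => nc.
have le i : (nth 0%N la i <= nth 0%N mu i)%N.
  by rewrite leqNgt; apply/negP=> /cell_la; rewrite ltnn.
have same i : i != r -> i != d.1 -> nth 0%N mu i = nth 0%N la i.
  move=> ir id; apply/eqP; rewrite eqn_leq le andbT leqNgt; apply/negP=> /cell.
  by case=> [|[[e]|e]]; [rewrite ltnn|rewrite e eqxx in ir|rewrite -e eqxx in id].
case: adj => /= de; move: nd cell_d same cell; rewrite de /= diagramP => /negP;
   rewrite -leqNgt => nd cell_d same cell.
- left=> i; have [->|ir] := eqVneq i r; last by rewrite same ?addn0.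
  have c1 : (nth 0%N la r >= q)%N.
    rewrite leqNgt; apply/negP=> lq.
    have /cell[|[[]|[]]] : (nth 0%N la r < nth 0%N mu r)%N by lia.
      by rewrite ltnn.
    lia. lia.
  have c2 : (nth 0%N mu r <= q.+2)%N.
    by rewrite leqNgt; apply/negP=> /cell[|[[]|[]]]; lia.
  lia.
have c1 : (nth 0%N la r >= q)%N.
  rewrite leqNgt; apply/negP=> lq.
  have /cell[|[[]|[]]] : (nth 0%N la r < nth 0%N mu r)%N by lia.
    by rewrite ltnn.
  lia. lia.
have c2 : (nth 0%N mu r <= q.+1)%N.
  by rewrite leqNgt; apply/negP=> /cell[|[[]|[]]]; lia.
have c3 : (nth 0%N la r.+1 >= q)%N.
  rewrite leqNgt; apply/negP=> lq.
  have /cell[|[[]|[]]] : (nth 0%N la r.+1 < nth 0%N mu r.+1)%N by lia.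
    by rewrite ltnn.
  lia. lia.
have c4 : (nth 0%N mu r.+1 <= q.+1)%N.
  by rewrite leqNgt; apply/negP=> /cell[|[[]|[]]]; lia.
right; split; first lia.
move=> i; have [->|ir] := eqVneq i r; first lia.
have [->|ir1] := eqVneq i r.+1; first lia.
by rewrite same // !addn0.
Qed.

Lemma size_partition_le la mu : is_partition la ->
  (forall i, nth 0%N la i <= nth 0%N mu i)%N -> (size la <= size mu)%N.
Proof.
move=> /andP[_ la0] le; rewrite leqNgt; apply: contra la0 => ml.
have := le (size mu); rewrite [X in (_ <= X)%N]nth_default // leqn0 => /eqP <-.
exact: mem_nth.
Qed.

Lemma adds_horizontal_le la mu j i : adds_horizontal la mu j ->
  (nth 0%N la i <= nth 0%N mu i)%N.
Proof. by move=> ->; rewrite leq_addr. Qed.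

Lemma adds_vertical_le la mu j i : adds_vertical la mu j ->
  (nth 0%N la i <= nth 0%N mu i)%N.
Proof. by move=> [_ ->]; rewrite -addnA leq_addr. Qed.

Lemma balanced_partition la : balanced la -> is_partition la.
Proof. by case. Qed.

(** The permutation [u] is part of the data because its sign is what [sigma] records. *)
Definition on_runners (K : nat) (mu : seq nat) (u : 'S_(K + K)) (x y : {ffun 'I_K -> int}) :=
  [/\ strict_dec x, strict_dec y, forall i, 0 <= x i, forall i, 0 <= y i &
      permv u (abacus (K + K) mu) = interleave x y].

Lemma nth_gt0_size mu j : (0 < nth 0%N mu j)%N -> (j < size mu)%N.
Proof. by rewrite [(j < _)%N]ltnNge; apply: contraL => jm; rewrite nth_default. Qed.

Lemma count_odd_horizontal la mu j : (size la <= size mu)%N -> adds_horizontal la mu j ->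
  count odd mu = count odd la.
Proof.
move=> sz h; rewrite (count_odd_nth (leqnn _)) (count_odd_nth sz).
by apply: eq_bigr => i _; rewrite h oddD odd_double addbF.
Qed.

(** Two equal parts grow by one, so both change parity: the number of odd parts moves by two, up or
    down, and [sigma] changes sign. *)
Lemma count_odd_vertical la mu j : (size la <= size mu)%N -> adds_vertical la mu j ->
  (count odd mu + (odd (nth 0 la j)).*2 = count odd la + (~~ odd (nth 0 la j)).*2)%N.
Proof.
move=> sz [e h]; have j1m : (j.+1 < size mu)%N.
  by apply: nth_gt0_size; rewrite h eqxx addn1.
rewrite (count_odd_nth (leqnn _)) (count_odd_nth sz).
pose i0 := Ordinal (ltnW j1m); pose i1 := Ordinal j1m.
have i10 : i1 != i0 by rewrite -val_eqE /=; lia.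
rewrite (bigD1 i0) //= [in RHS](bigD1 i0) //= (bigD1 i1) //= [in RHS](bigD1 i1) //=.
rewrite !h eqxx [in RHS]e -!e eqxx.
have -> : (j == j.+1) = false by lia.
have -> : (j.+1 == j) = false by lia.
rewrite (eq_bigr (fun i : 'I_(size mu) => odd (nth 0%N la i) : nat)) => [|i]; last first.
  rewrite -!val_eqE /= => /andP[/negPf ij /negPf ij1].
  by rewrite h ij ij1 !addn0.
rewrite !addn0 !addn1 /=; move: (\sum_(i | _) _)%N => S.
by case: (odd _); rewrite /=; lia.
Qed.

(** Along a chain of dominoes, a horizontal one changes neither [sigma] nor [u], while a vertical
    one negates [sigma] and composes [u] with a transposition. The sign of [u0] normalizes the empty
    partition. *)
Lemma balanced_on_runners K (u0 : 'S_(K + K)) mu :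
    permv u0 (staircase (K + K)) = interleave (staircase K) (staircase K) ->
    balanced mu -> (size mu <= K + K)%N ->
  ~~ odd (count odd mu) /\
  exists (u : 'S_(K + K)) (x y : {ffun 'I_K -> int}),
    on_runners mu u x y /\ sigma mu = (-1) ^+ odd_perm u * (-1) ^+ odd_perm u0.
Proof.
move=> u0E; elim=> [|la {}mu bla IH pmu ad] smu.
  split=> //; exists u0, (staircase K), (staircase K); split.
    split; rewrite ?abacus_nil //; try exact: staircase_strict_dec.
      by move=> i; apply: staircase_ge0.
    by move=> i; apply: staircase_ge0.
  by rewrite -signr_addb addbb.
have pla := balanced_partition bla.
have [j hv] := adds_dominoP ad.
have szle : (size la <= size mu)%N.
  apply: size_partition_le => // i.
  by case: hv => [/adds_horizontal_le|/adds_vertical_le]; apply.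
have [even_la [u [x [y [[dx dy x0 y0 uE] sig]]]]] := IH (leq_trans szle smu).
have injmu := strict_dec_inj (abacus_strict_dec (K + K) pmu).
case: hv => [h|h].
  have jm : (j < size mu)%N by apply: nth_gt0_size; rewrite h eqxx addn2.
  pose J := Ordinal (leq_trans jm smu).
  have muE : abacus (K + K) mu = abacus (K + K) la + unitv J *+ 2 by apply: abacus_horizontal.
  have uE' : permv u (abacus (K + K) mu) = interleave x y + unitv (u^-1 J)%g *+ 2.
    by rewrite muE permvD permv_unitv2 uE.
  have [|x' [y' [dx' dy' x0' y0' e]]] := interleave_add (k := (u^-1 J)%g) dx dy x0 y0.
    by rewrite -uE'; apply: permv_inj.
  rewrite (count_odd_horizontal szle h); split=> //.
  exists u, x', y'; split; first by split=> //; rewrite uE'.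
  by rewrite -sig /sigma (count_odd_horizontal szle h).
have j1m : (j.+1 < size mu)%N.
  by apply: nth_gt0_size; case: h => _ ->; rewrite eqxx addn1.
pose J := Ordinal (leq_trans (ltnW j1m) smu); pose J1 := Ordinal (leq_trans j1m smu).
have JJ1 : J != J1 by rewrite -val_eqE /=; lia.
have muE : abacus (K + K) mu = permv (tperm J J1) (abacus (K + K) la + unitv J1 *+ 2).
  exact: abacus_vertical.
have uE' : permv (u * tperm J J1)%g (abacus (K + K) mu) =
    interleave x y + unitv (u^-1 J1)%g *+ 2.
  by rewrite -permvM muE [permv (tperm J J1) _]permvM tperm2 permv1 permvD permv_unitv2 uE.
have [|x' [y' [dx' dy' x0' y0' e]]] := interleave_add (k := (u^-1 J1)%g) dx dy x0 y0.
  by rewrite -uE'; apply: permv_inj.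
have cnt := count_odd_vertical szle h.
have even_mu : ~~ odd (count odd mu).
  have := congr1 odd cnt; rewrite !oddD !odd_double !addbF => ->.
  exact: even_la.
split=> //; exists (u * tperm J J1)%g, x', y'; split; first by split=> //; rewrite uE'.
rewrite odd_permM odd_tperm JJ1 addbT -signr_addb.
have -> : (~~ odd_perm u (+) odd_perm u0) = ~~ (odd_perm u (+) odd_perm u0).
  by rewrite addNb.
rewrite signrN signr_addb -sig /sigma.
have e1 : (count odd mu)./2.*2 = count odd mu.
  by rewrite -[RHS]odd_double_half (negPf even_mu).
have e2 : (count odd la)./2.*2 = count odd la.
  by rewrite -[RHS]odd_double_half (negPf even_la).
rewrite -signr_odd -[in RHS]signr_odd -signrN; congr (_ ^+ nat_of_bool _).
by move: cnt; case: (odd (nth _ _ _)) => /= cnt;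
   [have -> : (count odd la)./2 = (count odd mu)./2.+1 by lia
   |have -> : (count odd mu)./2 = (count odd la)./2.+1 by lia];
   rewrite /= ?negbK.
Qed.

(** The witness is the last index where [x] exceeds the staircase: it is the last nonempty row, from
    which a cell can always be removed. *)
Lemma strict_dec_decr K (x : {ffun 'I_K -> int}) :
    strict_dec x -> (forall i, 0 <= x i) -> x != staircase K ->
  exists i, strict_dec (x - unitv i) /\ forall j, 0 <= (x - unitv i) j.
Proof.
move=> dx x0 ne; have /strict_decP dx' := dx.
have /existsP[i1 ne1] : [exists i, x i != staircase K i].
  apply: contraR ne; rewrite negb_exists => /forallP h; apply/eqP/ffunP=> i.
  by apply/eqP; rewrite -[_ == _]negbK.
pose i := [arg max_(k > i1 | x k != staircase K k) (k : nat)].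
have [nei maxi] : x i != staircase K i /\
    forall j : 'I_K, x j != staircase K j -> (j <= i)%N.
  by rewrite /i; case: arg_maxnP.
have xi : staircase K i < x i.
  rewrite lt_neqAle eq_sym nei /= ffunE; exact: strict_dec_staircase_int.
have xj (j : 'I_K) : (i < j)%N -> x j = staircase K j.
  by move=> ij; apply/eqP; apply: contraTT ij => /maxi; rewrite -leqNgt.
exists i; split.
  apply/strict_decP => j k jk; rewrite !ffunE.
  have := dx' j k jk; case: (eqVneq j i) => [ji|_]; last by case: (k == i) => /=; lia.
  have -> : (k == i) = false by apply/eqP => ki; move: jk; rewrite ji ki ltnn.
  move: jk; rewrite ji => ik _; rewrite (xj k) //.
  by move: xi; rewrite !ffunE /=; have := ltn_ord k; move: ik; lia.
move=> j; rewrite !ffunE; case: eqP => [->|_] /=; last by have := x0 j; lia.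
by move: xi; rewrite ffunE; lia.
Qed.

(* Moving a bead two positions down removes a domino: a horizontal one if the
   position in between is empty, a vertical one otherwise. *)
Lemma remove_domino N mu (j : 'I_N) :
    is_partition mu -> (size mu <= N)%N ->
    injective (abacus N mu - unitv j *+ 2) -> 2 <= abacus N mu j ->
  exists la (t : 'S_N), [/\ is_partition la, (size la <= N)%N, adds_domino la mu &
    permv t (abacus N la) = abacus N mu - unitv j *+ 2].
Proof.
move=> pmu smu inj ge2; have dmu := abacus_strict_dec N pmu.
have /strict_decP dmu' := dmu; set L := abacus N mu - _ in inj *.
have LE i : L i = abacus N mu i - ((i == j).*2)%:Z.
  by rewrite /L [LHS]ffunE [in X in _ + X]ffunE unitv2E.
have L0 i : 0 <= L i.
  rewrite LE; case: eqP => [->|_]; first by rewrite subr_ge0.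
  by rewrite subr0 abacus_ge0.
have injL i k : i != k -> L i != L k by apply: contra => /eqP/inj->.
have nth_eq la i : (size la <= N)%N -> (N <= i)%N -> nth 0%N mu i = nth 0%N la i.
  by move=> sla Ni; rewrite !nth_default // (leq_trans _ Ni).
have [/existsP[j1 /eqP j1E]|nex] := boolP [exists k, abacus N mu k == abacus N mu j - 1].
  have jj1 : (j < j1)%N.
    rewrite ltnNge leq_eqVlt; apply/norP; split.
      by apply/eqP=> /val_inj e; move: j1E; rewrite e; lia.
    by apply/negP=> /dmu'; rewrite j1E; lia.
  have j1S : val j1 = j.+1.
    apply/eqP; rewrite eqn_leq jj1 andbT leqNgt; apply/negP=> lt.
    have jN : (j.+1 < N)%N by apply: ltn_trans lt (ltn_ord _).
    have := dmu' (Ordinal jN) j1 lt; have := dmu' j (Ordinal jN) (ltnSn _); lia.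
  have jj1n : j != j1 by rewrite -val_eqE /= j1S; lia.
  have j1j : (j1 == j) = false by rewrite eq_sym (negPf jj1n).
  have ME i : permv (tperm j j1) L i = abacus N mu i - (i == j)%:Z - (i == j1)%:Z.
    rewrite ffunE LE; case: tpermP => [->|->|].
    - by rewrite eqxx j1j (negPf jj1n) j1E /=; lia.
    - by rewrite !eqxx j1j j1E /=; lia.
    - by move=> /eqP/negPf-> /eqP/negPf->; rewrite /=; lia.
  have dM : strict_dec (permv (tperm j j1) L).
    apply/strict_decP => i k ik; have := dmu' i k ik.
    have : permv (tperm j j1) L i != permv (tperm j j1) L k.
      by apply/eqP=> /(permv_inj inj) e; move: ik; rewrite e ltnn.
    rewrite !ME; case: (eqVneq i j) => [->|_]; first by rewrite (negPf jj1n) /=; lia.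
    by case: (i == j1) => /=; lia.
  have [la [pla sla laE]] : exists la,
      [/\ is_partition la, (size la <= N)%N & abacus N la = permv (tperm j j1) L].
    by apply: abacus_surj => // i; rewrite ffunE; apply: L0.
  have nthE (i : 'I_N) : (nth 0%N mu i = nth 0%N la i + (i == j) + (i == j1))%N.
    have : abacus N la i = permv (tperm j j1) L i by rewrite laE.
    rewrite ME !abacusE; case: (i == j); case: (i == j1) => /=; lia.
  exists la, (tperm j j1); split=> //; last first.
    by rewrite laE permvM tperm2 permv1.
  apply: (@adds_vertical_domino _ _ j); split.
    have := nthE j; have := nthE j1; have := j1E; rewrite !abacusE !eqxx (negPf jj1n) j1j -j1S.
    by move=> e1 e2 e3; have := ltn_ord j1; have := j1S; move: e1 e2 e3 => /=; lia.
  move=> i; case: (ltnP i N) => [iN|Ni].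
    by have := nthE (Ordinal iN); rewrite -!val_eqE /= j1S.
  rewrite (nth_eq la) // -j1S.
  by rewrite !gtn_eqF ?addn0 // (leq_trans (ltn_ord _) Ni).
have dL : strict_dec L.
  apply/strict_decP => i k ik; have := dmu' i k ik.
  have : L i != L k by apply/eqP=> /inj e; move: ik; rewrite e ltnn.
  rewrite negb_exists in nex; have := forallP nex k.
  rewrite !LE; case: (eqVneq i j) => [->|_] /=; last by lia.
  by case: (k == j) => /=; lia.
have [la [pla sla laE]] := abacus_surj dL L0.
have nthE (i : 'I_N) : (nth 0%N mu i = nth 0%N la i + (i == j).*2)%N.
  have : abacus N la i = L i by rewrite laE.
  by rewrite LE !abacusE; case: (i == j) => /=; lia.
exists la, 1%g; split=> //; last by rewrite permv1.
apply: (@adds_horizontal_domino _ _ j) => i; case: (ltnP i N) => [iN|Ni].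
  by have := nthE (Ordinal iN).
by rewrite (nth_eq la) // gtn_eqF ?addn0 // (leq_trans (ltn_ord _) Ni).
Qed.

Lemma interleave_decr K (x y : {ffun 'I_K -> int}) :
    strict_dec x -> strict_dec y -> (forall i, 0 <= x i) -> (forall i, 0 <= y i) ->
    (x != staircase K) || (y != staircase K) ->
  exists (k : 'I_(K + K)) (x' y' : {ffun 'I_K -> int}),
    [/\ strict_dec x', strict_dec y', forall i, 0 <= x' i, forall i, 0 <= y' i &
        interleave x' y' = interleave x y - unitv k *+ 2 /\
        \sum_i x' i + \sum_i y' i < \sum_i x i + \sum_i y i].
Proof.
move=> dx dy x0 y0.
have sum_pred (z : {ffun 'I_K -> int}) i : \sum_j (z - unitv i) j < \sum_j z j.
  rewrite (eq_bigr (fun j => z j - (j == i)%:Z)) => [|j _]; last by rewrite !ffunE.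
  rewrite sumrB gtrBl (bigD1 i) //= eqxx big1 ?addr0 // => j /negPf->//.
case/orP=> [/(strict_dec_decr dx x0)|/(strict_dec_decr dy y0)] [i [d' p']].
  exists (lshift K i), (x - unitv i), y; split => //; split; last by rewrite ltrD2r.
  by apply/esym/eqP; rewrite subr_eq -interleave_unitv_l subrK.
exists (rshift K i), x, (y - unitv i); split => //; split; last by rewrite ltrD2l.
by apply/esym/eqP; rewrite subr_eq -interleave_unitv_r subrK.
Qed.

(** Pushing down one bead on a runner removes a domino and lowers the total of the positions. When
    no push is possible both runners are staircases and [mu] is empty. *)
Lemma on_runners_balanced K mu (u : 'S_(K + K)) (x y : {ffun 'I_K -> int}) :
    is_partition mu -> (size mu <= K + K)%N -> on_runners mu u x y -> balanced mu.
Proof.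
have [m] : exists m : nat, \sum_i x i + \sum_i y i < m%:Z.
  exists (absz (\sum_i x i + \sum_i y i)).+1; rewrite -addn1 PoszD abszE.
  by rewrite ltzD1 ler_norm.
elim: m mu u x y => [|m IHm] mu u x y xy_m pmu smu [dx dy x0 y0 uE].
  by move: xy_m; rewrite ltNge addr_ge0 ?sumr_ge0.
have [/(interleave_decr dx dy x0 y0)[k [x' [y' [dx' dy' x0' y0' [e lt]]]]]|] :=
    boolP ((x != staircase K) || (y != staircase K)).
  have injxy' := interleave_inj dx' dy'.
  have uE' : permv u (abacus (K + K) mu - unitv (u k) *+ 2) = interleave x' y'.
    rewrite e -uE -{2}[k](permK u) -permv_unitv2.
    by apply/ffunP=> i; rewrite !ffunE.
  have inj : injective (abacus (K + K) mu - unitv (u k) *+ 2).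
    by rewrite -(permvK u (_ - _)) uE'; apply: permv_inj.
  have ge2 : 2 <= abacus (K + K) mu (u k).
    have := interleave_ge0 k x0' y0'; rewrite -uE' ffunE [X in _ <= X]ffunE.
    by rewrite [X in _ + X]ffunE unitv2E eqxx subr_ge0.
  have [la [t [pla sla ad tE]]] := remove_domino pmu smu inj ge2.
  apply: (balanced_step _ pmu ad).
  apply: (IHm la (u * t)%g x' y') => //.
    by move: xy_m lt; rewrite -addn1 PoszD; lia.
  by split=> //; rewrite -permvM tE.
rewrite negb_or !negbK => /andP[/eqP xE /eqP yE].
have [u0 u0E] := interleave_staircase K.
have mu_nil : abacus (K + K) mu = staircase (K + K).
  apply: strict_dec_range; first exact: abacus_strict_dec.
  move=> i; rewrite -[abacus _ _](permvK u) uE xE yE -u0E permvM ffunE.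
  set j := (_ i); rewrite ffunE; have := ltn_ord j; lia.
suff -> : mu = [::] by constructor.
by apply: (@abacus_inj (K + K)) => //; rewrite mu_nil abacus_nil.
Qed.

(** * Two-quotients *)

(** The positions of [maya] shifted by one half, which makes them integers. *)
Definition bead (la : seq nat) (z : int) : Prop :=
  exists i : nat, z = (nth 0%N la i)%:Z - i%:Z.

Lemma mayaP la (x : rat) : maya la x <-> exists2 z, bead la z & x = z%:~R - 2^-1.
Proof.
split=> [[i ->]|[z [i ->] ->]]; last by exists i; rewrite rmorphB.
by exists ((nth 0%N la i)%:Z - i%:Z); [exists i|rewrite rmorphB].
Qed.

Lemma maya_beads la (z : int) : maya la (z%:~R - 2^-1) <-> bead la z.
Proof.
rewrite mayaP; split=> [[w bw /addIr/eqP]|bz]; last by exists z.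
by rewrite eqr_int => /eqP ->.
Qed.

(** With [x = z - 1/2], the class of 1/2 modulo 2 consists of the odd [z] and that of -1/2 of the
    even [z]. *)
Lemma is_two_quotient_beads la a b : is_two_quotient la (a, b) <->
  [/\ is_partition a, is_partition b, forall z, bead a z <-> bead la (2 * z - 1) &
      forall z, bead b z <-> bead la (2 * z)].
Proof.
split=> [[/= pa pb ea eb]|[pa pb ea eb]]; split=> //=.
- move=> z; rewrite -!maya_beads ea /=; split.
    case=> x [mx _] xz; have -> // : (2 * z - 1)%:~R - 2^-1 = x :> rat.
    by rewrite rmorphB rmorphM /=; lra.
  move=> mx; exists ((2 * z - 1)%:~R - 2^-1); last by rewrite rmorphB rmorphM /=; lra.
  by split=> //; exists (z - 1); rewrite !rmorphB rmorphM /=; lra.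
- move=> z; rewrite -!maya_beads eb /=; split.
    case=> x [mx _] xz; have -> // : (2 * z)%:~R - 2^-1 = x :> rat.
    by rewrite rmorphM /=; lra.
  move=> mx; exists ((2 * z)%:~R - 2^-1); last by rewrite rmorphM /=; lra.
  by split=> //; exists z; rewrite rmorphM /=; lra.
- apply/seteqP; split => x /=.
    move=> /mayaP[z /ea bz ->]; exists ((2 * z - 1)%:~R - 2^-1).
      split; first exact/maya_beads.
      by exists (z - 1); rewrite !rmorphB rmorphM /=; lra.
    by rewrite rmorphB rmorphM /=; lra.
  case=> w [/mayaP[z bz ->] [k kE]] <-; have zk : z = 2 * (k + 1) - 1.
    apply/eqP; rewrite -(eqr_int rat) rmorphB rmorphM rmorphD /=; apply/eqP; lra.
  have : bead a (k + 1) by apply/ea; rewrite -zk.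
  by move/maya_beads; rewrite zk rmorphB rmorphM rmorphD /=; congr maya; lra.
apply/seteqP; split => x /=.
  move=> /mayaP[z /eb bz ->]; exists ((2 * z)%:~R - 2^-1).
    split; first exact/maya_beads.
    by exists z; rewrite rmorphM /=; lra.
  by rewrite rmorphM /=; lra.
case=> w [/mayaP[z bz ->] [k kE]] <-; have zk : z = 2 * k.
  apply/eqP; rewrite -(eqr_int rat) rmorphM /=; apply/eqP; lra.
have : bead b k by apply/eb; rewrite -zk.
by move/maya_beads; rewrite zk rmorphM /=; congr maya; lra.
Qed.

(** Bead [z] sits at position [z + N - 1], and all negative positions count as occupied. For
    [N = 2 K] the beads [2 z - 1] and [2 z] sit at [2 p] and [2 p + 1] with [p = z + K - 1], the
    position of bead [z] among [K]: this is the agreement with the conventions of the 2-quotient. *)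
Lemma bead_abacus N la z : (size la <= N)%N ->
  bead la z <-> (exists i, abacus N la i = z + N%:Z - 1) \/ z + N%:Z - 1 < 0.
Proof.
move=> sN; split=> [[i ->]|[[i iE]|lt]].
- case: (ltnP i N) => [iN|Ni].
    left; exists (Ordinal iN); rewrite abacusE /=; lia.
  by right; rewrite nth_default; [lia|apply: leq_trans sN Ni].
- by exists i; move: iE; rewrite abacusE; have := ltn_ord i; lia.
- exists `|z|%N; rewrite nth_default; first lia.
  lia.
Qed.

Lemma perm_of_values N (v v' : {ffun 'I_N -> int}) : injective v' ->
  (forall i, exists j, v j = v' i) -> exists u : 'S_N, permv u v = v'.
Proof.
move=> injv' ex; have exb i : exists j, v j == v' i by have [j e] := ex i; exists j; apply/eqP.
have injg : injective (fun i => xchoose (exb i)).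
  move=> i j e; apply: injv'; rewrite -(eqP (xchooseP (exb i))) -(eqP (xchooseP (exb j))).
  by rewrite e.
by exists (perm injg); apply/ffunP=> i; rewrite ffunE permE; apply/eqP/(xchooseP (exb i)).
Qed.

Lemma bead_inj a b : is_partition a -> is_partition b ->
  (forall z, bead a z <-> bead b z) -> a = b.
Proof.
move=> pa pb ab; pose N := maxn (size a) (size b).
have sa : (size a <= N)%N by apply: leq_maxl.
have sb : (size b <= N)%N by apply: leq_maxr.
have db := abacus_strict_dec N pb.
have [u uE] : exists u : 'S_N, permv u (abacus N a) = abacus N b.
  apply: perm_of_values; first exact: strict_dec_inj.
  move=> i; have : bead b (abacus N b i - N%:Z + 1).
    by apply/(bead_abacus _ sb); left; exists i; lia.
  move/ab/(bead_abacus _ sa) => [[j jE]|]; first by exists j; rewrite jE; lia.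
  by have := abacus_ge0 b i; lia.
have u1 : u = 1%g.
  by apply: (strict_dec_perm_uniq (abacus_strict_dec N pa)); rewrite uE.
by apply: (@abacus_inj N) => //; rewrite -uE u1 permv1.
Qed.

Lemma two_quotientE la ab : is_two_quotient la ab -> two_quotient la = ab.
Proof.
move=> q; apply: xget_unique => // -[a' b'] q'; case: ab q => a b.
move=> /is_two_quotient_beads[pa pb ea eb].
move: q' => /= /is_two_quotient_beads[pa' pb' ea' eb'].
congr (_, _); apply: bead_inj => // z; first by rewrite ea ea'.
by rewrite eb eb'.
Qed.

Lemma quotient_on_runners K la a b :
    is_partition la -> (size la <= K + K)%N -> (size a <= K)%N -> (size b <= K)%N ->
    is_two_quotient la (a, b) ->
  exists u : 'S_(K + K), on_runners la u (abacus K a) (abacus K b).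
Proof.
move=> pla sla sa sb /is_two_quotient_beads[pa pb ea eb].
have da := abacus_strict_dec K pa; have db := abacus_strict_dec K pb.
have [u uE] : exists u : 'S_(K + K), permv u (abacus (K + K) la) =
    interleave (abacus K a) (abacus K b).
  apply: perm_of_values; first exact: interleave_inj.
  move=> k; rewrite -[k]fintype.splitK; case: (fintype.split k) => i /=.
    rewrite interleave_l; have : bead a (abacus K a i - K%:Z + 1).
      by apply/(bead_abacus _ sa); left; exists i; lia.
    move/ea/(bead_abacus _ sla) => [[j jE]|]; first by exists j; rewrite jE; lia.
    by have := abacus_ge0 a i; lia.
  rewrite interleave_r; have : bead b (abacus K b i - K%:Z + 1).
    by apply/(bead_abacus _ sb); left; exists i; lia.
  move/eb/(bead_abacus _ sla) => [[j jE]|]; first by exists j; rewrite jE; lia.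
  by have := abacus_ge0 b i; lia.
by exists u; split=> // i; apply: abacus_ge0.
Qed.

Lemma on_runners_quotient K la a b (u : 'S_(K + K)) :
    is_partition a -> is_partition b -> (size la <= K + K)%N ->
    (size a <= K)%N -> (size b <= K)%N ->
    permv u (abacus (K + K) la) = interleave (abacus K a) (abacus K b) ->
  is_two_quotient la (a, b).
Proof.
move=> pa pb sla sa sb uE; apply/is_two_quotient_beads; split=> // z.
  rewrite (bead_abacus _ sa) (bead_abacus _ sla); split.
    case=> [[i iE]|]; last by right; lia.
    left; exists (u (lshift K i)).
    by have /ffunP/(_ (lshift K i)) := uE; rewrite ffunE interleave_l => ->; rewrite iE; lia.
  case=> [[j jE]|]; last by right; lia.
  have /ffunP/(_ (u^-1 j)%g) := uE; rewrite ffunE permKV jE -[(u^-1 j)%g]fintype.splitK.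
  case: (fintype.split _) => i /=; rewrite ?interleave_l ?interleave_r; last by lia.
  by move=> e; left; exists i; lia.
rewrite (bead_abacus _ sb) (bead_abacus _ sla); split.
  case=> [[i iE]|]; last by right; lia.
  left; exists (u (rshift K i)).
  by have /ffunP/(_ (rshift K i)) := uE; rewrite ffunE interleave_r => ->; rewrite iE; lia.
case=> [[j jE]|]; last by right; lia.
have /ffunP/(_ (u^-1 j)%g) := uE; rewrite ffunE permKV jE -[(u^-1 j)%g]fintype.splitK.
case: (fintype.split _) => i /=; rewrite ?interleave_l ?interleave_r; first by lia.
by move=> e; left; exists i; lia.
Qed.

(** * Shifted Schur functions *)

(** Otherwise [w] would inject the indices from [i] on into those after [i]. This finds a vanishing
    factor in each term of a determinant, and compares sequences after sorting. *)
Lemma perm_crossing N (w : 'S_N) (i : 'I_N) : exists r : 'I_N, (i <= r)%N && (w r <= i)%N.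
Proof.
apply/existsP; apply: contraT; rewrite negb_exists => /forallP h.
pose A := [set r : 'I_N | (i <= r)%N]; pose B := [set r : 'I_N | (i < r)%N].
have sub : w @: A \subset B.
  apply/fintype.subsetP=> _ /imsetP[r rA ->]; move: rA; rewrite !inE => ir.
  by have := h r; rewrite ir /= -ltnNge.
have : (#|A| <= #|B|)%N by rewrite -(card_imset _ (@perm_inj _ w)) subset_leq_card.
have -> : A = i |: B.
  by apply/setP=> r; rewrite !inE leq_eqVlt eq_sym -val_eqE.
by rewrite cardsU1 inE ltnn add1n ltnn.
Qed.

Lemma strict_dec_le K (x : {ffun 'I_K -> int}) (i j : 'I_K) :
  strict_dec x -> (i <= j)%N -> x j <= x i.
Proof.
move=> /strict_decP dx; rewrite leq_eqVlt => /orP[/eqP/val_inj-> //|/dx/ltW //].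
Qed.

(** The vanishing property of shifted Schur functions: each term of the determinant contains a
    factor at or after [i] in [x] and at or before [i] in [a], whose argument is negative. *)
Lemma skew_count_eq0 K (x a : {ffun 'I_K -> int}) (i : 'I_K) :
  strict_dec x -> strict_dec a -> x i < a i -> skew_count x a = 0.
Proof.
move=> dx da lt; rewrite /skew_count /determinant big1 // => w _.
have [r /andP[ir wi]] := perm_crossing w i.
rewrite (bigD1 r) //= mxE inv_fact_neg ?mul0r ?mulr0 //.
rewrite subr_lt0; apply: le_lt_trans (strict_dec_le dx ir) _.
exact: lt_le_trans lt (strict_dec_le da wi).
Qed.

Lemma interleave_le K (x y x' y' : {ffun 'I_K -> int}) k :
  (forall i, x i <= x' i) -> (forall i, y i <= y' i) ->
  interleave x y k <= interleave x' y' k.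
Proof.
move=> xx' yy'; rewrite -[k]fintype.splitK; case: (fintype.split k) => i /=.
  by rewrite !interleave_l; have := xx' i; lia.
by rewrite !interleave_r; have := yy' i; lia.
Qed.

(** Containment on both runners compares the beads of [mu] and [la] up to a permutation; sorting
    both sides preserves the comparison. *)
Lemma on_runners_le K mu la (u u' : 'S_(K + K)) (x y x' y' : {ffun 'I_K -> int}) :
    is_partition mu -> is_partition la -> on_runners mu u x y -> on_runners la u' x' y' ->
    (forall i, x i <= x' i) -> (forall i, y i <= y' i) ->
  forall i, abacus (K + K) mu i <= abacus (K + K) la i.
Proof.
move=> pmu pla [_ _ _ _ uE] [_ _ _ _ uE'] xx' yy' i.
have le_t j : abacus (K + K) mu j <= abacus (K + K) la ((u^-1 * u')%g j).
  have := interleave_le (u^-1 j)%g xx' yy'; rewrite -uE -uE'.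
  by rewrite ffunE [X in _ <= X]ffunE permKV permM.
have [r /andP[ir ri]] := perm_crossing (u^-1 * u')^-1%g i.
have := le_t ((u^-1 * u')^-1 r)%g; rewrite permKV => le_r.
apply: le_trans (strict_dec_le (abacus_strict_dec _ pmu) ri) _.
exact: le_trans le_r (strict_dec_le (abacus_strict_dec _ pla) ir).
Qed.

Lemma falling_natr (l m : nat) :
  falling (l%:R : algC) m = l`!%:R * inv_fact (l%:Z - m%:Z).
Proof.
case: (leqP m l) => [ml|lm]; last first.
  rewrite /falling (bigD1 (Ordinal lm)) //= subrr mul0r inv_fact_neg ?mulr0 //.
  lia.
have -> : falling (l%:R : algC) m = (l ^_ m)%:R.
  rewrite ffact_prod natr_prod; apply: eq_bigr => i _.
  by rewrite natrB //; have := ltn_ord i; lia.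
by rewrite subzn //= -(ffact_fact ml) natrM mulfK // pnatr_eq0 -lt0n fact_gt0.
Qed.

(** Row [i] contributes the factorial of its bead. These factors are common to the numerator and the
    denominator of a shifted Schur function. *)
Lemma det_falling n al (a : 'I_n -> nat) :
  \det (\matrix_(i < n, j < n) falling ((nth 0%N al i + (n - i.+1))%N%:R : algC) (a j)) =
  (\prod_(i < n) (nth 0%N al i + (n - i.+1))`!)%:R *
  skew_count (abacus n al) [ffun j => (a j)%:Z].
Proof.
rewrite /skew_count /determinant mulr_sumr; apply: eq_bigr => w _.
rewrite mulrCA natr_prod -big_split; congr (_ * _); apply: eq_bigr => i _ /=.
by rewrite !mxE falling_natr abacusE ffunE.
Qed.

Lemma shifted_schur_atE a al : let n := maxn (size a) (size al) in
  shifted_schur_at a al =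
  skew_count (abacus n al) (abacus n a) / skew_count (abacus n al) (staircase n).
Proof.
move=> n; rewrite /shifted_schur_at /shifted_schur -/n.
have num (m : 'I_n -> nat) :
    \det (\matrix_(i < n, j < n) falling ((nth 0%N al i)%:R + (n - i.+1)%N%:R) (m j)) =
    (\prod_(i < n) (nth 0%N al i + (n - i.+1))`!)%:R *
    skew_count (abacus n al) [ffun j => (m j)%:Z] :> algC.
  rewrite -det_falling; congr (\det _); apply/matrixP=> i j.
  by rewrite !mxE natrD.
rewrite num (num (fun j => (n - j.+1)%N)) -mulf_div divff ?mul1r //.
rewrite pnatr_eq0 -lt0n prodn_gt0 // => i; exact: fact_gt0.
Qed.

(** The new last row of the matrix is zero except for a final 1, and all other beads rise by one on
    both sides, keeping their differences. This passes from the number of variables in the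
    definition to [K]. *)
Lemma skew_count_abacusS n al a : (size al <= n)%N -> (size a <= n)%N ->
  skew_count (abacus n.+1 al) (abacus n.+1 a) = skew_count (abacus n al) (abacus n a).
Proof.
move=> sal sa; rewrite /skew_count (expand_det_row _ ord_max) (bigD1 ord_max) //=.
rewrite mxE !abacusE /= !nth_default // subnn !addn0 subrr big1 ?addr0 => [|j jm].
  have -> : inv_fact 0 = 1 by rewrite /inv_fact /= invr1.
  rewrite mul1r /cofactor addnn -signr_odd odd_double mul1r.
  congr (\det _); apply/matrixP=> i j; rewrite !mxE !abacusE; congr inv_fact.
  rewrite /= /bump leqNgt ltn_ord leqNgt ltn_ord !add0n.
  by move: (ltn_ord i) (ltn_ord j) => /= iN jN; rewrite (subSn iN) (subSn jN); lia.
rewrite mxE !abacusE /= nth_default // subnn inv_fact_neg ?mul0r //.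
by move: jm; rewrite -val_eqE /=; have := ltn_ord j; lia.
Qed.

Lemma skew_count_stable n K al a : (size al <= n)%N -> (size a <= n)%N -> (n <= K)%N ->
  skew_count (abacus K al) (abacus K a) = skew_count (abacus n al) (abacus n a).
Proof.
move=> sal sa /subnKC <-; elim: (K - n)%N => [|d IHd]; first by rewrite addn0.
by rewrite addnS skew_count_abacusS // ?(leq_trans _ (leq_addr _ _)).
Qed.

Lemma shifted_schur_at_skew K a al : (size al <= K)%N -> (size a <= K)%N ->
  shifted_schur_at a al =
  skew_count (abacus K al) (abacus K a) / skew_count (abacus K al) (staircase K).
Proof.
move=> sal sa; rewrite shifted_schur_atE -!abacus_nil; set n := maxn _ _.
have nK : (n <= K)%N by rewrite geq_max sa sal.
by rewrite !(@skew_count_stable n K) ?leq_maxl ?leq_maxr.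
Qed.

(** * The sum over balanced partitions *)

Lemma sum_interleave K (x y : {ffun 'I_K -> int}) :
  \sum_k interleave x y k = (\sum_i x i + \sum_i y i) * 2 + K%:Z.
Proof.
rewrite big_split_ord /= (eq_bigr (fun i => x i * 2)) => [|i _]; last by rewrite interleave_l.
rewrite [X in _ + X](eq_bigr (fun i => y i * 2 + 1)) => [|i _]; last by rewrite interleave_r.
rewrite big_split /= -!mulr_suml sumr_const card_ord mulrDl -addrA.
by congr (_ + (_ + _)); apply: natz.
Qed.

Lemma on_runners_sum K mu (u : 'S_(K + K)) (x y : {ffun 'I_K -> int}) :
    (size mu <= K + K)%N -> on_runners mu u x y ->
  (sumn mu)%:Z + \sum_i staircase (K + K) i = (\sum_i x i + \sum_i y i) * 2 + K%:Z.
Proof.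
move=> smu [_ _ _ _ uE]; rewrite -sum_interleave -uE -(sum_abacus smu).
rewrite [LHS](reindex_inj (@perm_inj _ u)); apply: eq_bigr => i _.
by rewrite [RHS]ffunE.
Qed.

Lemma staircase_on_runners K (u0 : 'S_(K + K)) :
    permv u0 (staircase (K + K)) = interleave (staircase K) (staircase K) ->
  on_runners [::] u0 (staircase K) (staircase K).
Proof.
move=> u0E; split; rewrite ?abacus_nil //; try exact: staircase_strict_dec.
  by move=> i; apply: staircase_ge0.
by move=> i; apply: staircase_ge0.
Qed.

Lemma on_runners_inj K mu mu' (u u' : 'S_(K + K)) (x y : {ffun 'I_K -> int}) :
    is_partition mu -> is_partition mu' -> (size mu <= K + K)%N -> (size mu' <= K + K)%N ->
    on_runners mu u x y -> on_runners mu' u' x y -> mu = mu'.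
Proof.
move=> pmu pmu' smu smu' [_ _ _ _ uE] [_ _ _ _ uE'].
apply: (@abacus_inj (K + K)) => //.
have e : abacus (K + K) mu' = permv (u'^-1 * u)%g (abacus (K + K) mu).
  by rewrite -permvM uE -uE' permvK.
have : (u'^-1 * u = 1)%g.
  by apply: (strict_dec_perm_uniq (abacus_strict_dec _ pmu)); rewrite -e; apply: abacus_strict_dec.
by move=> e1; rewrite e e1 permv1.
Qed.

Lemma permv_injective N (u u' : 'S_N) (v : {ffun 'I_N -> int}) :
  injective v -> permv u v = permv u' v -> u = u'.
Proof.
move=> injv /ffunP e; apply/permP=> i; apply: injv.
by have := e i; rewrite !ffunE.
Qed.

Lemma on_runners_two_quotient K mu (u : 'S_(K + K)) (x y : {ffun 'I_K -> int}) :
    is_partition mu -> (size mu <= K + K)%N -> on_runners mu u x y ->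
  [/\ (size (two_quotient mu).1 <= K)%N, (size (two_quotient mu).2 <= K)%N,
      abacus K (two_quotient mu).1 = x & abacus K (two_quotient mu).2 = y].
Proof.
move=> pmu smu [dx dy x0 y0 uE].
have [a [pa sa aE]] := abacus_surj dx x0; have [b [pb sb bE]] := abacus_surj dy y0.
rewrite (@two_quotientE mu (a, b)) //.
by apply: (@on_runners_quotient K _ _ _ u) => //; rewrite aE bE.
Qed.

Lemma on_runners_uniq K mu (u u' : 'S_(K + K)) (x y x' y' : {ffun 'I_K -> int}) :
    is_partition mu -> (size mu <= K + K)%N ->
    on_runners mu u x y -> on_runners mu u' x' y' -> u = u'.
Proof.
move=> pmu smu r r'; have [_ _ xE yE] := on_runners_two_quotient pmu smu r.
have [_ _ xE' yE'] := on_runners_two_quotient pmu smu r'.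
have [_ _ _ _ uE] := r; have [_ _ _ _ uE'] := r'.
apply: (permv_injective (strict_dec_inj (abacus_strict_dec (K + K) pmu))).
by rewrite uE uE' -xE -yE -xE' -yE'.
Qed.

(** A chain of dominoes yields one sorting permutation, and sorting permutations are unique, so the
    sign does not depend on the chain. *)
Lemma sigma_on_runners K (u0 u : 'S_(K + K)) mu (x y : {ffun 'I_K -> int}) :
    permv u0 (staircase (K + K)) = interleave (staircase K) (staircase K) ->
    balanced mu -> (size mu <= K + K)%N -> on_runners mu u x y ->
  sigma mu = (-1) ^+ odd_perm u * (-1) ^+ odd_perm u0.
Proof.
move=> u0E bmu smu r; have [_ [u' [x' [y' [r' ->]]]]] := balanced_on_runners u0E bmu smu.
by rewrite (on_runners_uniq (balanced_partition bmu) smu r r').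
Qed.

Lemma alternating_on_runners K mu (u : 'S_(K + K)) (x y : {ffun 'I_K -> int})
    (B : {ffun 'I_(K + K) -> int} -> algC) :
    alternating B -> on_runners mu u x y ->
  B (abacus (K + K) mu) = (-1) ^+ odd_perm u * B (interleave x y).
Proof. by move=> altB [_ _ _ _ <-]; rewrite altB mulrA -signr_addb addbb mul1r. Qed.

Lemma alternant_interleave K (x y : {ffun 'I_K -> int}) :
    strict_dec x -> strict_dec y -> (forall i, 0 <= x i) -> (forall i, 0 <= y i) ->
    alternant (interleave x y) != 0 -> x = staircase K /\ y = staircase K.
Proof.
move=> dx dy x0 y0 ne0.
have [w wE] : exists w : 'S_(K + K), interleave x y = permv w (staircase (K + K)).
  apply/not_existsP => h; case/eqP: ne0; rewrite /alternant big1 // => w _.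
  by case: eqP => [/h //|_]; rewrite mulr0.
have lt k : interleave x y k < (K + K)%:Z.
  by rewrite wE !ffunE; have := ltn_ord (w k); lia.
split; apply: strict_dec_range => // i.
  by rewrite x0 /=; have := lt (lshift K i); rewrite interleave_l; lia.
by rewrite y0 /=; have := lt (rshift K i); rewrite interleave_r; lia.
Qed.

Lemma int_bound K (x y : {ffun 'I_K -> int}) : exists M : nat,
  [/\ (K <= M)%N, forall i, x i < M%:Z & forall i, y i < M%:Z].
Proof.
exists (K + \sum_i absz (x i) + \sum_i absz (y i)).+1%N; split=> [|i|i].
- by rewrite -addnS -addnA leq_addr.
- apply: le_lt_trans (ler_norm _) _; rewrite -abszE ltz_nat ltnS (bigD1 i) //=.
  by rewrite addnCA -!addnA leq_addr.
- apply: le_lt_trans (ler_norm _) _; rewrite -abszE ltz_nat ltnS [X in (_ <= _ + X)%N](bigD1 i) //=.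
  by rewrite addnCA leq_addr.
Qed.

(** The alternant vanishes at every pair of runners except the two staircases. The surviving term is
    the denominator of both shifted Schur functions. *)
Lemma psums2_staircase K m (u0 : 'S_(K + K)) (x y : {ffun 'I_K -> int}) :
    permv u0 (staircase (K + K)) = interleave (staircase K) (staircase K) ->
    \sum_i staircase K i + \sum_i staircase K i + m%:Z = \sum_i x i + \sum_i y i ->
  psums (nseq m 2) (@alternant (K + K)) (interleave x y) =
  m`!%:R * (skew_count x (staircase K) * skew_count y (staircase K) * (-1) ^+ odd_perm u0).
Proof.
move=> u0E sumE; have [M [KM xM yM]] := int_bound x y.
rewrite (psums2_interleave m (@alternating_alternant _) (@nneg_support_alternant _) xM yM).
congr (_ * _).
have stM (i : 'I_K) : (K - i.+1 < M)%N by have := ltn_ord i; lia.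
pose st : {ffun 'I_K -> 'I_M} := [ffun i => Ordinal (stM i)].
have stE : natv st = staircase K by apply/ffunP=> i; rewrite !ffunE.
rewrite (bigD1 (st, st)) /=; last first.
  by rewrite /runner_pair /= stE staircase_strict_dec sumE eqxx.
rewrite stE -u0E alternating_alternant.
rewrite (alternant_strict_dec (v := staircase (K + K))); last first.
  exact/strict_decP/staircase_strict_dec.
rewrite eqxx mulr1 big1 ?addr0 // => -[a b] /andP[/and3P[/= da db _] ne].
have [->|ne0] := eqVneq (alternant (interleave (natv a) (natv b))) 0; first by rewrite mulr0.
have nat0 (c : {ffun 'I_K -> 'I_M}) i : 0 <= natv c i by rewrite ffunE.
have [ae be] := alternant_interleave da db (nat0 a) (nat0 b) ne0.
have natI (c d : {ffun 'I_K -> 'I_M}) : natv c = natv d -> c = d.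
  by move=> /ffunP e; apply/ffunP=> i; apply: val_inj; have := e i; rewrite !ffunE => -[].
by case/eqP: ne; congr (_, _); apply: natI; rewrite stE.
Qed.

Lemma natv_inj K M : injective (@natv K M).
Proof.
by move=> c d /ffunP e; apply/ffunP=> i; apply: val_inj; have := e i; rewrite !ffunE => -[].
Qed.

Lemma natv_surj K M (x : {ffun 'I_K -> int}) : (forall i, 0 <= x i) ->
  (forall i, x i < M%:Z) -> exists a : {ffun 'I_K -> 'I_M}, natv a = x.
Proof.
move=> x0 xM; have lt i : (`|x i|%N < M)%N by rewrite -ltz_nat gez0_abs.
by exists [ffun i => Ordinal (lt i)]; apply/ffunP=> i; rewrite !ffunE gez0_abs.
Qed.

Definition is_runner_partition K M (p : {ffun 'I_K -> 'I_M} * {ffun 'I_K -> 'I_M})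
    (mu : seq nat) : Prop :=
  [/\ is_partition mu, (size mu <= K + K)%N &
      exists v : 'S_(K + K), on_runners mu v (natv p.1) (natv p.2)].

(** The inverse of taking quotients; for runner pairs [runner_partitionP] excludes the default
    value. *)
Definition runner_partition K M (p : {ffun 'I_K -> 'I_M} * {ffun 'I_K -> 'I_M}) : seq nat :=
  xget [::] [set mu | is_runner_partition p mu]%classic.

Lemma natv_ge0 K M (a : {ffun 'I_K -> 'I_M}) i : 0 <= natv a i.
Proof. by rewrite ffunE. Qed.

Lemma runner_partitionP K M k s (p : {ffun 'I_K -> 'I_M} * {ffun 'I_K -> 'I_M}) :
  runner_pair k s p -> is_runner_partition p (runner_partition p).
Proof.
move=> /and3P[d1 d2 _]; apply: (xgetPex [::]).
have [w dw] := sorting_perm (interleave_inj d1 d2).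
have [|mu [pmu smu muE]] := abacus_surj dw.
  by move=> i; rewrite ffunE interleave_ge0 // => j; apply: natv_ge0.
exists mu; split=> //; exists w^-1%g; split=> //; try by move=> i; apply: natv_ge0.
by rewrite muE permvK.
Qed.

Lemma runner_partition_uniq K M k s (p : {ffun 'I_K -> 'I_M} * {ffun 'I_K -> 'I_M}) mu :
  runner_pair k s p -> is_runner_partition p mu -> runner_partition p = mu.
Proof.
move=> /runner_partitionP[p1 s1 [v1 r1]] [p2 s2 [v2 r2]].
exact: on_runners_inj p1 p2 s1 s2 r1 r2.
Qed.

Lemma diagram_nth_le mu la i : (diagram mu `<=` diagram la)%classic ->
  (nth 0%N mu i <= nth 0%N la i)%N.
Proof.
move=> sub; case e: (nth 0%N mu i) => [//|q].
by apply: (sub (i, q)); rewrite /diagram /= e.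
Qed.

(* Reindexing by 2-quotients: [p] ranges over the pairs of runners, and the terms
   of the left-hand side that correspond to no such pair vanish. *)
Lemma sum_balanced_runners (K k : nat) (la al be : seq nat) (u0 u : 'S_(K + K)) (M : nat)
    (nu : seq nat) :
    permv u0 (staircase (K + K)) = interleave (staircase K) (staircase K) ->
    is_partition la -> (size la <= K)%N -> (size al <= K)%N -> (size be <= K)%N ->
    on_runners la u (abacus K al) (abacus K be) ->
    (forall i, abacus K al i < M%:Z) -> (forall i, abacus K be i < M%:Z) ->
    0%N \notin nu -> (sumn nu + k.*2 = sumn la)%N ->
  \sum_(mu \in [set mu : seq nat |
          [/\ balanced mu, sumn mu = sumn nu & diagram mu `<=` diagram la]]%classic)
     (sigma mu * chi mu nu * shifted_schur_at (two_quotient mu).1 al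
       * shifted_schur_at (two_quotient mu).2 be) =
  \sum_(p : {ffun 'I_K -> 'I_M} * {ffun 'I_K -> 'I_M} |
       runner_pair k (\sum_i abacus K al i + \sum_i abacus K be i) p)
    skew_count (abacus K al) (natv p.1) / skew_count (abacus K al) (staircase K) *
    (skew_count (abacus K be) (natv p.2) / skew_count (abacus K be) (staircase K)) *
    (psums nu (@alternant (K + K)) (interleave (natv p.1) (natv p.2)) * (-1) ^+ odd_perm u0).
Proof.
move=> u0E pla sla sal sbe ru xM yM nu0 sumE.
have slaK : (size la <= K + K)%N by apply: leq_trans sla (leq_addr _ _).
set s := \sum_i abacus K al i + \sum_i abacus K be i.
(* The pairs lying below the runners of [la]; their partitions are balanced and contained in
   [la]. *)
pose P0 (p : {ffun 'I_K -> 'I_M} * {ffun 'I_K -> 'I_M}) :=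
  [&& runner_pair k s p, [forall i, natv p.1 i <= abacus K al i] &
      [forall i, natv p.2 i <= abacus K be i]].
have smu_le mu : is_partition mu -> (diagram mu `<=` diagram la)%classic ->
    (size mu <= K + K)%N.
  move=> pmu sub; apply: leq_trans slaK; apply: size_partition_le => // i.
  exact: diagram_nth_le.
have [dx dy _ _ _] := ru.
have quotE p : P0 p -> [/\ (size (two_quotient (runner_partition p)).1 <= K)%N,
    (size (two_quotient (runner_partition p)).2 <= K)%N,
    abacus K (two_quotient (runner_partition p)).1 = natv p.1 &
    abacus K (two_quotient (runner_partition p)).2 = natv p.2].
  move=> /and3P[rp _ _]; have [pmu smu [v r]] := runner_partitionP rp.
  exact: on_runners_two_quotient pmu smu r.
have inS p : P0 p -> [/\ balanced (runner_partition p), sumn (runner_partition p) = sumn nu &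
    (diagram (runner_partition p) `<=` diagram la)%classic].
  move=> /and3P[rp /forallP le1 /forallP le2].
  have [pmu smu [v r]] := runner_partitionP rp; split.
  - exact: on_runners_balanced r.
  - have := on_runners_sum smu r; have := on_runners_sum slaK ru.
    case/and3P: rp => _ _ /eqP; rewrite -/s => sp.
    move=> e1 e2; apply/eqP; rewrite -eqz_nat; apply/eqP.
    move: e1 e2; rewrite -sp -sumE -muln2 !PoszD PoszM; set D := \sum_i staircase _ _; lia.
  move=> -[i q]; rewrite /diagram /= => qi; apply: leq_trans qi _.
  case: (ltnP i (K + K)) => [iK|Ki]; last first.
    by rewrite nth_default // (leq_trans smu).
  have := on_runners_le pmu pla r ru le1 le2 (Ordinal iK).
  by rewrite !abacusE lez_nat leq_add2r.
(* A pair with a bead above the corresponding bead of [la] contributes 0 by the vanishing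
   property. *)
rewrite [RHS](bigID (fun p => P0 p)) /= [X in _ = _ + X]big1 ?addr0; last first.
  move=> p /andP[rp]; rewrite /P0 rp /= negb_and => /orP[]; rewrite negb_forall => /existsP[i];
  rewrite -ltNge => lt; case/and3P: rp => d1 d2 _.
    by rewrite (skew_count_eq0 dx d1 lt) !mul0r.
  by rewrite (skew_count_eq0 dy d2 lt) mul0r mulr0 mul0r.
rewrite (@fsbigE _ _ _ _ _ [seq runner_partition p | p <- enum P0]).
- rewrite big_map big_enum_cond /=; apply: eq_big => [p|p].
    rewrite -[p \in P0]/(P0 p); have [Pp|nPp] := boolP (P0 p); last by rewrite andbF.
    have /and3P[rp _ _] := Pp; rewrite rp; apply: mem_set => /=.
    exact: inS.
  rewrite -[p \in P0]/(P0 p) => /andP[Pp _]; have [bmu smu_nu sub] := inS p Pp.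
  have /and3P[rp _ _] := Pp; have [pmu smu [v r]] := runner_partitionP rp.
  have [s1 s2 e1 e2] := quotE p Pp.
  rewrite (shifted_schur_at_skew sal s1) (shifted_schur_at_skew sbe s2) e1 e2.
  rewrite (sigma_on_runners u0E bmu smu r) (chi_psums pmu smu nu0 (esym smu_nu)).
  rewrite -[beta_vec _]/(abacus (K + K) (runner_partition p)).
  rewrite (alternating_on_runners (alternating_psums nu (@alternating_alternant _)) r).
  have sgn2 : (-1) ^+ odd_perm v * (-1) ^+ odd_perm v = 1 :> algC.
    by rewrite -signr_addb addbb.
  move: sgn2; move: ((-1) ^+ odd_perm v : algC) => sv sgn2.
  set G1 := skew_count _ _ / _; set G2 := skew_count _ _ / _.
  set B := psums _ _ _; set s0 := _ ^+ odd_perm u0.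
  transitivity (sv * sv * (G1 * G2 * (B * s0))); first by ring.
  by rewrite sgn2 mul1r.
- rewrite map_inj_in_uniq ?enum_uniq // => p p'; rewrite !mem_enum => Pp Pp' e.
  have [_ _ e1 e2] := quotE p Pp; have [_ _ e1' e2'] := quotE p' Pp'.
  case: p p' Pp Pp' e e1 e2 e1' e2' => [a b] [a' b'] /= _ _ -> -> -> e1' e2'.
  by congr (_, _); apply: natv_inj.
- by move=> mu /= /mapP[p]; rewrite mem_enum => /inS[b1 b2 b3] ->.
(* A partition inside [la] may still have a quotient not contained in that of [la]. Its term then
   vanishes; otherwise its runners form a pair in [P0], contradicting its absence from the list. *)
move=> mu [bmu smu_nu sub] nr; have pmu := balanced_partition bmu.
have smu := smu_le mu pmu sub.
have [_ [v [x' [y' [r _]]]]] := balanced_on_runners u0E bmu smu.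
have [s1 s2 e1 e2] := on_runners_two_quotient pmu smu r.
rewrite (shifted_schur_at_skew sal s1) (shifted_schur_at_skew sbe s2) e1 e2.
have [dx' dy' x0' y0' _] := r.
have [/existsP[i lt]|nlt1] := boolP [exists i, abacus K al i < x' i].
  by rewrite (skew_count_eq0 dx dx' lt) mul0r mulr0 mul0r.
have [/existsP[i lt]|nlt2] := boolP [exists i, abacus K be i < y' i].
  by rewrite (skew_count_eq0 dy dy' lt) mul0r mulr0.
rewrite !negb_exists in nlt1 nlt2.
have le1 i : x' i <= abacus K al i by rewrite leNgt (forallP nlt1).
have le2 i : y' i <= abacus K be i by rewrite leNgt (forallP nlt2).
have [a aE] := natv_surj x0' (fun i => le_lt_trans (le1 i) (xM i)).
have [b bE] := natv_surj y0' (fun i => le_lt_trans (le2 i) (yM i)).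
have rp : runner_pair k s (a, b).
  rewrite /runner_pair /= aE bE dx' dy' /=; apply/eqP.
  have := on_runners_sum smu r; have := on_runners_sum slaK ru.
  rewrite smu_nu -sumE -/s -muln2 PoszD PoszM.
  set D := \sum_i staircase _ _. clearbody D s; move: (\sum_(i < K) x' i) (\sum_(i < K) y' i) => X Y; lia.
case/negP: nr; apply/mapP; exists (a, b).
  by rewrite mem_enum unfold_in /P0 rp /= aE bE; apply/andP; split; apply/forallP.
symmetry; apply: (runner_partition_uniq rp); split=> //.
by exists v; rewrite /= aE bE.
Qed.

Theorem mainTheorem1 (nu la alpha beta : seq nat)
    (hnu : is_partition nu) (hnu_odd : all odd nu)
    (hnu_even : ~~ odd (sumn nu)) (hnu_pos : (0 < sumn nu)%N)
    (hla : balanced la) (hsize : (sumn nu <= sumn la)%N)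
    (hquot : is_two_quotient la (alpha, beta)) :
  g_char nu la =
    2 ^+ (sumn nu)./2 / (zfrak nu)%:R *
    \sum_(mu \in [set mu : seq nat |
                  [/\ balanced mu, sumn mu = sumn nu &
                      diagram mu `<=` diagram la]]%classic)
      (sigma mu * chi mu nu
       * shifted_schur_at (two_quotient mu).1 alpha
       * shifted_schur_at (two_quotient mu).2 beta).
Proof.
(* Large enough for [alpha] and [beta] to fit on runners of [K] beads and [la] on [K + K]. *)
pose K := (size la + size alpha + size beta)%N.
have pla := balanced_partition hla.
have sla : (size la <= K)%N by rewrite /K -addnA leq_addr.
have sal : (size alpha <= K)%N by rewrite /K addnAC leq_addl.
have sbe : (size beta <= K)%N by rewrite /K leq_addl.
have slaK : (size la <= K + K)%N by apply: leq_trans sla (leq_addr _ _).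
have [u0 u0E] := interleave_staircase K.
have [u ru] := quotient_on_runners pla slaK sal sbe hquot.
have [M [_ xM yM]] := int_bound (abacus K alpha) (abacus K beta).
have sum_la := on_runners_sum slaK ru.
have sum_0 := on_runners_sum (mu := [::]) (leq0n _) (staircase_on_runners u0E).
pose s := \sum_i abacus K alpha i + \sum_i abacus K beta i.
(* Compared with the empty partition, the runner positions of [la] exceed those of the staircases by
   half of |la| in total; this also shows that |la| is even. *)
have half_la : exists m : nat, m.*2 = sumn la /\
    \sum_i staircase K i + \sum_i staircase K i + m%:Z = s.
  exists (absz (s - (\sum_i staircase K i + \sum_i staircase K i))%R).
  move: sum_la sum_0; rewrite -/s /=.
  move: (\sum_(i < K + K) staircase (K + K) i) (\sum_(i < K) staircase K i) => D D0.
  clearbody s; lia.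
have [m [mE sumE]] := half_la.
have la_even : ~~ odd (sumn la) by rewrite -mE odd_double.
have nu0 : 0%N \notin nu by case/andP: hnu.
rewrite (g_charE pla hnu hnu_odd hnu_even la_even hsize); congr (_ * _).
set k := ((sumn la - sumn nu)./2)%N.
have kE : (sumn nu + k.*2 = sumn la)%N.
  have : ~~ odd (sumn la - sumn nu) by rewrite oddB // (negPf la_even) (negPf hnu_even).
  by rewrite /k => /negPf o; rewrite -[RHS](subnKC hsize) -[in RHS](odd_double_half (_ - _)) o.
have -> : (sumn la)./2 = m by rewrite -mE doubleK.
rewrite (sum_balanced_runners u0E pla sla sal sbe ru xM yM nu0 kE).
have s1 : sumn (nseq k 2 ++ nu) = sumn la by rewrite sumn_cat sumn_nseq -kE; lia.
have s2 : sumn (nseq m 2) = sumn la by rewrite sumn_nseq -mE; lia.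
rewrite (chi_psums pla slaK _ s1); last by rewrite mem_cat mem_nseq andbF.
rewrite (chi_psums pla slaK _ s2); last by rewrite mem_nseq andbF.
rewrite /psums foldr_cat -/(psums _ _) -/(psums _ _) -/(psums _ _).
have alt0 := @alternating_alternant (K + K).
have nn0 := @nneg_support_alternant (K + K).
have altnu := alternating_psums nu alt0; have nnnu := nneg_support_psums nu nn0.
rewrite -[beta_vec _]/(abacus (K + K) la).
(* Both character values of [la] pick up the sign of [u], so the quotient contains its square. *)
rewrite (alternating_on_runners (alternating_psums (nseq k 2) altnu) ru).
rewrite (alternating_on_runners (alternating_psums (nseq m 2) alt0) ru).
rewrite (psums2_staircase u0E sumE) (psums2_interleave k altnu nnnu xM yM).
have fact_neq0 j : (j`!)%:R != 0 :> algC by rewrite pnatr_eq0 -lt0n fact_gt0.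
have sign_inv (b : bool) : ((-1) ^+ b)^-1 = (-1) ^+ b :> algC by case: b; rewrite ?invrN1 ?invr1.
rewrite !invfM sign_inv sign_inv.
have sgn2 : (-1) ^+ odd_perm u * (-1) ^+ odd_perm u = 1 :> algC.
  by rewrite -signr_addb addbb.
set Gx := (skew_count _ (staircase K))^-1; set Gy := (skew_count _ (staircase K))^-1.
set S := \sum_(p | _) _; set s0 := _ ^+ odd_perm u0.
have regroup (a b b' c d : algC) :
    a * b' * (c * (b * S) * (c * (d * (Gx * Gy * s0)))) =
    (a * d) * (b * b') * (c * c) * (S * (Gx * Gy * s0)).
  by clearbody S Gx Gy s0; ring.
rewrite regroup sgn2 !divff // !mul1r mulr_suml; apply: eq_bigr => p _.
clearbody Gx Gy s0; move: (skew_count _ _) (skew_count _ _) (psums _ _ _) => g1 g2 B.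
by ring.
Qed.
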